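(* Let $\lambda$ be a contact form on a closed oriented smooth manifold $M$, and let $R$ be its Reeb field. Then the basic cohomology class $[d\lambda]\in H^2_b(M,\mathfrak{R})$ is non-zero, where $\mathfrak{R}$ is the 1-dimensional foliation of $M$ generated by $R$.
   Context: All manifolds, forms and vector fields are smooth. A contact form on an oriented manifold $M^{2n+1}$ is a 1-form $\lambda$ such that $\lambda\wedge(d\lambda)^n>0$. Its Reeb field $R$ is the unique vector field with $\lambda(R)=1$ and $\iota_R d\lambda=0$. Basic cohomology: for a foliation $\mathfrak{F}$ of $M$, let $C^k$ be the space of $k$-forms $\alpha$ on $M$ such that $\iota_Y\alpha=0$ and $\iota_Y d\alpha=0$ for every vector $Y$ tangent to $\mathfrak{F}$. With the usual exterior derivative $d^k: C^k\to C^{k+1}$ this is a cochain complex, and $H^k_b(M,\mathfrak{F})=\ker d^k/\operatorname{im} d^{k-1}$. Since $\iota_R d\lambda=0$ and $d(d\lambda)=0$, the form $d\lambda$ is a cocycle in $C^2$ for the foliation $\mathfrak{R}$.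
   Formalization: The manifold M is assumed nonempty and of dimension 2n+1 with n ≥ 1; on a circle (n = 0) or on the empty manifold dλ = 0, so its basic class is zero and the claim fails. *)

(* Defs.v *)
From HB Require Import structures.
From mathcomp Require Import all_boot all_order all_algebra all_fingroup.
From mathcomp Require Import all_classical all_reals all_analysis.

Set Implicit Arguments.
Unset Strict Implicit.
Unset Printing Implicit Defensive.

Import Order.TTheory GRing.Theory Num.Theory.
Import numFieldNormedType.Exports.

Local Open Scope classical_set_scope.
Local Open Scope ring_scope.

(* [f] is of class C^r on [U]; meant for [U] open. *)
Fixpoint Cr_on (R : realType) (m : nat) (W : normedModType R) (r : nat)
    (U : set 'rV[R]_m) (f : 'rV[R]_m -> W) : Prop :=
  {in U, continuous f} /\
  if r is r'.+1 then
    forall i : 'I_m,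
      (forall x, U x -> derivable f x (delta_mx 0 i)) /\
      Cr_on r' U (fun x => 'D_(delta_mx 0 i) f x)
  else True.

Definition smooth_on (R : realType) (m : nat) (W : normedModType R)
    (U : set 'rV[R]_m) (f : 'rV[R]_m -> W) : Prop :=
  forall r, Cr_on r U f.

(* A smooth m-manifold without boundary, oriented by its atlas: all coordinate
   changes have positive Jacobian determinant, and all charts of the atlas are
   positively oriented.  [chart i] and [chart_inv i] are only meaningful on
   [chart_dom i] and on its image [chart_cod i].  [chart_at p] is a preferred
   chart around [p]. *)
Record oriented_manifold (R : realType) (m : nat) := OrientedManifold {
  manifold_carrier :> topologicalType;
  chart_index : Type;
  chart_dom : chart_index -> set manifold_carrier;
  chart_cod : chart_index -> set 'rV[R]_m;
  chart : chart_index -> manifold_carrier -> 'rV[R]_m;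
  chart_inv : chart_index -> 'rV[R]_m -> manifold_carrier;
  chart_at : manifold_carrier -> chart_index;
  manifold_hausdorff : hausdorff_space manifold_carrier;
  manifold_second_countable : @second_countable manifold_carrier;
  chart_dom_open : forall i, open (chart_dom i);
  chart_cod_open : forall i, open (chart_cod i);
  chart_cont : forall i, {in chart_dom i, continuous (chart i)};
  chart_inv_cont : forall i, {in chart_cod i, continuous (chart_inv i)};
  chart_mem : forall i p, chart_dom i p -> chart_cod i (chart i p);
  chart_inv_mem : forall i x, chart_cod i x -> chart_dom i (chart_inv i x);
  chartK : forall i p, chart_dom i p -> chart_inv i (chart i p) = p;
  chart_invK : forall i x, chart_cod i x -> chart i (chart_inv i x) = x;
  chart_at_mem : forall p, chart_dom (chart_at p) p;
  transition_smooth : forall i j,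
    smooth_on [set x | chart_cod i x /\ chart_dom j (chart_inv i x)]
              (chart j \o chart_inv i);
  transition_oriented : forall i j x,
    chart_cod i x -> chart_dom j (chart_inv i x) ->
    0 < \det (jacobian (chart j \o chart_inv i) x)
}.

Section Manifold.
Context {R : realType} {m : nat} {M : oriented_manifold R m}.

(* Differential of the coordinate change from chart [i] to chart [j] at the
   point of coordinates [x]; it acts on row vectors by [v *m _]. *)
Definition transition_mx (i j : chart_index M) (x : 'rV[R]_m) : 'M[R]_m :=
  jacobian (chart j \o chart_inv i) x.

(* The tangent space of M at p is identified with R^m by means of the
   preferred chart [chart_at p]; so a vector field takes values in R^m, and
   smoothness has to be tested after passing to the coordinates of a fixed
   chart. *)
Definition vector_field : Type := M -> 'rV[R]_m.

Definition smooth_vector_field (X : vector_field) : Prop :=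
  forall i : chart_index M,
    smooth_on (chart_cod i) (fun x =>
      let p := chart_inv i x in
      let c := chart_at p in
      X p *m transition_mx c i (chart c p)).

(* The arguments v_0, ..., v_{k-1} of a k-form at a point are the rows of a
   k x m matrix. *)
Definition diff_form (k : nat) : Type := M -> 'M[R]_(k, m) -> R.

Definition multilinear (k : nat) (f : 'M[R]_(k, m) -> R) : Prop :=
  forall (A B C : 'M[R]_(k, m)) (i : 'I_k) (b c : R),
    row i A = b *: row i B + c *: row i C ->
    row' i B = row' i A -> row' i C = row' i A ->
    f A = b * f B + c * f C.

Definition alternating (k : nat) (f : 'M[R]_(k, m) -> R) : Prop :=
  forall (A : 'M[R]_(k, m)) (i j : 'I_k),
    i != j -> row i A = row j A -> f A = 0.

(* Expression of a form in the coordinates of chart [i], i.e. its pullback by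
   [chart_inv i]. *)
Definition local_form (k : nat) (i : chart_index M) (a : diff_form k)
    (x : 'rV[R]_m) (A : 'M[R]_(k, m)) : R :=
  let p := chart_inv i x in a p (A *m transition_mx i (chart_at p) x).

Definition smooth_form (k : nat) (a : diff_form k) : Prop :=
  (forall p, multilinear (a p) /\ alternating (a p)) /\
  forall (i : chart_index M) (A : 'M[R]_(k, m)),
    smooth_on (chart_cod i) (fun x => local_form i a x A).

(* (da)(v_0, ..., v_k) = \sum_i (-1)^i D_{v_i} (a(v_0, ..^.., v_k)) for
   constant v_0, ..., v_k in the coordinates of the preferred chart at p. *)
Definition ext_d (k : nat) (a : diff_form k) : diff_form k.+1 :=
  fun p A =>
    let c := chart_at p in
    \sum_(i < k.+1) (-1) ^+ i *
      'D_(row i A) (fun x => local_form c a x (row' i A)) (chart c p).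

Definition wedge_prod (k l : nat) (a : diff_form k) (b : diff_form l) :
    diff_form (k + l) :=
  fun p A =>
    (k`! * l`!)%:R^-1 *
    \sum_(s : 'S_(k + l))
      (-1) ^+ s * (a p (usubmx (row_perm s A)) * b p (dsubmx (row_perm s A))).

Fixpoint wedge_exp (k : nat) (a : diff_form k) (j : nat) : diff_form (j * k) :=
  if j is j'.+1 then wedge_prod a (@wedge_exp k a j') else fun _ _ => 1.

(* Contraction at a point; the contraction of a 0-form is 0. *)
Definition interior_prod (k : nat) (Y : 'rV[R]_m) :
    ('M[R]_(k, m) -> R) -> 'M[R]_(k.-1, m) -> R :=
  if k is k'.+1 then fun f A => f (col_mx Y A : 'M[R]_(1 + k', m))
  else fun _ _ => 0.

(* The rows of [1%:M] are the coordinate frame of the preferred chart, which is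
   positively oriented. *)
Definition positive_volume (a : diff_form m) : Prop := forall p, 0 < a p 1%:M.

Definition reeb_field (lam : diff_form 1) (X : vector_field) : Prop :=
  smooth_vector_field X /\
  forall p, lam p (X p) = 1 /\ interior_prod (X p) (ext_d lam p) = 0.

(* A foliation enters basic cohomology only through its tangent spaces. *)
Definition tangent_distribution : Type := M -> set 'rV[R]_m.

Definition foliation_of (X : vector_field) : tangent_distribution :=
  fun p => [set t *: X p | t in [set: R]].

Section BasicCohomology.
Context (F : tangent_distribution).

Definition basic_form (k : nat) : set (diff_form k) :=
  [set a | smooth_form a /\
           forall p Y, F p Y ->
             interior_prod Y (a p) = 0 /\ interior_prod Y (ext_d a p) = 0].

Definition basic_cocycle (k : nat) : set (diff_form k) :=
  [set a | basic_form a /\ ext_d a = 0].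

Definition basic_coboundary (k : nat) : set (diff_form k) :=
  if k is k'.+1 then @ext_d k' @` @basic_form k' else [set 0].

(* The coset of [a] modulo coboundaries, an element of ker d / im d when [a]
   is a cocycle. *)
Definition basic_class (k : nat) (a : diff_form k) : set (diff_form k) :=
  [set b | basic_cocycle b /\ basic_coboundary (b - a)].

End BasicCohomology.

End Manifold.

Arguments vector_field {R m} M.
Arguments diff_form {R m} M k.
Arguments tangent_distribution {R m} M.
Arguments wedge_exp {R m M k} a j.

Definition contact_form (R : realType) (n : nat)
    (M : oriented_manifold R (n * 2).+1) (lam : diff_form M 1) : Prop :=
  smooth_form lam /\ positive_volume (wedge_prod lam (wedge_exp (ext_d lam) n)).

(* Main.v *)
(* Suppose d lam = d b with b basic. Then mu := lam - b is closed, and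
   b /\ (d lam)^n = 0 because every factor is annihilated by the Reeb field; hence
   mu /\ (d lam)^n = lam /\ (d lam)^n > 0. With a C^1 partition of unity rho_l,
     mu /\ (d lam)^n = sum_l mu /\ d(rho_l lam) /\ (d lam)^(n-1),
   and each summand is supported in one chart, where it is a sum of determinants
   with all columns but the second closed and the second one a gradient: by Piola's
   identity it is the divergence of a compactly supported field and integrates to 0.

   The integral over R^m of a compactly supported f is replaced by the Riemann sums
   (N+1)^-m sum_(k in Z^m) f(k/(N+1)). The sums of a partial derivative tend to 0 as
   they are close to those of a difference quotient, which vanish by translation
   invariance. Under a change of variables y = phi x they agree up to o(1): g is
   approximated by its interpolation with hat functions on a fine lattice, which is
   pulled back by the affine maps tangent to phi, and the linear case reduces by the
   LUP decomposition to one-dimensional sums and to unitriangular maps, for which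
   rounding to the lattice is injective. *)
From HB Require Import structures.
Require Import Defs.
From mathcomp Require Import all_boot all_order all_algebra all_fingroup.
From mathcomp Require Import all_classical all_reals all_analysis.
From mathcomp Require Import ring lra zify.
Import Order.TTheory GRing.Theory Num.Theory.
Import numFieldNormedType.Exports.
Local Open Scope classical_set_scope.
Local Open Scope ring_scope.

Set Implicit Arguments.
Unset Strict Implicit.
Unset Printing Implicit Defensive.

(** * Lattice Riemann sums *)

(** No limit of the sums of a form is ever shown to exist. Charts are compared through differences
    that tend to 0, and the contradiction is between sums of a non-negative density that stay above
    a positive constant and the same sums tending to 0.

    The localisation acts on one factor d lam because it must preserve closedness: rho_l mu would no
    longer be closed, whereas d(rho_l lam) is still exact and still adds up to d lam.

    The price is regularity. As rho_l is only C^1, d(rho_l lam) is only continuous and cannot be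
    differentiated. Piola's identity never does so: the cofactors along the gradient column involve
    the other columns alone, and these are C^1. To have a single such column, d a is written in
    coordinates as the sum over b of d(a_b) /\ dx_b. *)

Section LatticeSums.
Context {R : realType} {m : nat}.
Implicit Types (f g : 'rV[R]_m -> R) (k : 'rV[int]_m) (N K r : nat).

Definition box K : seq 'rV[int]_m :=
  [seq \row_i ((t i)%:Z - K%:Z) | t : {ffun 'I_m -> 'I_(2 * K).+1}].

Lemma box_uniq K : uniq (box K).
Proof.
rewrite map_inj_uniq ?enum_uniq// => t u /rowP tu; apply/ffunP => i.
by apply: val_inj; have := tu i; rewrite !mxE => /addIr [].
Qed.

Lemma mem_box K k : (k \in box K) = [forall i, `|k 0 i| <= K%:Z].
Proof.
rewrite /box; apply/idP/forallP => [/mapP[t _ ->] i|kK].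
  rewrite mxE; have := ltn_ord (t i); rewrite ltnS.
  move: (nat_of_ord (t i)) => a aK; rewrite ler_norml; apply/andP; split; lia.
have kK' (i : 'I_m) : (absz (k ord0 i + K%:Z)%R < (2 * K).+1)%N.
  have := kK i; rewrite -[k 0 i]/(k ord0 i); move: (k ord0 i) => a.
  by rewrite ler_norml => /andP[? ?]; lia.
apply/mapP; exists [ffun i => Ordinal (kK' i)]; rewrite ?mem_enum//; apply/rowP => i.
rewrite !mxE ffunE /=; have := kK i; rewrite -[k 0 i]/(k ord0 i).
by move: (k ord0 i) => a; rewrite ler_norml => /andP[? ?]; lia.
Qed.

Lemma size_box K : size (box K) = ((2 * K).+1 ^ m)%N.
Proof. by rewrite size_map -cardE card_ffun !card_ord. Qed.

Definition lat N k : 'rV[R]_m := \row_i ((k 0 i)%:~R / N.+1%:R).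

(** The sum is finitely supported, with value 0 by convention when infinitely many terms are
    non-zero. Ranging over the whole lattice rather than over a box, it is invariant under
    translations and permutations of the coordinates. *)
Definition lsum N f : R :=
  (\sum_(k \in [set: 'rV[int]_m]) f (lat N k)) / N.+1%:R ^+ m.

Definition supp_in r f := forall x, f x != 0 -> forall i, `|x 0 i| <= r%:R.

Lemma lat_box r N k : (forall i, `|lat N k 0 i| <= r%:R) -> k \in box (r * N.+1).
Proof.
move=> kr; rewrite mem_box; apply/forallP => i; have := kr i.
rewrite mxE normrM normfV (ger0_norm (ler0n _ _)) ler_pdivrMr ?ltr0n//.
by rewrite -natrM -intr_norm -(ler_int R).
Qed.

Lemma lsumE r N f : supp_in r f ->
  lsum N f = (\sum_(k <- box (r * N.+1)) f (lat N k)) / N.+1%:R ^+ m.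
Proof.
move=> fr; congr (_ / _); rewrite (@fsbigE _ _ _ _ _ (box (r * N.+1)))//.
- by apply: eq_bigl => k; rewrite in_setT.
- exact: box_uniq.
- move=> k _; apply: contraNeq => /fr; exact: lat_box.
Qed.

Lemma eq_lsum N f g : f =1 g -> lsum N f = lsum N g.
Proof. by move=> /funext ->. Qed.

Lemma supp_in_le r r' f : (r <= r')%N -> supp_in r f -> supp_in r' f.
Proof. by move=> rr fr x /fr fx i; rewrite (le_trans (fx i))// ler_nat. Qed.

Lemma supp_inD r f g : supp_in r f -> supp_in r g -> supp_in r (fun x => f x + g x).
Proof.
move=> fr gr x fgx; have [fx|/fr//] := eqVneq (f x) 0.
by apply: gr; move: fgx; rewrite fx add0r.
Qed.

Lemma supp_inN r f : supp_in r f -> supp_in r (fun x => - f x).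
Proof. by move=> fr x; rewrite oppr_eq0 => /fr. Qed.

Lemma supp_inMr r f g : supp_in r g -> supp_in r (fun x => f x * g x).
Proof. by move=> fr x; rewrite mulf_eq0 negb_or => /andP[_ /fr]. Qed.

Lemma lsumD r N f g : supp_in r f -> supp_in r g ->
  lsum N (fun x => f x + g x) = lsum N f + lsum N g.
Proof.
move=> fr gr; rewrite !(@lsumE r)//; last exact: supp_inD.
by rewrite big_split/= mulrDl.
Qed.

Lemma lsumZ N (c : R) f : lsum N (fun x => c * f x) = c * lsum N f.
Proof. by rewrite /lsum mulrA mulr_fsumr. Qed.

Lemma lsumN N f : lsum N (fun x => - f x) = - lsum N f.
Proof.
by rewrite -mulN1r -lsumZ; apply: eq_lsum => x; rewrite mulN1r.
Qed.

Lemma lsumB r N f g : supp_in r f -> supp_in r g ->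
  lsum N (fun x => f x - g x) = lsum N f - lsum N g.
Proof.
by move=> fr gr; rewrite (@lsumD r) ?lsumN//; exact: supp_inN.
Qed.

Lemma lsum0 N : lsum N (fun=> 0) = 0.
Proof. by rewrite -[RHS](mul0r (lsum N (fun=> 0))) -lsumZ; apply: eq_lsum => x; rewrite mul0r. Qed.

Lemma supp_in_sum (I : Type) (s : seq I) (F : I -> 'rV[R]_m -> R) :
  (forall i, exists r, supp_in r (F i)) ->
  exists r, supp_in r (fun x => \sum_(i <- s) F i x).
Proof.
move=> Fr; elim: s => [|i s [r rP]].
  by exists 0 => x; rewrite big_nil eqxx.
have [ri riP] := Fr i; exists (maxn ri r) => x; rewrite big_cons.
exact: (supp_inD (supp_in_le (leq_maxl _ _) riP) (supp_in_le (leq_maxr _ _) rP)).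
Qed.

Lemma lsum_sum N (I : Type) (s : seq I) (F : I -> 'rV[R]_m -> R) :
  (forall i, exists r, supp_in r (F i)) ->
  lsum N (fun x => \sum_(i <- s) F i x) = \sum_(i <- s) lsum N (F i).
Proof.
move=> Fr; elim: s => [|i s IH].
  by rewrite big_nil -[RHS](lsum0 N); apply: eq_lsum => x; rewrite big_nil.
have [ri riP] := Fr i; have [r rP] := supp_in_sum s Fr.
rewrite big_cons -IH -(@lsumD (maxn ri r)).
- by apply: eq_lsum => x; rewrite big_cons.
- by apply: supp_in_le riP; rewrite leq_maxl.
- by apply: supp_in_le rP; rewrite leq_maxr.
Qed.

Lemma lsum_le r N f g : supp_in r f -> supp_in r g -> (forall x, f x <= g x) ->
  lsum N f <= lsum N g.
Proof.
move=> fr gr fg; rewrite !(@lsumE r)// ler_wpM2r ?invr_ge0 ?exprn_ge0//.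
exact: ler_sum.
Qed.

Lemma lsum_ge0 N f : (forall x, 0 <= f x) -> 0 <= lsum N f.
Proof.
by move=> f0; rewrite mulr_ge0 ?invr_ge0 ?exprn_ge0// fsumr_ge0.
Qed.

(** The bound does not depend on N: it is what turns a uniform estimate of functions into an
    estimate of their sums. *)
Lemma box_vol r N :
  (size (box (r * N.+1)))%:R / N.+1%:R ^+ m <= (2 * r%:R + 1) ^+ m :> R.
Proof.
rewrite size_box natrX -expr_div_n lerXn2r ?nnegrE ?divr_ge0 ?addr_ge0 ?mulr_ge0//.
rewrite ler_pdivrMr ?ltr0n// -[2 * _]natrM natr1 -natrM ler_nat; lia.
Qed.

Lemma lsum_norm_le r N f (c : R) : supp_in r f -> (forall x, `|f x| <= c) ->
  `|lsum N f| <= (2 * r%:R + 1) ^+ m * c.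
Proof.
move=> fr fc; have c0 : 0 <= c by apply: le_trans (fc 0).
rewrite (@lsumE r)// normrM normfV [`|_ ^+ m|]ger0_norm ?exprn_ge0//.
apply: le_trans (ler_wpM2r c0 (box_vol r N)).
rewrite [leRHS]mulrAC ler_wpM2r ?invr_ge0 ?exprn_ge0//.
apply: le_trans (ler_norm_sum _ _ _) _.
apply: (@le_trans _ _ (\sum_(k <- box (r * N.+1)) c)); first exact: ler_sum.
by rewrite big_const_seq count_predT iter_addr_0 mulr_natl.
Qed.

Lemma lat_shift N k i :
  lat N (k + delta_mx 0 i) = lat N k + N.+1%:R^-1 *: delta_mx 0 i.
Proof.
apply/rowP => j; rewrite !mxE eqxx/= rmorphD/= mulrDl.
by congr (_ + _); case: (j == i); rewrite ?mul1r ?mulr1 ?mul0r ?mulr0.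
Qed.

Lemma lsum_shift N f i :
  lsum N (fun x => f (x + N.+1%:R^-1 *: delta_mx 0 i)) = lsum N f.
Proof.
congr (_ / _); rewrite [RHS](@reindex_fsbigT _ _ _ _ _ (fun k => k + delta_mx 0 i)).
  by apply: eq_fsbigr => k _; rewrite lat_shift.
by exists (fun k => k - delta_mx 0 i) => k; rewrite (addrK, subrK).
Qed.

(** Distinct indices contribute distinct terms of the sum of f, and the terms left out are
    non-negative. Surjectivity is not asked of psi, so that rounding maps qualify; the reverse
    inequality will come from the inverse linear map. *)
Lemma lsum_inj r r' N f (psi : 'rV[int]_m -> 'rV[int]_m) : injective psi ->
  supp_in r f -> (forall x, 0 <= f x) ->
  (\sum_(k <- box r') f (lat N (psi k))) / N.+1%:R ^+ m <= lsum N f.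
Proof.
move=> psi_inj fr f0; rewrite (@lsumE r)// ler_wpM2r ?invr_ge0 ?exprn_ge0//.
rewrite -(big_map psi xpredT (fun k => f (lat N k))).
rewrite [leLHS](bigID (fun k => k \in box (r * N.+1)))/= [X in _ + X]big1 ?addr0.
  rewrite -big_filter; set s := [seq _ <- _ | _].
  have us : uniq s by rewrite filter_uniq// map_inj_uniq ?box_uniq.
  have ss : {subset s <= box (r * N.+1)} by move=> k; rewrite mem_filter => /andP[].
  have E : \sum_(k <- s) f (lat N k) =
      \sum_(k <- box (r * N.+1) | k \in s) f (lat N k).
    rewrite -[RHS]big_filter; apply: perm_big; apply: uniq_perm => //.
      by rewrite filter_uniq ?box_uniq.
    by move=> k; rewrite [in RHS]mem_filter; case: (boolP (k \in s)) => //= /ss ->.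
  rewrite E [leRHS](bigID (fun k => k \in s))/=.
  by rewrite lerDl sumr_ge0.
move=> k /negP kb; apply/eqP/negPn/negP => /fr /lat_box; exact: kb.
Qed.

End LatticeSums.

(** * Lattice sums of a partial derivative *)

Section Lines.
Context {R : realType} {V : normedModType R}.

Lemma is_derive_line (f : V -> R) (x v : V) (t : R) :
  derivable f (x + t *: v) v ->
  is_derive t 1 (fun s => f (x + s *: v)) ('D_v f (x + t *: v)).
Proof.
have E : (fun h : R => h^-1 *: (f (x + (h *: (1 : R) + t) *: v) - f (x + t *: v))) =
    (fun h => h^-1 *: (f (h *: v + (x + t *: v)) - f (x + t *: v))).
  apply/funext => h; congr (_ *: (f _ - _)).
  by rewrite scalerDl scaler1 addrCA.
move=> fx; apply: DeriveDef; first by rewrite /derivable E.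
by rewrite /derive E.
Qed.

Lemma line_MVT (f : V -> R) (x v : V) (t : R) : 0 < t ->
  (forall s, 0 <= s <= t -> derivable f (x + s *: v) v) ->
  exists2 s, 0 <= s <= t & f (x + t *: v) - f x = t * 'D_v f (x + s *: v).
Proof.
move=> t0 fd.
have dphi s : 0 <= s <= t ->
    is_derive s 1 (fun s => f (x + s *: v)) ('D_v f (x + s *: v)).
  by move=> st; apply: is_derive_line; exact: fd.
have [||s] := @MVT R (fun s => f (x + s *: v)) (fun s => 'D_v f (x + s *: v)) 0 t t0.
- by move=> s; rewrite in_itv/= => /andP[s0 st]; apply: dphi; rewrite !ltW.
- apply: derivable_within_continuous => s; rewrite in_itv/= => st.
  by have [] := dphi s st.
rewrite in_itv/= => /andP[s0 st]; rewrite scale0r addr0 subr0 => ->.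
by exists s; rewrite ?ltW// mulrC.
Qed.

End Lines.

Lemma invS_small (R : realType) (d : R) : 0 < d ->
  \forall N \near \oo, N.+1%:R^-1 <= d.
Proof.
by move=> d0; near=> N; apply/ltW; near: N; exact: (near_infty_natSinv_lt (PosNum d0)).
Unshelve. all: by end_near. Qed.

Section LatticeDerivative.
Context {R : realType} {m : nat}.
Implicit Types (f g : 'rV[R]_m -> R).

Lemma supp_in_shift r f (v : 'rV[R]_m) : (forall i, `|v 0 i| <= 1) ->
  supp_in r f -> supp_in r.+1 (fun x => f (x + v)).
Proof.
move=> v1 fr x /fr xr i; have := xr i; rewrite mxE => xvr.
rewrite -natr1 -[x 0 i](addrK (v 0 i)) (le_trans (ler_normB _ _))// lerD//.
Qed.

Lemma lsum_derive r g (i : 'I_m) : supp_in r g ->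
  supp_in r (fun x => 'D_(delta_mx 0 i) g x) ->
  (forall x, derivable g x (delta_mx 0 i)) ->
  (forall e, 0 < e -> exists2 d, 0 < d & forall x t, 0 <= t <= d ->
    `|'D_(delta_mx 0 i) g (x + t *: delta_mx 0 i) - 'D_(delta_mx 0 i) g x| <= e) ->
  lsum N (fun x => 'D_(delta_mx 0 i) g x) @[N --> \oo] --> 0.
Proof.
move=> gr Gr gd Guc; set v := delta_mx 0 i; set G := fun x => 'D_v g x.
apply/cvgrPdist_le => e e0.
pose C : R := (2 * r.+1%:R + 1) ^+ m.
have C0 : 0 < C by rewrite exprn_gt0// addr_gt0// mulr_gt0// ltr0n.
have [d d0 Gd] := Guc (e / C) (divr_gt0 e0 C0).
near=> N.
pose h : R := N.+1%:R^-1.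
have h0 : 0 < h by rewrite invr_gt0 ltr0n.
have h1 : h <= 1 by rewrite invf_le1 ?ltr0n// ler1n.
have hv j : `|(h *: v) 0 j| <= 1.
  rewrite !mxE eqxx/=; case: (j == i); rewrite ?mulr1 ?mulr0 ?normr0//.
  by rewrite ger0_norm// ltW.
have hd : N.+1%:R^-1 <= d by near: N; exact: invS_small.
pose q x := h^-1 * (g (x + h *: v) - g x).
have gr' : supp_in r.+1 g by apply: supp_in_le gr.
have Gr' : supp_in r.+1 G by apply: supp_in_le Gr.
have gs : supp_in r.+1 (fun x => g (x + h *: v)) by exact: supp_in_shift.
have qr : supp_in r.+1 q.
  by apply: supp_inMr; apply: supp_inD => //; exact: supp_inN.
have q0 : lsum N q = 0.
  by rewrite lsumZ (@lsumB _ _ r.+1)// lsum_shift subrr mulr0.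
have -> : lsum N G = lsum N (fun x => G x - q x).
  by rewrite (@lsumB _ _ r.+1)// q0 subr0.
rewrite sub0r normrN.
have -> : e = C * (e / C) by rewrite mulrC divfK ?gt_eqF.
apply: lsum_norm_le => [|x]; first by apply: supp_inD => //; exact: supp_inN.
have [s /andP[s0 sh] E] := @line_MVT _ _ g x v h h0 (fun s _ => gd _).
rewrite /q E mulrA mulVf ?gt_eqF// mul1r distrC Gd// s0 /=.
exact: le_trans hd.
Unshelve. all: by end_near. Qed.

End LatticeDerivative.

Section MatrixNorm.
Context {R : realType}.

Lemma coord_le_norm p q (A : 'M[R]_(p, q)) i j : `|A i j| <= `|A|.
Proof.
by rewrite [leRHS]/Num.Def.normr/= mx_normrE; exact: (le_bigmax _ _ (i, j)).
Qed.

Lemma mx_norm_le p q (A : 'M[R]_(p, q)) (c : R) : 0 <= c ->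
  (forall i j, `|A i j| <= c) -> `|A| <= c.
Proof.
move=> c0 Ac; rewrite [leLHS]/Num.Def.normr/= mx_normrE bigmax_le// => -[i j] _.
Qed.

Lemma norm_mulmx_le p q (v : 'rV[R]_p) (A : 'M[R]_(p, q)) :
  `|v *m A| <= p%:R * `|A| * `|v|.
Proof.
apply: mx_norm_le => [|i j]; first by rewrite !mulr_ge0.
rewrite mxE (le_trans (ler_norm_sum _ _ _))//.
apply: (@le_trans _ _ (\sum_(l < p) (`|A| * `|v|))).
  apply: ler_sum => l _; rewrite normrM mulrC.
  by rewrite ler_pM ?coord_le_norm.
by rewrite sumr_const card_ord -mulrA mulr_natl.
Qed.

End MatrixNorm.

(** * Hat functions and their lattice sums *)

Section Tent.
Context {R : realType}.
Implicit Types (a s t u : R).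

Definition pospart t : R := Num.max 0 t.

(* The second difference of the positive part: the hat function of [-1, 1]. *)
Definition tent t : R := pospart (t + 1) - 2 * pospart t + pospart (t - 1).

Lemma tentE t : tent t = Num.max 0 (1 - `|t|).
Proof.
rewrite /tent /pospart; case: (ger0P t) => t0.
  have [|] := leP 0 (t + 1); have [|] := leP 0 t; have [|] := leP 0 (t - 1);
  have [|] := leP 0 (1 - t); lra.
have [|] := leP 0 (t + 1); have [|] := leP 0 t; have [|] := leP 0 (t - 1);
have [|] := leP 0 (1 - - t); lra.
Qed.

Lemma tent_ge0 t : 0 <= tent t.
Proof. by rewrite tentE le_max lexx. Qed.

Lemma tent_le1 t : tent t <= 1.
Proof. by rewrite tentE ge_max ler01 gerBl normr_ge0. Qed.

Lemma tent_supp t : tent t != 0 -> `|t| < 1.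
Proof.
rewrite tentE; case: (leP 0 (1 - `|t|)); last by rewrite eqxx.
by rewrite subr_ge0 le_eqVlt => /predU1P[->|//]; rewrite subrr eqxx.
Qed.

Lemma tentN t : tent (- t) = tent t.
Proof. by rewrite !tentE normrN. Qed.

Lemma tent_lip t u : `|tent t - tent u| <= `|t - u|.
Proof.
rewrite !tentE; have /= := ler_dist_dist t u; move: `|t| `|u| `|t - u| => a b c.
case: (leP 0 (1 - a)); case: (leP 0 (1 - b)); rewrite !ler_norml => ? ? /andP[? ?];
  apply/andP; split; lra.
Qed.

(** The hat function is a second difference, so the sum telescopes to the unit difference D of the
    positive part, which is 1 at the right end and 0 at the left one. *)
Lemma tent_partition a n : a <= 0 -> 0 <= a + n%:R ->
  \sum_(j < n.+1) tent (a + j%:R) = 1.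
Proof.
move=> a0 an; pose D u := pospart (u + 1) - pospart u.
have -> : \sum_(j < n.+1) tent (a + j%:R) = D (a + n%:R) - D (a - 1).
  elim: n {an} => [|n IH]; last first.
    rewrite big_ord_recr/= IH -natr1 [a + (_ + 1)]addrA /tent /D addrK; lra.
  by rewrite big_ord1 addr0 /tent /D subrK; lra.
rewrite /D /pospart.
have -> : Num.max 0 (a + n%:R + 1) = a + n%:R + 1 by apply/max_idPr; lra.
have -> : Num.max 0 (a + n%:R) = a + n%:R by apply/max_idPr; lra.
have -> : Num.max 0 (a - 1 + 1) = 0 by apply/max_idPl; lra.
have -> : Num.max 0 (a - 1) = 0 by apply/max_idPl; lra.
lra.
Qed.

(** First-order Taylor expansion of the squared positive part, whose derivative is twice the
    positive part. The sign of the remainder is recorded because three such remainders will be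
    combined with weights of both signs. *)
Lemma pospart_sqr_incr t s : 0 <= s ->
  0 <= pospart (t + s) ^+ 2 - pospart t ^+ 2 - 2 * s * pospart t <= s ^+ 2.
Proof.
move=> s0; rewrite /pospart; case: (leP 0 t) => t0; case: (leP 0 (t + s)) => ts;
  apply/andP; split; nra.
Qed.

(** [Phi] is a primitive of the hat function, with total increment 1; each step of the Riemann sum
    differs from the increment of [Phi] by at most s^2. *)
Lemma tent_riemann a s n : 0 < s -> a <= -1 -> 1 <= a + n%:R * s ->
  `|s * (\sum_(j < n) tent (a + j%:R * s)) - 1| <= n%:R * s ^+ 2.
Proof.
move=> s0 a1 an.
pose Phi u := (pospart (u + 1) ^+ 2 - 2 * pospart u ^+ 2 + pospart (u - 1) ^+ 2) / 2.
have Phi1 : Phi (a + n%:R * s) - Phi a = 1.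
  rewrite /Phi /pospart.
  have -> : Num.max 0 (a + n%:R * s + 1) = a + n%:R * s + 1 by apply/max_idPr; lra.
  have -> : Num.max 0 (a + n%:R * s) = a + n%:R * s by apply/max_idPr; lra.
  have -> : Num.max 0 (a + n%:R * s - 1) = a + n%:R * s - 1 by apply/max_idPr; lra.
  have -> : Num.max 0 (a + 1) = 0 by apply/max_idPl; lra.
  have -> : Num.max 0 a = 0 by apply/max_idPl; lra.
  have -> : Num.max 0 (a - 1) = 0 by apply/max_idPl; lra.
  by field.
rewrite -[X in _ - X]Phi1 {a1 an Phi1}; elim: n => [|n IH].
  by rewrite big_ord0 mul0r mulr0 addr0 mul0r !subrr normr0.
rewrite big_ord_recr/=; set b := a + n%:R * s.
have -> : a + n.+1%:R * s = b + s by rewrite /b -natr1; ring.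
(* The three remainders lie in [0, s^2] and enter with weights 1/2, -1 and 1/2, hence the bound
   s^2. *)
have step : `|Phi (b + s) - Phi b - s * tent b| <= s ^+ 2.
  have := pospart_sqr_incr (b + 1) (ltW s0).
  have := pospart_sqr_incr b (ltW s0).
  have := pospart_sqr_incr (b - 1) (ltW s0).
  rewrite /Phi /tent -[b + s + 1]addrAC -[b + s - 1]addrAC.
  rewrite ler_norml => /andP[? ?] /andP[? ?] /andP[? ?].
  apply/andP; split; lra.
have -> : s * (\sum_(j < n) tent (a + j%:R * s) + tent b) - (Phi (b + s) - Phi a) =
  (s * (\sum_(j < n) tent (a + j%:R * s)) - (Phi b - Phi a)) -
  (Phi (b + s) - Phi b - s * tent b) by ring.
rewrite -natr1 mulrDl mul1r; apply: le_trans (ler_normB _ _) _.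
exact: lerD.
Qed.

End Tent.

Section ProductsOverBoxes.
Context {R : realType} {m : nat}.
Implicit Types (f g : 'rV[R]_m -> R).

Lemma sum_box_prod K (F : 'I_m -> int -> R) :
  \sum_(k <- box K) \prod_i F i (k 0 i) =
  \prod_i \sum_(j < (2 * K).+1) F i (j%:Z - K%:Z).
Proof.
rewrite bigA_distr_bigA/= /box big_map -big_enum/=; apply: eq_bigr => t _.
by apply: eq_bigr => i _; rewrite mxE.
Qed.

Lemma prod_01_lip (s : seq 'I_m) (a b : 'I_m -> R) :
  (forall i, 0 <= a i <= 1) -> (forall i, 0 <= b i <= 1) ->
  `|\prod_(i <- s) a i - \prod_(i <- s) b i| <= \sum_(i <- s) `|a i - b i|.
Proof.
move=> a01 b01.
have p01 (c : 'I_m -> R) (u : seq 'I_m) : (forall i, 0 <= c i <= 1) ->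
    0 <= \prod_(i <- u) c i <= 1.
  move=> c01; apply/andP; split.
    by apply: prodr_ge0 => i _; case/andP: (c01 i).
  apply: prodr_ile1 => i _; exact: c01.
elim: s => [|i s IH]; first by rewrite !big_nil subrr normr0.
rewrite !big_cons.
set A := \prod_(j <- s) a j in IH *; set B := \prod_(j <- s) b j in IH *.
have -> : a i * A - b i * B = (a i - b i) * A + b i * (A - B) by ring.
rewrite (le_trans (ler_normD _ _))// !normrM lerD//.
  have /andP[A0 A1] := p01 a s a01.
  by rewrite [`|A|]ger0_norm// ler_piMr.
have /andP[b0 b1] := b01 i.
by rewrite (le_trans _ IH)// [`|b i|]ger0_norm// ler_piMl.
Qed.

(** The tensor-product hat function of the cube [-1, 1]^m; its integer translates form a partition
    of unity. *)
Definition kap (y : 'rV[R]_m) : R := \prod_i tent (y 0 i).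

Lemma kap_ge0 y : 0 <= kap y.
Proof. by apply: prodr_ge0 => i _; exact: tent_ge0. Qed.

Lemma kap_le1 y : kap y <= 1.
Proof. by apply: prodr_ile1 => i _; rewrite tent_ge0 tent_le1. Qed.

Lemma kap_supp y : kap y != 0 -> forall i, `|y 0 i| < 1.
Proof. by move=> /prodf_neq0 h i; apply: tent_supp; exact: h. Qed.

Lemma kap_lip x y : `|kap x - kap y| <= m%:R * `|x - y|.
Proof.
apply: (le_trans (prod_01_lip _ _ _)) => [i|i|]; rewrite ?tent_ge0 ?tent_le1//.
apply: (@le_trans _ _ (\sum_(i < m) `|x - y|)); last first.
  by rewrite sumr_const card_ord mulr_natl.
apply: ler_sum => i _; apply: le_trans (tent_lip _ _) _.
by have := coord_le_norm (x - y) 0 i; rewrite !mxE.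
Qed.

Lemma kap_partition K (y : 'rV[R]_m) : (forall i, `|y 0 i| <= K%:R) ->
  \sum_(k <- box K) kap (y - map_mx intr k) = 1.
Proof.
move=> yK.
rewrite (eq_bigr (fun k : 'rV[int]_m => \prod_i tent ((k 0 i)%:~R - y 0 i))); last first.
  by move=> k _; apply: eq_bigr => i _; rewrite !mxE -tentN opprB.
rewrite (sum_box_prod K (fun i (j : int) => tent (j%:~R - y 0 i))).
apply: big1 => i _; rewrite -[RHS](@tent_partition _ (- K%:R - y 0 i) (2 * K)).
- by apply: eq_bigr => j _; rewrite rmorphB/=; congr tent; rewrite -!pmulrn; ring.
- by have := yK i; rewrite ler_norml; lra.
- by have := yK i; rewrite ler_norml natrM; lra.
Qed.

(** Both the function and the box are products, so the sum factorises; up to the factor 1/|d_i|, the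
    i-th factor is a Riemann sum of the hat function with step |d_i|/(N+1). *)
Lemma lsum_kap_diag (d b : 'rV[R]_m) : (forall i, d 0 i != 0) ->
  lsum N (fun y : 'rV[R]_m => \prod_i tent (y 0 i * d 0 i + b 0 i)) @[N --> \oo]
    --> (`|\prod_i d 0 i|)^-1.
Proof.
move=> d0.
(* With this r the box contains the support of the product, and in each coordinate the sampled
   interval covers [-1, 1], as [tent_riemann] requires. *)
have [r rP] : exists r : nat, forall i, 1 + `|b 0 i| <= r%:R * `|d 0 i|.
  pose c := \sum_i ((1 + `|b 0 i|) / `|d 0 i|).
  exists (Num.truncn c).+1 => i; rewrite -ler_pdivrMr ?normr_gt0//.
  apply/ltW/(le_lt_trans _ (truncnS_gt c)).
  rewrite /c (bigD1 i)//=; apply: ler_wpDr => //; apply: sumr_ge0 => j _.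
  by rewrite divr_ge0// addr_ge0.
pose G (y : 'rV[R]_m) := \prod_i tent (y 0 i * d 0 i + b 0 i).
have Gr : supp_in r G.
  move=> y /prodf_neq0 h i; have /tent_supp := h i isT => tdb.
  rewrite -(ler_pM2r (_ : 0 < `|d 0 i|)) ?normr_gt0// -normrM -[_ * _](addrK (b 0 i)).
  apply: le_trans (rP i); apply: le_trans (ler_normB _ _) _; rewrite lerD2r; exact: ltW.
pose s N i := N.+1%:R^-1 * \sum_(j < (2 * (r * N.+1)).+1)
  tent ((j%:Z - (r * N.+1)%:Z)%:~R / N.+1%:R * d 0 i + b 0 i).
have E N : lsum N G = \prod_i s N i.
  rewrite (@lsumE _ _ r)// /s big_split/= prodr_const card_ord exprVn mulrC.
  congr (_ * _).
  rewrite -(sum_box_prod _ (fun i (j : int) => tent (j%:~R / N.+1%:R * d 0 i + b 0 i))).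
  by apply: eq_bigr => k _; apply: eq_bigr => i _; rewrite mxE.
rewrite (eq_cvg _ _ E) normr_prod -prodfV.
apply: cvg_big => [|i _]; first exact: mul_continuous.
 apply/cvgrPdist_le => e e0.
pose D := `|d 0 i|; have D0 : 0 < D by rewrite normr_gt0.
(* The hat function is even, so a negative d_i can be replaced by its absolute value if b_i changes
   sign. *)
pose b' := Num.sg (d 0 i) * b 0 i.
have b'b : `|b'| <= `|b 0 i|.
  by rewrite normrM normr_sg d0 mul1r.
near=> N; pose K := (r * N.+1)%N; pose sg := D / N.+1%:R.
have sg0 : 0 < sg by rewrite divr_gt0.
have Ksg : K%:R * sg = r%:R * D.
  by rewrite /K /sg natrM mulrACA [X in X = _]mulrC; field; rewrite gt_eqF.
have -> : s N i = N.+1%:R^-1 * \sum_(j < (2 * K).+1) tent (- (r%:R * D) + b' + j%:R * sg).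
  congr (_ * _); apply: eq_bigr => j _; rewrite -Ksg.
  have -> : - (K%:R * sg) + b' + j%:R * sg =
      Num.sg (d 0 i) * ((j%:Z - K%:Z)%:~R / N.+1%:R * d 0 i + b 0 i).
    rewrite rmorphB/= -!pmulrn /sg /D /b' normrEsg; field; rewrite gt_eqF//.
  by have := d0 i; case: sgrP => // _ _; rewrite ?mul1r// mulN1r tentN.
have := rP i; rewrite -/D => rD; have := b'b; rewrite ler_norml => /andP[? ?].
set T := \sum_(j < _) _.
have Tn : `|sg * T - 1| <= (2 * K).+1%:R * sg ^+ 2.
  apply: tent_riemann => //; first by lra.
  by rewrite -natr1 natrM mulrDl -mulrA Ksg; lra.
have -> : D^-1 - N.+1%:R^-1 * T = - (D^-1 * (sg * T - 1)).
  by rewrite /sg; field; rewrite !gt_eqF.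
rewrite normrN normrM gtr0_norm ?invr_gt0// mulrC ler_pdivrMr//.
apply: le_trans Tn _.
have -> : (2 * K).+1%:R * sg ^+ 2 = (2 * r%:R + N.+1%:R^-1) * N.+1%:R^-1 * D ^+ 2.
  by rewrite -natr1 /K !natrM /sg; field; rewrite gt_eqF.
have N1 : N.+1%:R^-1 <= 1 :> R by rewrite invf_le1// ler1n.
have : N.+1%:R^-1 <= e / ((2 * r%:R + 1) * D).
  by near: N; apply: invS_small; rewrite divr_gt0// mulr_gt0.
rewrite ler_pdivlMr ?mulr_gt0//.
move=> /(ler_wpM2r (ltW D0)); apply: le_trans.
rewrite -subr_ge0.
have -> : N.+1%:R^-1 * ((2 * r%:R + 1) * D) * D -
    (2 * r%:R + N.+1%:R^-1) / N.+1%:R * D ^+ 2 =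
    N.+1%:R^-1 * D ^+ 2 * (1 - N.+1%:R^-1) by ring.
by rewrite !mulr_ge0 ?invr_ge0 ?exprn_ge0 ?subr_ge0// ltW.
Unshelve. all: by end_near. Qed.

End ProductsOverBoxes.

(** * Linear changes of variables *)

Section LinearChangeOfVariables.
Context {R : realType}.

Definition lip m (c : R) (f : 'rV[R]_m -> R) :=
  forall x y, `|f x - f y| <= c * `|x - y|.

Lemma supp_in_norm m r (f : 'rV[R]_m -> R) x : supp_in r f -> f x != 0 -> `|x| <= r%:R.
Proof. by move=> fr /fr xr; apply: mx_norm_le => // i j; rewrite ord1. Qed.

Lemma norm_supp_in m (c : R) (f : 'rV[R]_m -> R) :
  (forall x, f x != 0 -> `|x| <= c) -> exists r, supp_in r f.
Proof.
move=> fc; exists (Num.truncn c).+1 => x /fc xc i.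
by rewrite (le_trans (coord_le_norm _ _ _))// (le_trans xc)// ltW ?truncnS_gt.
Qed.

Lemma supp_in_affine m r (f : 'rV[R]_m -> R) (A : 'M[R]_m) b : A \in unitmx ->
  supp_in r f -> exists r', supp_in r' (fun x => f (x *m A + b)).
Proof.
move=> Au fr; apply: (@norm_supp_in _ (m%:R * `|invmx A| * (r%:R + `|b|))) => x fx.
rewrite -[x](mulmxK Au) (le_trans (norm_mulmx_le _ _))// ler_wpM2l ?mulr_ge0//.
by rewrite -[x *m A](addrK b) (le_trans (ler_normB _ _))// lerD2r (supp_in_norm fr).
Qed.

Lemma lip_affine m c (f : 'rV[R]_m -> R) (A : 'M[R]_m) b : 0 <= c -> lip c f ->
  lip (c * (m%:R * `|A|)) (fun x => f (x *m A + b)).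
Proof.
move=> c0 fl x y; apply: le_trans (fl _ _) _.
rewrite opprD addrACA subrr addr0 -mulmxBl -mulrA ler_wpM2l//.
exact: norm_mulmx_le.
Qed.

(** Unitriangularity with respect to a rank of the indices: the order of the indices gives the upper
    triangular matrices, the reversed order the lower triangular ones. *)
Definition unitri m (rk : 'I_m -> nat) (L : 'M[R]_m) :=
  (forall i, L i i = 1) /\ (forall j i, j != i -> L j i != 0 -> (rk j < rk i)%N).

Definition floor_row m (L : 'M[R]_m) (k : 'rV[int]_m) : 'rV[int]_m :=
  \row_i Num.floor ((map_mx intr k *m L) 0 i).

(** By induction on the rank: coordinate i of k L is the integer k_i plus a combination of
    coordinates of smaller rank, already recovered, and the floor commutes with adding an
    integer. *)
Lemma floor_row_inj m (rk : 'I_m -> nat) (L : 'M[R]_m) : unitri rk L ->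
  injective (floor_row L).
Proof.
move=> [L1 Lt] k l kl; apply/rowP => i.
have [n] := ubnP (rk i); elim: n i => // n IH i; rewrite ltnS => rki.
have := congr1 (fun v : 'rV[int]_m => v 0 i) kl; rewrite !mxE.
rewrite (bigD1 i)//= [in RHS](bigD1 i)//= !L1 !mulr1 !mxE.
rewrite (eq_bigr (fun j => map_mx intr l 0 j * L j i)); last first.
  move=> j ji; have [->|Lji] := eqVneq (L j i) 0; first by rewrite !mulr0.
  by rewrite !mxE IH// (leq_trans (Lt _ _ ji Lji)).
by rewrite !floorDzr ?intr_int// !intrKfloor => /addIr.
Qed.

Lemma lat_floor_row m (L : 'M[R]_m) N k :
  `|lat N k *m L - lat N (floor_row L k)| <= N.+1%:R^-1.
Proof.
apply: mx_norm_le => [|i j]; first by rewrite invr_ge0.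
have -> : lat N k = N.+1%:R^-1 *: map_mx intr k :> 'rV[R]_m.
  by apply/rowP => l; rewrite !mxE mulrC.
rewrite -scalemxAl !ord1 [X in `|X|]mxE [X in X + _]mxE [X in _ + X]mxE !mxE.
set t := \sum_l _; have /andP[tl tu] := floor_itv t.
rewrite [_ / _]mulrC -mulrBr normrM gtr0_norm ?invr_gt0// ler_piMr ?invr_ge0//.
move: tu; rewrite intrD1 => tu.
rewrite ger0_norm ?subr_ge0//; lra.
Qed.

(** Rounding moves each sample point by at most 1/(N+1), which costs c/(N+1) by the Lipschitz bound;
    the rounded points are pairwise distinct lattice points, so [lsum_inj] applies. *)
Lemma lsum_unitri_le m (rk : 'I_m -> nat) (L : 'M[R]_m) r r' N f c :
  unitri rk L -> (forall x, 0 <= f x) -> 0 <= c -> lip c f -> supp_in r f ->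
  supp_in r' (fun x => f (x *m L)) ->
  lsum N (fun x => f (x *m L)) <= lsum N f + (2 * r'%:R + 1) ^+ m * (c * N.+1%:R^-1).
Proof.
move=> uL f0 c0 fl fr fLr.
apply: le_trans (lerD (@lsum_inj _ _ _ (r' * N.+1) N _ _ (floor_row_inj uL) fr f0) (lexx _)).
rewrite (@lsumE _ _ r')// -lerBlDl -mulrBl -sumrB.
apply: le_trans (ler_wpM2r _ (box_vol r' N)); last first.
  by rewrite mulr_ge0// invr_ge0.
rewrite mulrAC ler_wpM2r ?invr_ge0 ?exprn_ge0//.
apply: (@le_trans _ _ (\sum_(k <- box (m := m) (r' * N.+1)) (c * N.+1%:R^-1))).
  apply: ler_sum => k _; apply: le_trans (ler_norm _) _; apply: le_trans (fl _ _) _.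
  by rewrite ler_wpM2l// lat_floor_row.
by rewrite big_const_seq count_predT iter_addr_0 mulr_natl.
Qed.

(** The equation Y L = 1 is solved for the entries of Y by induction on the rank of the column. This
    is what makes the one-sided estimate available in both directions. *)
Lemma unitri_inv m (rk : 'I_m -> nat) (L : 'M[R]_m) : L \in unitmx ->
  unitri rk L -> unitri rk (invmx L).
Proof.
move=> Lu [L1 Lt]; set Y := invmx L.
have YE j i : Y j i = (j == i)%:R - \sum_(l | l != i) Y j l * L l i.
  have := congr1 (fun B : 'M[R]_m => B j i) (mulVmx Lu).
  by rewrite !mxE (bigD1 i)//= L1 mulr1 => <-; rewrite addrK.
have Y0 j i : j != i -> (rk i <= rk j)%N -> Y j i = 0.
  have [n] := ubnP (rk i); elim: n i => // n IH i; rewrite ltnS => rki ji ij.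
  rewrite YE (negbTE ji) sub0r big1 ?oppr0// => l li.
  have [->|Lli] := eqVneq (L l i) 0; first by rewrite mulr0.
  have lt_li := Lt _ _ li Lli.
  rewrite IH ?mul0r ?(leq_trans lt_li)//; last by rewrite (leq_trans (ltnW lt_li)).
  by apply: contraTneq (leq_trans lt_li ij) => ->; rewrite ltnn.
split=> [i|j i ji]; last first.
  by apply: contraNT; rewrite -leqNgt => /Y0 ->.
rewrite YE eqxx big1 ?subr0// => l li.
have [->|Lli] := eqVneq (L l i) 0; first by rewrite mulr0.
by rewrite Y0 ?mul0r 1?eq_sym// ltnW// Lt.
Qed.

Lemma lsum_unitri m (rk : 'I_m -> nat) (L : 'M[R]_m) r f c :
  L \in unitmx -> unitri rk L -> (forall x, 0 <= f x) -> 0 <= c -> lip c f ->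
  supp_in r f ->
  lsum N (fun x => f (x *m L)) - lsum N f @[N --> \oo] --> 0.
Proof.
move=> Lu uL f0 c0 fl fr.
have [r' r'P] := supp_in_affine 0 Lu fr.
have fLr : supp_in r' (fun x => f (x *m L)).
  by move=> x; have := r'P x; rewrite addr0.
have fl' : lip (c * (m%:R * `|L|)) (fun x => f (x *m L)).
  by move=> x y; have := lip_affine L 0 c0 fl x y; rewrite !addr0.
apply/cvgrPdist_le => e e0.
pose C := (2 * r'%:R + 1) ^+ m * c + (2 * r%:R + 1) ^+ m * (c * (m%:R * `|L|)) + 1.
have C1 : 0 <= (2 * r'%:R + 1) ^+ m * c.
  by rewrite mulr_ge0// exprn_ge0// addr_ge0// mulr_ge0.
have C2 : 0 <= (2 * r%:R + 1) ^+ m * (c * (m%:R * `|L|)).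
  by rewrite !mulr_ge0// exprn_ge0// addr_ge0// mulr_ge0.
have C0 : 0 < C by rewrite ltr_wpDl// addr_ge0.
near=> N.
have Ne : N.+1%:R^-1 <= e / C by near: N; apply: invS_small; rewrite divr_gt0.
have N0 : 0 <= N.+1%:R^-1 :> R by rewrite invr_ge0.
move: Ne; rewrite ler_pdivlMr// => Ne.
have H1 := @lsum_unitri_le _ _ _ r r' N f c uL f0 c0 fl fr fLr.
have fLV : (fun x => (fun y => f (y *m L)) (x *m invmx L)) = f.
  by apply/funext => x; rewrite mulmxKV.
(* The reverse inequality: the same estimate for the inverse of L and for f composed with L, whose
   composite is f. *)
have H2 := @lsum_unitri_le _ _ _ r' r N (fun y => f (y *m L)) (c * (m%:R * `|L|))
  (unitri_inv Lu uL) (fun x => f0 _) _ fl' fLr.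
rewrite {}fLV in H2; have {}H2 := H2 _ fr.
have {}H2 := H2 (mulr_ge0 c0 (mulr_ge0 (ler0n _ _) (normr_ge0 _))).
rewrite sub0r normrN.
apply: le_trans Ne; rewrite /C; move: C1 C2 H1 H2 N0.
rewrite !mulrA; set P := _ ^+ m * c; set Q := _ ^+ m * c * _ * _.
move: P Q (N.+1%:R^-1) (lsum N f) (lsum N _) => P Q h a b C1 C2 H1 H2 N0.
have := mulr_ge0 C1 N0; have := mulr_ge0 C2 N0.
by rewrite ler_norml => ? ?; apply/andP; split; lra.
Unshelve. all: by end_near. Qed.

End LinearChangeOfVariables.

Section KernelIntegral.
Context {R : realType} {n : nat}.
Let m := n.+1.

Lemma lsum_col_perm (s : 'S_m) N (f : 'rV[R]_m -> R) :
  lsum N (fun x => f (col_perm s x)) = lsum N f.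
Proof.
congr (_ / _); rewrite [RHS](@reindex_fsbigT _ _ _ _ _ (fun k => col_perm s k)).
  apply: eq_fsbigr => k _; congr f; apply/rowP => i; by rewrite !mxE.
exists (fun k => col_perm s^-1 k) => k; rewrite -col_permM.
  by rewrite mulVg col_perm1.
by rewrite mulgV col_perm1.
Qed.

(** From P A = L U = L V D with D diagonal: P is absorbed by permuting the coordinates of the
    lattice, L and V change the sums by o(1), and D is the product case. Only D contributes to the
    determinant, up to sign. *)
Lemma lsum_kap (A : 'M[R]_m) b : A \in unitmx ->
  lsum N (fun x => kap (x *m A + b)) @[N --> \oo] --> `|\det A|^-1.
Proof.
move=> Au.
have := cormen_lup_perm A; have := cormen_lup_detL A; have := @cormen_lup_lower _ _ A.
have := @cormen_lup_upper _ _ A; have := cormen_lup_correct A.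
case: (cormen_lup A) => -[P L] U /= PA Uu Ll dL /is_perm_mxP[s Ps].
pose d : 'rV[R]_m := \row_i U i i.
have dU : \det U = \prod_i d 0 i.
  rewrite -det_tr det_trig; first by apply: eq_bigr => i _; rewrite !mxE.
  by apply/is_trig_mxP => i j ij; rewrite mxE Uu.
have dA : `|\det A| = `|\prod_i d 0 i|.
  have := congr1 determinant PA; rewrite !det_mulmx dL mul1r dU Ps det_perm => <-.
  by rewrite normrM normrX normrN1 expr1n mul1r.
have d0 i : d 0 i != 0.
  have : \prod_i d 0 i != 0 by rewrite -normr_gt0 -dA normr_gt0 -unitfE.
  by move=> /prodf_neq0; apply.
(* The columns of U are divided by its diagonal entries, so that V is unitriangular and U is V
   followed by a diagonal scaling. *)
pose V : 'M[R]_m := \matrix_(i, j) (U i j / d 0 j).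
have VU : U = V *m diag_mx d.
  by apply/matrixP => i j; rewrite mul_mx_diag !mxE divfK//; have := d0 j; rewrite mxE.
have uV : unitri (fun i => i : nat) V.
  split=> [i|i j ij]; first by rewrite !mxE divff//; have := d0 i; rewrite mxE.
  have ij' : (i != j :> nat) := ij.
  by apply: contraNT; rewrite -leqNgt leq_eqVlt eq_sym (negbTE ij')/= => /Uu Uij; rewrite !mxE Uij mul0r.
have uL : unitri (fun i => rev_ord i : nat) L.
  split=> [i|i j ij]; first by rewrite Ll// eqxx.
  apply: contraNT; rewrite -leqNgt => h; rewrite Ll ?(negbTE ij)//.
  by move: h; rewrite /= leq_sub2lE// ltnS.
have Lun : L \in unitmx by rewrite unitmxE dL unitr1.
have Vun : V \in unitmx.
  have : U \in unitmx by rewrite unitmxE unitfE dU -normr_gt0 -dA normr_gt0 -unitfE.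
  by rewrite VU unitmx_mul => /andP[].
have Dun : diag_mx d \in unitmx.
  by rewrite unitmxE det_diag unitfE -normr_gt0 -dA normr_gt0 -unitfE.
have kr : supp_in 1 (@kap R m) by move=> x /kap_supp x1 i; rewrite ltW.
have kl : lip m%:R (@kap R m) by move=> x y; exact: kap_lip.
pose G x := @kap R m (x *m diag_mx d + b).
have [rG Gr] := supp_in_affine b Dun kr.
have Gl := lip_affine (diag_mx d) b (ler0n _ _) kl.
have c1 : 0 <= m%:R * (m%:R * `|diag_mx d|) :> R by rewrite !mulr_ge0.
have GV := @lsum_unitri _ _ _ V rG G _ Vun uV (fun x => kap_ge0 _) c1 Gl Gr.
pose H x := G (x *m V).
have [rH Hr] : exists r, supp_in r H.
  have [r rP] := supp_in_affine 0 Vun Gr.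
  by exists r => x; have := rP x; rewrite addr0.
have Hl := lip_affine V 0 c1 Gl.
have HL := @lsum_unitri _ _ _ L rH H _ Lun uL (fun x => kap_ge0 _) _ _ Hr.
have Hl' : lip (m%:R * (m%:R * `|diag_mx d|) * (m%:R * `|V|)) H.
  by move=> x y; have := Hl x y; rewrite !addr0.
have {}HL := HL _ (mulr_ge0 c1 (mulr_ge0 (ler0n _ _) (normr_ge0 _))) Hl'.
have GE : lsum N G @[N --> \oo] --> `|\det A|^-1.
  have GE N : lsum N G = lsum N (fun y => \prod_i tent (y 0 i * d 0 i + b 0 i)).
    apply: eq_lsum => x; apply: eq_bigr => i _.
    by rewrite mul_mx_diag !mxE.
  by rewrite dA (eq_cvg _ _ GE); exact: lsum_kap_diag.
have E N : lsum N (fun x => kap (x *m A + b)) =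
    (lsum N (fun x => H (x *m L)) - lsum N H) + (lsum N H - lsum N G) + lsum N G.
  rewrite addrA subrK subrK -(lsum_col_perm s^-1); apply: eq_lsum => x.
  rewrite /H /G -!mulmxA -VU -[L *m U]PA Ps mulmxA; congr (kap (_ *m _ + _)).
  by rewrite col_permE invgK.
rewrite (eq_cvg _ _ E) (_ : `|\det A|^-1 = 0 + 0 + `|\det A|^-1); last by rewrite !add0r.
exact: (cvgD (cvgD HL GV) GE).
Qed.

End KernelIntegral.

(** * Nonlinear change of variables under uniform estimates *)

Section CountClose.
Context {R : realType} {m : nat}.

(** Translating by one element puts the whole list into a box. The lemma bounds, independently of
    the mesh, how many hat functions matter at a given point. *)
Lemma size_close (s : seq 'rV[int]_m) (D : nat) : uniq s ->
  (forall k l, k \in s -> l \in s -> forall i, `|k 0 i - l 0 i| <= D%:Z) ->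
  (size s <= (2 * D).+1 ^ m)%N.
Proof.
case: s => // k0 s us sD; rewrite -(size_box (m := m)).
rewrite -(size_map (fun k => k - k0)); apply: uniq_leq_size.
  by rewrite map_inj_uniq //; exact: addIr.
move=> _ /mapP[k ks ->]; rewrite mem_box; apply/forallP => i.
by rewrite !mxE; apply: sD => //; rewrite mem_head.
Qed.

End CountClose.

Section ChangeOfVariables.
Context {R : realType} {n : nat}.
Let m := n.+1.
Context (K : set 'rV[R]_m) (phi psi : 'rV[R]_m -> 'rV[R]_m)
  (J : 'rV[R]_m -> 'M[R]_m) (f g : 'rV[R]_m -> R).
Context (fK : forall x, f x != 0 -> K x)
  (gK : forall y, g y != 0 -> K (psi y) /\ phi (psi y) = y)
  (Kbd : exists r, forall x, K x -> `|x| <= r)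
  (phiKbd : exists r, forall x, K x -> `|phi x| <= r)
  (fJ : forall x, K x -> f x = \det (J x) * g (phi x))
  (Jpos : forall x, K x -> 0 < \det (J x))
  (detJbd : exists B, forall x, K x -> \det (J x) <= B)
  (Jinv : exists2 C, 0 < C & forall x (v : 'rV[R]_m), K x -> `|v| <= C * `|v *m J x|)
  (Jbd : exists2 C, 0 < C & forall x (v : 'rV[R]_m), K x -> `|v *m J x| <= C * `|v|)
  (fuc : forall e, 0 < e -> exists2 d, 0 < d &
    forall x y, `|x - y| <= d -> `|f x - f y| <= e)
  (guc : forall e, 0 < e -> exists2 d, 0 < d &
    forall x y, `|x - y| <= d -> `|g x - g y| <= e)
  (fbd : exists B, forall x, `|f x| <= B)
  (phi1 : forall e, 0 < e -> exists2 d, 0 < d & forall x y, K x -> `|y - x| <= d ->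
    `|phi y - phi x - (y - x) *m J x| <= e * `|y - x|)
  (phi_inv_uc : forall e, 0 < e -> exists2 d, 0 < d & forall x y, K x -> K y ->
    `|phi x - phi y| <= d -> `|x - y| <= e).

(* [quasi M] replaces [g] by its values on the lattice of mesh 1/(M+1), the hat
   functions around the lattice points z being pulled back by the affine maps
   tangent to [phi] at [psi z]. *)
Definition quasi_coef M (k : 'rV[int]_m) : R :=
  \det (J (psi (lat M k))) * g (lat M k).

Definition quasi_bump M (k : 'rV[int]_m) (x : 'rV[R]_m) : R :=
  kap ((x - psi (lat M k)) *m (M.+1%:R *: J (psi (lat M k)))).

Definition quasi r M (x : 'rV[R]_m) : R :=
  \sum_(k <- box (r * M.+1)) quasi_coef M k * quasi_bump M k x.

Lemma quasi_bump_close M k x C : 0 < C ->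
  (forall x (v : 'rV[R]_m), K x -> `|v| <= C * `|v *m J x|) ->
  g (lat M k) != 0 -> quasi_bump M k x != 0 ->
  `|x - psi (lat M k)| <= C * M.+1%:R^-1.
Proof.
move=> C0 CJ gk /kap_supp kx; have [Kk _] := gK gk.
apply: le_trans (CJ _ _ Kk) _; rewrite ler_wpM2l ?(ltW C0)//.
apply: mx_norm_le => [|i j]; first by rewrite invr_ge0.
rewrite ord1; have := kx j; rewrite -scalemxAr mxE normrM gtr0_norm ?ltr0n//.
by rewrite -ltr_pdivlMl ?ltr0n// mulr1 => /ltW.
Qed.

(** The radius is the same for all M: the uniform error of the interpolation will be multiplied by a
    volume that must not depend on M. *)
Lemma quasi_supp r : exists r', supp_in r' f /\ forall M, supp_in r' (quasi r M).
Proof.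
have [rK rKP] := Kbd; have [C C0 CJ] := Jinv.
have [r1 r1P] : exists r1, supp_in r1 f.
  by apply: (@norm_supp_in _ _ rK) => x /fK /rKP.
have [r2 r2P] : exists r2, forall M, supp_in r2 (quasi r M).
  exists (Num.truncn (rK + C)).+1 => M x qx i.
  apply/ltW/(le_lt_trans _ (truncnS_gt _)).
  apply: le_trans (coord_le_norm _ _ _) _.
  have [k [gk bk]] : exists k, g (lat M k) != 0 /\ quasi_bump M k x != 0.
    apply: contrapT => /forallNP H; move/eqP: qx; apply.
    apply: big1 => k _; have [E|gk] := eqVneq (g (lat M k)) 0.
      by rewrite /quasi_coef E mulr0 mul0r.
    have [->|bk] := eqVneq (quasi_bump M k x) 0; first by rewrite mulr0.
    by case: (H k).
  have := quasi_bump_close C0 CJ gk bk => xk.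
  have [Kk _] := gK gk; rewrite -[x](subrK (psi (lat M k))) addrC.
  apply: le_trans (ler_normD _ _) _; apply: lerD; first exact: rKP.
  apply: le_trans xk _; rewrite ler_piMr ?(ltW C0)//.
  by rewrite invf_le1 ?ltr0n// ler1n.
exists (maxn r1 r2); split=> [|M]; first by apply: supp_in_le r1P; exact: leq_maxl.
by apply: supp_in_le (r2P M); exact: leq_maxr.
Qed.

(** The bump around psi z has sums tending to 1/(det J (M+1)^m), and its coefficient is det J times
    g(z): in the limit each lattice point z contributes g(z)/(M+1)^m. *)
Lemma quasi_lsum r M : supp_in r g ->
  lsum N (quasi r M) @[N --> \oo] --> lsum M g.
Proof.
move=> gr.
have cv k : lsum N (fun x => quasi_coef M k * quasi_bump M k x) @[N --> \oo] -->
    g (lat M k) / M.+1%:R ^+ m.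
  have [E|gk] := eqVneq (g (lat M k)) 0.
    rewrite E mul0r; have E' N : lsum N (fun x => quasi_coef M k * quasi_bump M k x) = 0.
      by rewrite lsumZ /quasi_coef E mulr0 mul0r.
    by rewrite (eq_cvg _ _ E'); exact: cvg_cst.
  have [Kk _] := gK gk; have Jk := Jpos Kk.
  have E' N : lsum N (fun x => quasi_coef M k * quasi_bump M k x) =
      quasi_coef M k * lsum N (fun x => kap (x *m (M.+1%:R *: J (psi (lat M k))) +
        - (psi (lat M k) *m (M.+1%:R *: J (psi (lat M k)))))).
    by rewrite lsumZ; congr (_ * _); apply: eq_lsum => x; rewrite /quasi_bump mulmxBl.
  rewrite (eq_cvg _ _ E').
  have -> : g (lat M k) / M.+1%:R ^+ m = quasi_coef M k *
      `|\det (M.+1%:R *: J (psi (lat M k)))|^-1.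
    rewrite detZ ger0_norm; last by rewrite mulr_ge0 ?exprn_ge0// ltW.
    by rewrite /quasi_coef; field; rewrite gt_eqF// expf_neq0 ?gt_eqF.
  apply: cvgMl_tmp; apply: lsum_kap.
  by rewrite unitmxE unitfE detZ mulf_neq0 ?expf_neq0 ?gt_eqF.
have bdk k : exists r', supp_in r' (fun x => quasi_coef M k * quasi_bump M k x).
  have [C C0 CJ] := Jinv; have [rK rKP] := Kbd.
  apply: (@norm_supp_in _ _ (rK + C * M.+1%:R^-1)) => x.
  rewrite !mulf_eq0 !negb_or => /andP[/andP[_ gk] bk].
  have := quasi_bump_close C0 CJ gk bk => xk; have [Kk _] := gK gk.
  rewrite -[x](subrK (psi (lat M k))) addrC.
  by apply: le_trans (ler_normD _ _) _; apply: lerD => //; exact: rKP.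
have E N : lsum N (quasi r M) =
    \sum_(k <- box (r * M.+1)) lsum N (fun x => quasi_coef M k * quasi_bump M k x).
  exact: lsum_sum.
rewrite (eq_cvg _ _ E) (@lsumE _ _ r)// mulr_suml.
by apply: cvg_big => [|k _]; [exact: add_continuous|exact: cv].
Qed.

(** Used with y = phi x: if the affine approximation of phi at psi z errs by c meshes, then the
    pulled-back hat function at x and the original one at phi x differ by at most m c. *)
Lemma quasi_bump_lip M k x y (c : R) : 0 <= c ->
  `|(x - psi (lat M k)) *m J (psi (lat M k)) - (y - lat M k)| <= c * M.+1%:R^-1 ->
  `|quasi_bump M k x - kap (M.+1%:R *: y - map_mx intr k)| <= m%:R * c.
Proof.
move=> c0 h; apply: le_trans (kap_lip _ _) _; rewrite ler_wpM2l//.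
have -> : map_mx intr k = M.+1%:R *: lat M k :> 'rV[R]_m.
  by apply/rowP => i; rewrite !mxE mulrC divfK// gt_eqF.
rewrite -scalemxAr -scalerBr -scalerBr normrZ gtr0_norm//.
by rewrite -ler_pdivlMl// mulrC.
Qed.

(** Since the hat functions at phi x add up to 1, f(x) is the sum of the f(x) [kx k], to be compared
    term by term with the interpolation. Where g(z) = 0 the interpolation has no term, but g(phi x)
    is then small near z, and the errors are weighted by the hat functions. Where g(z) is non-zero,
    the coefficient is f(psi z), and an error arises only if psi z is within O(1/M) of x, which
    happens for boundedly many z. *)
Lemma quasi_approx r : (forall x, K x -> `|phi x| <= r%:R) -> forall e, 0 < e ->
  \forall M \near \oo, forall x, `|f x - quasi r M x| <= e.
Proof.
move=> phir e e0.
have [C C0 CJ] := Jinv; have [C' C'0 CJ'] := Jbd; have [B0 B0P] := fbd.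
pose B := B0 + 1; have B_gt0 : 0 < B.
  by rewrite ltr_wpDl//; apply: le_trans (B0P 0).
have BP x : `|f x| <= B by rewrite (le_trans (B0P x))// lerDl.
have [A0 A0P] := detJbd; pose A := `|A0| + 1.
have A_gt0 : 0 < A by rewrite ltr_wpDl.
have AP x : K x -> \det (J x) <= A.
  by move=> /A0P h; rewrite (le_trans h)// (le_trans (ler_norm _))// lerDl.
(* Two lattice points close to x have preimages at distance at most 4 C h, so their indices differ
   by at most 4 C (C' + 1), which is below D. *)
pose D := (Num.truncn (8 * (C' + 1) * C)).+1.
pose eta := e / (1 + ((2 * D).+1 ^ m)%:R).
have eta0 : 0 < eta by rewrite divr_gt0.
(* The bound 1 serves in the count of close points, 1/(2 C) in absorbing the nonlinear error when
   inverting phi, and the last one makes the two kinds of hat functions agree up to eta/2 after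
   multiplication by f. *)
pose del := Num.min (Num.min 1 (1 / (2 * C))) (eta / 2 / (B * m%:R * (2 * C))).
have del0 : 0 < del by rewrite !lt_min ltr01 !divr_gt0// !mulr_gt0.
have del1 : del <= 1 by rewrite /del !ge_min lexx.
have delC : del * (2 * C) <= 1.
  by rewrite -ler_pdivlMr ?mulr_gt0// /del !ge_min lexx orbT.
have deleta : B * (m%:R * (del * (2 * C))) <= eta / 2.
  have -> : B * (m%:R * (del * (2 * C))) = del * (B * m%:R * (2 * C)) by ring.
  by rewrite -ler_pdivlMr ?mulr_gt0// /del !ge_min lexx !orbT.
have [df df0 dfP] := fuc (divr_gt0 eta0 (ltr0n _ 2)).
have [dg dg0 dgP] := guc (divr_gt0 eta0 A_gt0).
have [dp dp0 dpP] := phi1 del0.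
have [di di0 diP] := phi_inv_uc dp0.
near=> M => x.
have M0 : 0 < M.+1%:R :> R by rewrite ltr0n.
have h_ge0 : 0 <= M.+1%:R^-1 :> R by rewrite invr_ge0.
have Mdf : 2 * C * M.+1%:R^-1 <= df.
  rewrite -ler_pdivlMl ?mulr_gt0// mulrC; near: M; apply: invS_small.
  by rewrite divr_gt0// mulr_gt0.
have Mdp : 4 * C * M.+1%:R^-1 <= dp.
  rewrite -ler_pdivlMl ?mulr_gt0// mulrC; near: M; apply: invS_small.
  by rewrite divr_gt0// mulr_gt0.
have Mdg : M.+1%:R^-1 <= dg by near: M; exact: invS_small.
have Mdi : M.+1%:R^-1 <= di by near: M; exact: invS_small.
pose h : R := M.+1%:R^-1.
pose z k : 'rV[R]_m := lat M k.
pose kx k := kap (M.+1%:R *: phi x - map_mx intr k).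
have kx_close k : kx k != 0 -> `|phi x - z k| <= h.
  move=> /kap_supp kk; apply: mx_norm_le => [//|i j]; rewrite ord1.
  have -> : (phi x - z k) 0 j = h * (M.+1%:R *: phi x - map_mx intr k) 0 j.
    by rewrite !mxE /h; field; rewrite gt_eqF.
  by rewrite normrM ger0_norm// ler_piMr// ltW.
pose close k := (g (z k) != 0) && (`|x - psi (z k)| <= 2 * C * h).
(* Uniform continuity of the inverse first brings x close enough to psi z for the linear
   approximation. The distance a then satisfies a <= C (h + del a), and the last term is at most
   a/2. *)
have kx_psi k : K x -> g (z k) != 0 -> kx k != 0 -> `|x - psi (z k)| <= 2 * C * h.
  move=> Kx gk /kx_close xk; have [Kk zk] := gK gk.
  have xp : `|x - psi (z k)| <= dp.
    by apply: diP => //; rewrite zk (le_trans xk).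
  have := dpP _ _ Kk xp; rewrite zk => h1.
  have := CJ _ (x - psi (z k)) Kk.
  set a := `|x - psi (z k)| in h1 *; set w := (x - psi (z k)) *m _ in h1 *.
  have : `|w| <= h + del * a.
    have -> : w = (phi x - z k) - (phi x - z k - w) by rewrite opprB addrC subrK.
    by rewrite (le_trans (ler_normB _ _))// lerD.
  move=> h2 h3.
  have : C * `|w| <= C * (h + del * a) by rewrite ler_wpM2l// ltW.
  have a0 : 0 <= a by exact: normr_ge0.
  have : del * (2 * C) * a <= a by rewrite ler_piMl.
  by lra.
have partition : f x = \sum_(k <- box (r * M.+1)) f x * kx k.
  have [->|fx] := eqVneq (f x) 0; first by rewrite big1// => k _; rewrite mul0r.
  rewrite -mulr_sumr kap_partition ?mulr1// => i.
  rewrite mxE normrM natrM [leRHS]mulrC [`|M.+1%:R|]gtr0_norm// ler_wpM2l ?(ltW M0)//.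
  by apply: le_trans (coord_le_norm _ _ _) _; apply: phir; exact: fK.
rewrite [X in X - _]partition /quasi -sumrB.
apply: le_trans (ler_norm_sum _ _ _) _.
(* The indicator of K is there because the hat functions in the box are known to add up to 1 only
   when phi x lies in the box, which holds on K; outside K, f vanishes. *)
have termwise k : `|f x * kx k - quasi_coef M k * quasi_bump M k x| <=
    eta * (kx k * `[<K x>]%:R) + eta * (close k)%:R.
  have eta_ge0 := ltW eta0; have kx0 : 0 <= kx k by exact: kap_ge0.
  have b0 : 0 <= quasi_bump M k x by exact: kap_ge0.
  have b1 : quasi_bump M k x <= 1 by exact: kap_le1.
  have rhs1 : 0 <= eta * (kx k * `[<K x>]%:R) by rewrite mulr_ge0// mulr_ge0.
  have [gk|gk] := eqVneq (g (z k)) 0.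
    have -> : quasi_coef M k = 0 by rewrite /quasi_coef gk mulr0.
    rewrite mul0r subr0; apply: ler_wpDr; first by rewrite mulr_ge0.
    have [Kx|nKx] := pselect (K x); last first.
      have [->|/fK//] := eqVneq (f x) 0.
      by rewrite mul0r normr0.
    have -> : `[<K x>] = true by exact/asboolP.
    rewrite mulr1; have [->|kk] := eqVneq (kx k) 0; first by rewrite !mulr0 normr0.
    rewrite normrM [`|kx k|]ger0_norm// ler_wpM2r//.
    have := dgP _ _ (le_trans (kx_close _ kk) Mdg); rewrite gk subr0 => gx.
    rewrite fJ// normrM gtr0_norm ?Jpos//.
    have -> : eta = A * (eta / A) by rewrite mulrC divfK ?gt_eqF.
    by apply: ler_pM => //; rewrite ?(ltW (Jpos Kx)) ?AP.
  have [Kk zk] := gK gk.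
  have coefE : quasi_coef M k = f (psi (z k)) by rewrite fJ// zk.
  have [ck|/negbTE nck] := boolP (close k); last first.
    have bk0 : quasi_bump M k x = 0.
      apply/eqP; apply: contraFT nck => bk; rewrite /close gk/=.
      apply: le_trans (quasi_bump_close C0 CJ gk bk) _.
      by rewrite ler_wpM2r// ler_peMl ?(ltW C0)// ler1n.
    rewrite bk0 mulr0 subr0 mulr0 addr0.
    have [Kx|nKx] := pselect (K x); last first.
      have [->|/fK//] := eqVneq (f x) 0.
      by rewrite mul0r normr0.
    have [->|kk] := eqVneq (kx k) 0; first by rewrite !(mul0r,mulr0) normr0.
    by move: nck; rewrite /close gk/= kx_psi.
  rewrite mulr1; apply: ler_wpDl => //; rewrite coefE.
  move/andP: ck => [_ xk].
  have fx : `|f x - f (psi (z k))| <= eta / 2 by apply: dfP; exact: le_trans xk _.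
  have -> : f x * kx k - f (psi (z k)) * quasi_bump M k x =
    (f x - f (psi (z k))) * quasi_bump M k x + f x * (kx k - quasi_bump M k x) by ring.
  have -> : eta = eta / 2 + eta / 2 by rewrite -splitr.
  apply: le_trans (ler_normD _ _) _; apply: lerD.
    by rewrite normrM [`|quasi_bump _ _ _|]ger0_norm// (le_trans (ler_piMr _ _)).
  have [Kx|nKx] := pselect (K x); last first.
    have [->|/fK//] := eqVneq (f x) 0.
    by rewrite mul0r normr0 divr_ge0.
  rewrite normrM; apply: le_trans deleta; apply: ler_pM => //; rewrite distrC.
  apply: quasi_bump_lip; first by rewrite mulr_ge0 ?mulr_ge0 ?(ltW del0) ?(ltW C0).
  have xdp : `|x - psi (z k)| <= dp.
    apply: le_trans xk (le_trans _ Mdp); rewrite ler_wpM2r// ler_wpM2r ?(ltW C0)//.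
    by rewrite ler_nat.
  have := dpP _ _ Kk xdp; rewrite zk distrC => h1; apply: le_trans h1 _.
  by rewrite -mulrA ler_wpM2l// ltW.
apply: le_trans (ler_sum _ (fun k _ => termwise k)) _.
rewrite big_split/= -!mulr_sumr.
have -> : e = eta * 1 + eta * ((2 * D).+1 ^ m)%:R.
  by rewrite -mulrDr /eta divfK ?gt_eqF.
apply: lerD; rewrite ler_wpM2l ?(ltW eta0)//.
  rewrite -mulr_suml; have [Kx|nKx] := pselect (K x); last first.
    have -> : `[<K x>] = false by exact/asboolP.
    by rewrite mulr0.
  have -> : `[<K x>] = true by exact/asboolP.
  rewrite mulr1 kap_partition// => i.
  rewrite mxE normrM natrM [leRHS]mulrC [`|M.+1%:R|]gtr0_norm// ler_wpM2l ?(ltW M0)//.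
  by apply: le_trans (coord_le_norm _ _ _) _; exact: phir.
have -> : \sum_(k <- box (r * M.+1)) (close k)%:R =
    (size [seq k <- box (m := m) (r * M.+1) | close k])%:R :> R.
  by rewrite size_filter -sum1_count natr_sum [RHS]big_mkcond; apply: eq_bigr => k _; case: (close k).
rewrite ler_nat; apply: size_close; first by rewrite filter_uniq ?box_uniq.
move=> k l; rewrite !mem_filter => /andP[/andP[gk xk] _] /andP[/andP[gl xl] _] i.
have [Kk zk] := gK gk; have [Kl zl] := gK gl.
have kl : `|psi (z k) - psi (z l)| <= 4 * C * h.
  have -> : psi (z k) - psi (z l) = (x - psi (z l)) - (x - psi (z k)).
    by rewrite opprB [RHS]addrC addrA subrK.
  apply: le_trans (ler_normB _ _) _; move: xk xl; lra.
have := dpP _ _ Kl (le_trans kl Mdp); rewrite zk zl => h1.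
have h2 := CJ' _ (psi (z k) - psi (z l)) Kl.
have zkl : `|z k - z l| <= (C' + 1) * (4 * C * h).
  set w := (psi (z k) - psi (z l)) *m _ in h1 h2.
  have -> : z k - z l = (z k - z l - w) + w by rewrite subrK.
  apply: le_trans (ler_normD _ _) _.
  have : del * `|psi (z k) - psi (z l)| <= `|psi (z k) - psi (z l)| by rewrite ler_piMl.
  have : (C' + 1) * `|psi (z k) - psi (z l)| <= (C' + 1) * (4 * C * h).
    by rewrite ler_wpM2l// addr_ge0// ltW.
  by move: h1 h2; lra.
rewrite -(ler_int R) intr_norm rmorphB/=.
have -> : (k 0 i)%:~R - (l 0 i)%:~R = M.+1%:R * (z k - z l) 0 i.
  by rewrite !mxE; field; rewrite gt_eqF.
rewrite normrM gtr0_norm// -ler_pdivlMl//.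
apply: le_trans (coord_le_norm _ _ _) _; apply: le_trans zkl _.
rewrite mulrA mulrC ler_wpM2l//.
apply: (@le_trans _ _ (8 * (C' + 1) * C)); last exact/ltW/truncnS_gt.
have : 0 <= (C' + 1) * C by rewrite mulr_ge0 ?addr_ge0// ltW.
by lra.
Unshelve. all: by end_near. Qed.

(** The mesh M of the interpolation is frozen before N tends to infinity, since the sums of the
    bumps are known only in the limit. Hence the two sums are taken on different lattices. *)
Lemma lsum_cov_approx e : 0 < e ->
  \forall M \near \oo, \forall N \near \oo, `|lsum N f - lsum M g| <= e.
Proof.
move=> e0.
have [r [phir gr]] : exists r : nat, (forall x, K x -> `|phi x| <= r%:R) /\ supp_in r g.
  have [r0 r0P] := phiKbd; exists (Num.truncn r0).+1.
  have phir x : K x -> `|phi x| <= (Num.truncn r0).+1%:R.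
    by move=> /r0P h; rewrite (le_trans h)// ltW// truncnS_gt.
  split=> // y /gK[Ky yE] i; apply: le_trans (coord_le_norm _ _ _) _.
  by rewrite -yE; exact: phir.
have [r' [fr' qr']] := quasi_supp r.
pose V : R := (2 * r'%:R + 1) ^+ m.
have V0 : 0 < V by rewrite exprn_gt0// ltr_wpDl// mulr_ge0.
have e20 : 0 < e / 2 by rewrite divr_gt0.
near=> M.
have qa : forall x, `|f x - quasi r M x| <= e / 2 / V.
  by near: M; apply: quasi_approx => //; rewrite divr_gt0.
have qc := @quasi_lsum r M gr.
near=> N.
rewrite -[lsum N f](subrK (lsum N (quasi r M))) -addrA -(lsumB _ fr' (qr' M)).
rewrite [e]splitr; apply: le_trans (ler_normD _ _) _; apply: lerD.
  have -> : e / 2 = V * (e / 2 / V) by rewrite [RHS]mulrC divfK// gt_eqF.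
  by apply: lsum_norm_le => //; apply: supp_inD => //; apply: supp_inN; exact: qr'.
rewrite distrC; near: N.
by move/cvgrPdist_le : qc => /(_ _ e20).
Unshelve. all: by end_near. Qed.

End ChangeOfVariables.

(** * Differential calculus *)

Lemma cvg_sumr {R : realType} {T : Type} (F : set_system T) {FF : Filter F}
    (I : Type) (s : seq I) (f : I -> T -> R) (l : I -> R) :
  (forall i, f i x @[x --> F] --> l i) ->
  \sum_(i <- s) f i x @[x --> F] --> \sum_(i <- s) l i.
Proof.
by move=> fl; apply: cvg_big => [|i _]; [exact: add_continuous|exact: fl].
Qed.

Lemma differentiable_approx {R : realType} {V W : normedModType R} (f : V -> W)
    (L : {linear V -> W}) (x : V) : continuous L ->
  (forall e, 0 < e -> \forall h \near (0 : V), `|f (h + x) - (f x + L h)| <= e * `|h|) ->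
  differentiable f x /\ 'd f x = L :> (V -> W).
Proof.
move=> Lc fL; have Lo : f \o shift x = cst (f x) + L +o_ 0 id.
  by apply/eqaddoP => e e0; exact: fL.
have dE := diff_unique Lc Lo; split=> //.
by apply/diff_locallyP; rewrite dE.
Qed.

(** * Strict differentiability from continuous partial derivatives *)

Section StrictDifferentiability.
Context {R : realType} {m : nat}.
Implicit Types (f g : 'rV[R]_m -> R) (U : set 'rV[R]_m).

Lemma signed_line_MVT f (x v : 'rV[R]_m) (t : R) :
  (forall a, 0 <= a <= 1 -> derivable f (x + (a * t) *: v) v) ->
  exists2 a, 0 <= a <= 1 & f (x + t *: v) - f x = t * 'D_v f (x + (a * t) *: v).
Proof.
move=> fd; case: (ltgtP t 0) => t0; last 1 first.
- exists 0; first by rewrite lexx ler01.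
  by rewrite t0 scale0r addr0 subrr mul0r.
- have nt0 : 0 < - t by rewrite oppr_gt0.
  have E s : x + t *: v + s *: v = x + ((1 + s / t) * t) *: v.
    by rewrite mulrDl mul1r divfK ?lt_eqF// scalerDl addrA.
  have st01 s : 0 <= s <= - t -> 0 <= 1 + s / t <= 1.
    move=> /andP[s0 st]; rewrite gerDl mulr_ge0_le0 ?invr_le0 ?(ltW t0)// andbT.
    by rewrite -lerBlDl sub0r ler_ndivlMr// mulN1r.
  have [s st|s st] := @line_MVT _ _ f (x + t *: v) v (- t) nt0.
    by rewrite E; apply/fd/st01.
  rewrite scaleNr addrK E => h; exists (1 + s / t); first exact: st01.
  by rewrite -[LHS]opprB h mulNr opprK.
- have E s : s = s / t * t by rewrite divfK// gt_eqF.
  have st01 s : 0 <= s <= t -> 0 <= s / t <= 1.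
    move=> /andP[s0 st]; rewrite divr_ge0 ?(ltW t0)//.
    by rewrite ler_pdivrMr// mul1r.
  have [s st|s st] := @line_MVT _ _ f x v t t0.
    by rewrite [s]E; apply/fd/st01.
  by move=> h; exists (s / t); [exact: st01|rewrite -E].
Qed.

(* Moving one coordinate at a time from y to z stays in any sup-norm ball
   containing both. *)
Lemma strict_diff f U x : open U -> U x ->
  (forall (i : 'I_m) y, U y -> derivable f y (delta_mx 0 i)) ->
  (forall i : 'I_m, {for x, continuous (fun y => 'D_(delta_mx 0 i) f y)}) ->
  forall e, 0 < e -> exists2 d, 0 < d & forall y z, `|x - y| < d -> `|x - z| < d ->
    `|f z - f y - \sum_i (z 0 i - y 0 i) * 'D_(delta_mx 0 i) f x| <= e * `|z - y|.
Proof.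
move=> oU Ux fd fc e e0.
pose em := e / (m%:R + 1).
have em0 : 0 < em by rewrite divr_gt0// ltr_wpDl.
have : \forall y \near x, U y /\ forall i : 'I_m,
    `|'D_(delta_mx 0 i) f y - 'D_(delta_mx 0 i) f x| <= em.
  near=> y; split; first by near: y; apply: open_nbhs_nbhs.
  near: y; apply: filter_forall => i.
  by have /cvgrPdist_le/(_ _ em0) := fc i; apply: filterS => y; rewrite distrC.
move=> /nbhs_normP[d /= d0 dP]; exists d => // y z xy xz.
pose p (j : nat) : 'rV[R]_m := \row_i (if (i < j)%N then z 0 i else y 0 i).
pose c := Num.max `|x - y| `|x - z|.
have cd : c < d by rewrite gt_max xy xz.
have c0 : 0 <= c by rewrite le_max normr_ge0.
have pin (j : 'I_m) a : 0 <= a <= 1 ->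
    `|x - (p j + (a * (z 0 j - y 0 j)) *: delta_mx 0 j)| < d.
  move=> /andP[a0 a1]; apply: le_lt_trans cd; apply: mx_norm_le => // i l.
  rewrite !mxE ord1 eqxx/=.
  have xyl : `|x 0 l - y 0 l| <= c.
    by have := coord_le_norm (x - y) 0 l; rewrite !mxE => h; rewrite le_max h.
  have xzl : `|x 0 l - z 0 l| <= c.
    by have := coord_le_norm (x - z) 0 l; rewrite !mxE => h; rewrite le_max h orbT.
  case: (eqVneq l j) xyl xzl => [-> xyl xzl|lj xyl xzl]; last by rewrite mulr0 addr0; case: ifP.
  rewrite ltnn mulr1.
  have -> : x 0 j - (y 0 j + a * (z 0 j - y 0 j)) =
    (1 - a) * (x 0 j - y 0 j) + a * (x 0 j - z 0 j) by ring.
  have -> : c = (1 - a) * c + a * c by ring.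
  apply: le_trans (ler_normD _ _) _; rewrite !normrM (ger0_norm a0).
  rewrite (@ger0_norm _ (1 - a)) ?subr_ge0//.
  by apply: lerD; rewrite ler_wpM2l// subr_ge0.
have step (j : 'I_m) : exists2 w, `|x - w| < d &
    f (p j.+1) - f (p j) = (z 0 j - y 0 j) * 'D_(delta_mx 0 j) f w.
  have -> : p j.+1 = p j + (z 0 j - y 0 j) *: delta_mx 0 j.
    apply/rowP => i; rewrite !mxE eqxx/= ltnS leq_eqVlt.
    have [->|ij] := eqVneq i j; first by rewrite eqxx ltnn/= mulr1 addrC subrK.
    have ij' : (i != j :> nat) := ij.
    by rewrite (negbTE ij')/= mulr0 addr0.
  have [a a01|a a01 E] := @signed_line_MVT f (p j) (delta_mx 0 j) (z 0 j - y 0 j).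
    by apply: fd; apply: (dP _ (pin j a a01)).1.
  by exists (p j + (a * (z 0 j - y 0 j)) *: delta_mx 0 j) => //; exact: pin.
have pm : p m = z by apply/rowP => i; rewrite mxE ltn_ord.
have p0 : p 0 = y by apply/rowP => i; rewrite mxE.
have -> : f z - f y = \sum_(i < m) (f (p i.+1) - f (p i)).
  by rewrite -(big_mkord xpredT (fun i => f (p i.+1) - f (p i))) telescope_sumr// pm p0.
rewrite -sumrB; apply: le_trans (ler_norm_sum _ _ _) _.
apply: (@le_trans _ _ (\sum_(i < m) (em * `|z - y|))).
  apply: ler_sum => i _; have [w xw ->] := step i.
  rewrite -mulrBr normrM mulrC ler_pM//; first exact: (dP _ xw).2.
  by have := coord_le_norm (z - y) 0 i; rewrite !mxE.
rewrite sumr_const card_ord -mulr_natl mulrA ler_wpM2r// /em mulrCA ler_piMr ?(ltW e0)//.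
by rewrite ler_pdivrMr ?ltr_wpDl// mul1r lerDl.
Unshelve. all: by end_near. Qed.

Lemma partial_differentiable f U x : open U -> U x ->
  (forall (i : 'I_m) y, U y -> derivable f y (delta_mx 0 i)) ->
  (forall i : 'I_m, {for x, continuous (fun y => 'D_(delta_mx 0 i) f y)}) ->
  differentiable f x /\
  forall v : 'rV[R]_m, 'D_v f x = \sum_i v 0 i * 'D_(delta_mx 0 i) f x.
Proof.
move=> oU Ux fd fc.
pose l (v : 'rV[R]_m) := \sum_i v 0 i * 'D_(delta_mx 0 i) f x.
have llin : linear l.
  move=> a u v; rewrite /l scaler_sumr -big_split/=; apply: eq_bigr => i _.
  by rewrite !mxE mulrDl scalerAl.
pose lM := GRing.isLinear.Build _ _ _ _ _ llin.
pose L : {linear 'rV[R]_m -> R} := HB.pack l lM.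
have Lc : continuous L.
  move=> v; apply: (@cvg_sumr _ _ (nbhs v)) => i.
  by apply: cvgMr_tmp; exact: coord_continuous.
have [|df dE] := @differentiable_approx _ _ _ f L x Lc; last first.
  by split=> // v; rewrite deriveE// dE.
move=> e e0.
have [d d0 dP] := strict_diff oU Ux fd fc e0.
near=> h.
have := dP x (h + x); rewrite subrr normr0 => /(_ d0).
rewrite addrK opprD addrCA subrr addr0 normrN => H.
rewrite opprD addrA; apply: le_trans (H _).
  rewrite le_eqVlt; apply/orP; left; apply/eqP; congr (`|_ - _|).
  by apply: eq_bigr => i _; rewrite mxE addrK.
  near: h; rewrite near_simpl; exact: (@nbhs0_lt _ 'rV[R]_m d d0).
Unshelve. all: by end_near. Qed.

End StrictDifferentiability.

(** * Symmetry of second derivatives *)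

Section Schwarz.
Context {R : realType} {V : normedModType R}.
Implicit Types (f g : V -> R) (x u v : V).

Lemma diff_le f x : differentiable f x -> forall e, 0 < e -> exists2 d, 0 < d &
  forall h, `|h| < d -> `|f (x + h) - f x - 'd f x h| <= e * `|h|.
Proof.
move=> df e e0; have /eqaddoP/(_ e e0) := diff_locally df.
move=> /nbhs_normP[d /= d0 dP]; exists d => // h hd.
have := dP h; rewrite /= sub0r normrN => /(_ hd); rewrite !fctE /= /shift /=.
by rewrite [h + x]addrC opprD addrA.
Qed.

Lemma is_derive_translate f x u v (df : R) :
  is_derive (x + u) v f df -> is_derive x v (fun y => f (y + u)) df.
Proof.
have E : (fun h : R => h^-1 *: (f (h *: v + x + u) - f (x + u))) =
    (fun h : R => h^-1 *: (f (h *: v + (x + u)) - f (x + u))).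
  by apply/funext => h; rewrite addrA.
move=> [fd <-]; apply: DeriveDef; first by rewrite /derivable /= E.
by rewrite /derive /= E.
Qed.

(** The mean value theorem in the direction u, applied to y |-> f(y + t v) - f(y), then the
    first-order expansion of ['D_u f] at x. The second difference is symmetric in u and v, so
    comparing it with both mixed derivatives identifies them. *)
Lemma second_difference f x u v :
  (\forall y \near x, derivable f y u) -> differentiable (fun y => 'D_u f y) x ->
  forall e, 0 < e -> \forall t \near (0 : R)^'+,
    `|f (x + t *: u + t *: v) - f (x + t *: u) - f (x + t *: v) + f x
      - t ^+ 2 * 'D_v (fun y => 'D_u f y) x| <= e * t ^+ 2.
Proof.
move=> fu dG e e0; set G := fun y => 'D_u f y.
pose A := 2 * (`|u| + `|v|) + 1.
have A0 : 0 < A by rewrite ltr_wpDl// mulr_ge0// addr_ge0.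
have [d d0 dP] := diff_le dG (divr_gt0 e0 A0).
have /nbhs_normP[d' /= d'0 d'P] := fu.
near=> t.
have t0 : 0 < t by [].
have tA : t * A < Num.min d d'.
  rewrite -ltr_pdivlMr//; near: t; apply: nbhs_right_lt.
  by rewrite divr_gt0// lt_min d0.
have small s a : 0 <= s <= t -> a = 0 \/ a = t -> `|s *: u + a *: v| < Num.min d d'.
  move=> /andP[s0 st] at_; apply: le_lt_trans tA.
  have a0t : 0 <= a <= t by case: at_ => ->; rewrite lexx ltW.
  case/andP: a0t => a0 at'.
  rewrite (le_trans (ler_normD _ _))// !normrZ !ger0_norm// /A.
  have := ler_wpM2r (normr_ge0 u) st; have := ler_wpM2r (normr_ge0 v) at'.
  have := mulr_ge0 (ltW t0) (normr_ge0 u); have := mulr_ge0 (ltW t0) (normr_ge0 v).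
  by lra.
have fd s a : 0 <= s <= t -> a = 0 \/ a = t -> derivable f (x + (s *: u + a *: v)) u.
  move=> st at_; apply: d'P => /=; rewrite opprD addrA subrr sub0r normrN.
  by have := small s a st at_; rewrite lt_min => /andP[].
pose q y := f (y + t *: v) - f y.
have qd s : 0 <= s <= t -> is_derive (x + s *: u) u q
    (G (x + (s *: u + t *: v)) - G (x + s *: u)).
  move=> st; rewrite /q; apply: is_deriveB.
    have h := fd s t st (or_intror erefl).
    by apply: is_derive_translate; rewrite -addrA; exact/derivableP.
  have := fd s 0 st (or_introl erefl); rewrite scale0r addr0.
  exact: derivableP.
have [s st|s st E] := @line_MVT _ _ q x u t t0; first by have [] := qd s st.
have [_ qE] := qd s st.
have -> : f (x + t *: u + t *: v) - f (x + t *: u) - f (x + t *: v) + f x =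
    t * (G (x + (s *: u + t *: v)) - G (x + s *: u)).
  by rewrite -qE -E /q; ring.
have dd : Num.min d d' <= d by rewrite ge_min lexx.
have h1 := dP _ (lt_le_trans (small s t st (or_intror erefl)) dd).
have h2 := dP _ (lt_le_trans (small s 0 st (or_introl erefl)) dd).
rewrite scale0r addr0 in h2.
rewrite deriveE//.
have -> : t * (G (x + (s *: u + t *: v)) - G (x + s *: u)) - t ^+ 2 * 'd G x v =
  t * ((G (x + (s *: u + t *: v)) - G x - 'd G x (s *: u + t *: v)) -
       (G (x + s *: u) - G x - 'd G x (s *: u))).
  by rewrite !linearD !linearZ /= /GRing.scale /=; ring.
rewrite normrM gtr0_norm// expr2 mulrCA ler_wpM2l ?(ltW t0)//.
apply: le_trans (ler_normB _ _) _; apply: le_trans (lerD h1 h2) _.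
rewrite -mulrDr -mulrA ler_wpM2l ?(ltW e0)//.
rewrite ler_pdivrMl// mulrC.
case/andP: st => s0 st.
apply: le_trans (lerD (ler_normD _ _) (lexx _)) _.
rewrite !normrZ !ger0_norm ?(ltW t0)// /A.
have := ler_wpM2r (normr_ge0 u) st.
have := mulr_ge0 (ltW t0) (normr_ge0 v); lra.
Unshelve. all: by end_near. Qed.

Lemma derive_comm f x u v :
  (\forall y \near x, derivable f y u) -> (\forall y \near x, derivable f y v) ->
  differentiable (fun y => 'D_u f y) x -> differentiable (fun y => 'D_v f y) x ->
  'D_v (fun y => 'D_u f y) x = 'D_u (fun y => 'D_v f y) x.
Proof.
have key (a b c d D1 D2 E t2 : R) : 0 <= t2 -> `|a - b - c + d - t2 * D1| <= E ->
    `|a - c - b + d - t2 * D2| <= E -> t2 * `|D1 - D2| <= E + E.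
  move=> t20 h1 h2; rewrite -[X in X * _]ger0_norm// -normrM.
  have -> : t2 * (D1 - D2) = (a - c - b + d - t2 * D2) - (a - b - c + d - t2 * D1) by ring.
  by apply: le_trans (ler_normB _ _) _; exact: lerD.
move=> fu fv du dv; apply/eqP; rewrite -subr_eq0 -normr_le0; apply/ler_addgt0Pl => e e0.
have e20 : 0 < e / 2 by rewrite divr_gt0.
have t_gt0 : \forall t \near (0 : R)^'+, 0 < t by exact: nbhs_right_gt.
have [t [t0 [h1 h2]]] := filter_ex (filterI t_gt0 (filterI
  (second_difference v fu du e20) (second_difference u fv dv e20))).
rewrite addr0 -(ler_pM2l (exprn_gt0 2 t0)) [leRHS]mulrC [X in _ <= X * _]splitr mulrDl.
have E : x + t *: v + t *: u = x + t *: u + t *: v by rewrite addrAC.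
rewrite E in h2; exact: (key _ _ _ _ _ _ _ _ (exprn_ge0 2 (ltW t0)) h1 h2).
Qed.

End Schwarz.

(** * Functions of class C^1 *)

Section C1.
Context {R : realType} {m : nat}.
Implicit Types (f g : 'rV[R]_m -> R) (U : set 'rV[R]_m).

(** C^1 is the working class, rather than smooth, because the partition of unity will be made from
    squares of positive parts. *)
Definition C1_on U f := forall x, U x -> differentiable f x /\
  forall v : 'rV[R]_m, {for x, continuous (fun y => 'D_v f y)}.

Lemma open_near U x (P : set 'rV[R]_m) : open U -> U x -> (forall y, U y -> P y) ->
  \forall y \near x, P y.
Proof.
move=> oU Ux UP; have : \forall y \near x, U y by apply: open_nbhs_nbhs.
exact: filterS.
Qed.

Lemma continuous_near (W : topologicalType) (f g : 'rV[R]_m -> W) x :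
  (\forall y \near x, f y = g y) -> {for x, continuous f} -> {for x, continuous g}.
Proof.
move=> fg fx; have E : f x = g x := nbhs_singleton fg.
change (g y @[y --> x] --> g x); rewrite -E.
by apply: cvg_trans fx; exact: (@near_eq_cvg _ _ (nbhs x) _ _ _ fg).
Qed.

Lemma differentiable_near f g x :
  (\forall y \near x, f y = g y) -> differentiable f x -> differentiable g x.
Proof.
move=> fg df; have [||//] := @differentiable_approx _ _ _ g ('d f x) x.
  exact: diff_continuous.
move=> e e0; have [d d0 dP] := diff_le df e0.
near=> h; rewrite -(nbhs_singleton fg) opprD addrA addrC [_ - f x]addrC.
have <- : f (h + x) = g (h + x).
  near: h; have /nbhs_normP[d' /= d'0 d'P] := fg.
  near=> h; apply: d'P; rewrite /= opprD addrCA subrr addr0 normrN.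
  by near: h; rewrite near_simpl; exact: (@nbhs0_lt _ 'rV[R]_m d' d'0).
have := dP h; rewrite addrC [- f x + _]addrC [x + h]addrC; apply.
by near: h; rewrite near_simpl; exact: (@nbhs0_lt _ 'rV[R]_m d d0).
Unshelve. all: by end_near. Qed.

Lemma C1_ext U f g : open U -> (forall x, U x -> f x = g x) -> C1_on U f -> C1_on U g.
Proof.
move=> oU fg f1 x Ux; have [fd fc] := f1 x Ux; split=> [|v].
  by apply: differentiable_near fd; apply: open_near Ux _.
apply: continuous_near (fc v); apply: open_near Ux _ => // y Uy.
by apply: near_eq_derive; apply: open_near Uy _.
Qed.

Lemma C1_continuous U f x : C1_on U f -> U x -> {for x, continuous f}.
Proof. by move=> f1 /f1[/differentiable_continuous]. Qed.

Lemma C1_derivable U f x v : C1_on U f -> U x -> derivable f x v.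
Proof. by move=> f1 /f1[/diff_derivable]. Qed.

Lemma derive_partials f x (v : 'rV[R]_m) : differentiable f x ->
  'D_v f x = \sum_i v 0 i * 'D_(delta_mx 0 i) f x.
Proof.
move=> df; rewrite deriveE// {1}[v]row_sum_delta linear_sum; apply: eq_bigr => i _.
by rewrite linearZ/= deriveE.
Qed.

Lemma C1_partials U f : open U ->
  (forall (i : 'I_m) y, U y -> derivable f y (delta_mx 0 i)) ->
  (forall (i : 'I_m) x, U x -> {for x, continuous (fun y => 'D_(delta_mx 0 i) f y)}) ->
  C1_on U f.
Proof.
move=> oU fd fc.
have H x : U x -> differentiable f x.
  by move=> Ux; have [] := @partial_differentiable _ _ f U x oU Ux fd (fun i => fc i x Ux).
move=> x Ux; split; first exact: H.
move=> v; apply: (@continuous_near _ (fun y => \sum_i v 0 i * 'D_(delta_mx 0 i) f y)).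
  by apply: open_near Ux _ => // y /H fy; rewrite (derive_partials v fy).
apply: (@cvg_sumr _ _ (nbhs x)) => i; apply: cvgMl_tmp; exact: fc.
Qed.

Lemma C1_cst U (c : R) : C1_on U (fun=> c).
Proof.
move=> x _; split=> [|v]; first exact: differentiable_cst.
have -> : (fun y : 'rV[R]_m => 'D_v (fun=> c) y) = cst 0.
  by apply/funext => y; rewrite derive_cst.
exact: cst_continuous.
Qed.

Lemma C1_D U f g : open U -> C1_on U f -> C1_on U g -> C1_on U (fun x => f x + g x).
Proof.
move=> oU f1 g1 x Ux; split=> [|v].
  by apply: differentiableD; [exact: (f1 x Ux).1|exact: (g1 x Ux).1].
apply: (@continuous_near _ (fun y => 'D_v f y + 'D_v g y)).
  apply: open_near Ux _ => // y Uy; rewrite -deriveD//; exact: C1_derivable Uy.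
by apply: continuousD; [exact: (f1 x Ux).2|exact: (g1 x Ux).2].
Qed.

Lemma C1_M U f g : open U -> C1_on U f -> C1_on U g -> C1_on U (fun x => f x * g x).
Proof.
move=> oU f1 g1 x Ux; split=> [|v].
  by apply: differentiableM; [exact: (f1 x Ux).1|exact: (g1 x Ux).1].
apply: (@continuous_near _ (fun y => f y * 'D_v g y + g y * 'D_v f y)).
  apply: open_near Ux _ => // y Uy.
  by rewrite (@deriveM _ _ f g y v)//; exact: C1_derivable Uy.
by apply: continuousD; apply: continuousM; [exact: C1_continuous Ux|exact: (g1 x Ux).2|
  exact: C1_continuous Ux|exact: (f1 x Ux).2].
Qed.

Lemma C1_Z U c f : open U -> C1_on U f -> C1_on U (fun x => c * f x).
Proof. by move=> oU; apply: C1_M => //; exact: C1_cst. Qed.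

Lemma C1_N U f : open U -> C1_on U f -> C1_on U (fun x => - f x).
Proof.
move=> oU f1; apply: (@C1_ext _ (fun x => -1 * f x)) => // [x _|]; first by rewrite mulN1r.
exact: C1_Z.
Qed.

Lemma C1_sum U (I : Type) (s : seq I) (P : pred I) (F : I -> 'rV[R]_m -> R) : open U ->
  (forall i, C1_on U (F i)) -> C1_on U (fun x => \sum_(i <- s | P i) F i x).
Proof.
move=> oU F1; elim: s => [|i s IH].
  apply: (@C1_ext _ (fun=> 0)) => // [x _|]; [by rewrite big_nil|exact: C1_cst].
apply: (@C1_ext _ (fun x => (if P i then F i x else 0) + \sum_(j <- s | P j) F j x)) => //.
  by move=> x _; rewrite big_cons; case: (P i); rewrite ?add0r.
by apply: C1_D => //; case: (P i) => //; exact: C1_cst.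
Qed.

Lemma C1_prod U (I : Type) (s : seq I) (F : I -> 'rV[R]_m -> R) : open U ->
  (forall i, C1_on U (F i)) -> C1_on U (fun x => \prod_(i <- s) F i x).
Proof.
move=> oU F1; elim: s => [|i s IH].
  apply: (@C1_ext _ (fun=> 1)) => // [x _|]; [by rewrite big_nil|exact: C1_cst].
apply: (@C1_ext _ (fun x => F i x * \prod_(j <- s) F j x)) => //.
  by move=> x _; rewrite big_cons.
exact: C1_M.
Qed.

Lemma C1_V U f : open U -> (forall x, U x -> f x != 0) -> C1_on U f ->
  C1_on U (fun x => (f x)^-1).
Proof.
move=> oU fn0 f1 x Ux; split=> [|v].
  by apply: differentiableV; [exact: (f1 x Ux).1|exact: fn0].
apply: (@continuous_near _ (fun y => - (f y) ^- 2 * 'D_v f y)).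
  apply: open_near Ux _ => // y Uy.
  by rewrite (@deriveV _ _ f y v)//; [exact: fn0|exact: C1_derivable Uy].
apply: continuousM; last exact: (f1 x Ux).2.
apply: continuousN; apply: continuousV; first by rewrite expf_neq0// fn0.
by apply: continuousM; exact: C1_continuous Ux.
Qed.

Lemma smooth_C1 U f : open U -> smooth_on U f -> C1_on U f.
Proof.
move=> oU /(_ 1)[_ fU]; apply: C1_partials => // i x Ux.
  by have [+ _] := fU i; apply.
by have [_ [+ _]] := fU i => /(_ x); apply; rewrite inE.
Qed.

Lemma smooth_partial U f (i : 'I_m) : smooth_on U f ->
  smooth_on U (fun x => 'D_(delta_mx 0 i) f x).
Proof. by move=> fU r; have [_ /(_ i)[]] := fU r.+1. Qed.

Lemma smooth_dir_C1 U f (v : 'rV[R]_m) : open U -> smooth_on U f ->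
  C1_on U (fun x => 'D_v f x).
Proof.
move=> oU fU.
apply: (@C1_ext _ (fun y => \sum_i v 0 i * 'D_(delta_mx 0 i) f y)) => // [x Ux|].
  by rewrite (derive_partials v)//; exact: (smooth_C1 oU fU Ux).1.
by apply: C1_sum => // i; apply: C1_Z => //; apply: smooth_C1 => //; exact: smooth_partial.
Qed.

Lemma Cr_ext r U f g : open U -> (forall x, U x -> f x = g x) ->
  Cr_on r U f -> Cr_on r U g.
Proof.
move=> oU; elim: r f g => [|r IH] f g fg [fc fr].
  split=> // x xU; apply: continuous_near (fc x xU); rewrite inE in xU.
  by apply: open_near xU _.
split.
  move=> x xU; apply: continuous_near (fc x xU); rewrite inE in xU.
  by apply: open_near xU _.
move=> i; have [fd fi] := fr i; split.
  by move=> x Ux; apply: near_eq_derivable (fd x Ux); apply: open_near Ux _.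
apply: IH fi => x Ux; apply: near_eq_derive; exact: open_near Ux _.
Qed.

Lemma Cr_lin r U f g (c : R) : open U -> Cr_on r U f -> Cr_on r U g ->
  Cr_on r U (fun x => c * f x + g x).
Proof.
move=> oU; elim: r f g => [|r IH] f g [fc fr] [gc gr].
  split=> // x xU; exact: (continuousD (continuousM (@cst_continuous _ _ c x)
    (fc x xU : {for x, continuous f})) (gc x xU : {for x, continuous g})).
split=> [x xU|i].
  exact: (continuousD (continuousM (@cst_continuous _ _ c x)
    (fc x xU : {for x, continuous f})) (gc x xU : {for x, continuous g})).
have [fd fi] := fr i; have [gd gi] := gr i.
have fZ x : U x -> derivable (fun x => c * f x) x (delta_mx 0 i).
  by move=> Ux; apply: derivableZ; exact: fd.
split=> [x Ux|]; first by apply: derivableD; [exact: fZ|exact: gd].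
apply: Cr_ext (IH _ _ fi gi) => // x Ux.
rewrite deriveD; [|exact: fZ|exact: gd].
by congr (_ + _); rewrite (@deriveZ _ _ _ f c)//; exact: fd.
Qed.

Lemma smooth_lin U f g (c : R) : open U -> smooth_on U f -> smooth_on U g ->
  smooth_on U (fun x => c * f x + g x).
Proof. by move=> oU fU gU r; exact: Cr_lin. Qed.

Lemma smooth_ext U f g : open U -> (forall x, U x -> f x = g x) ->
  smooth_on U f -> smooth_on U g.
Proof. by move=> oU fg fU r; exact: Cr_ext (fU r). Qed.

Lemma smooth_cst U (c : R) : smooth_on U (fun=> c).
Proof.
move=> r; elim: r c => [|r IH] c; first by split=> // x _; exact: cst_continuous.
split=> [x _|i]; first exact: cst_continuous.
split=> [x _|]; first exact: derivable_cst.
have -> : (fun y : 'rV[R]_m => 'D_(delta_mx 0 i) (fun=> c) y) = fun=> 0.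
  by apply/funext => y; rewrite derive_cst.
exact: IH.
Qed.

Lemma smooth_sum U (I : Type) (s : seq I) (c : I -> R) (F : I -> 'rV[R]_m -> R) : open U ->
  (forall i, smooth_on U (F i)) -> smooth_on U (fun x => \sum_(i <- s) c i * F i x).
Proof.
move=> oU F1; elim: s => [|i s IH].
  apply: (@smooth_ext _ (fun=> 0)) => // [x _|]; [by rewrite big_nil|exact: smooth_cst].
apply: (@smooth_ext _ (fun x => c i * F i x + \sum_(j <- s) c j * F j x)) => //.
  by move=> x _; rewrite big_cons.
exact: smooth_lin.
Qed.

Lemma smooth_derive_comm U f (u v x : 'rV[R]_m) : open U -> smooth_on U f -> U x ->
  'D_v (fun y => 'D_u f y) x = 'D_u (fun y => 'D_v f y) x.
Proof.
move=> oU fU Ux; apply: derive_comm.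
- by apply: open_near Ux _ => // y Uy; apply: C1_derivable Uy; exact: smooth_C1.
- by apply: open_near Ux _ => // y Uy; apply: C1_derivable Uy; exact: smooth_C1.
- exact: (smooth_dir_C1 u oU fU Ux).1.
- exact: (smooth_dir_C1 v oU fU Ux).1.
Qed.

End C1.

(** * Determinants with closed columns as divergences *)

Section Divergence.
Context {R : realType} {m : nat}.
Implicit Types (f g : 'rV[R]_m -> R) (U : set 'rV[R]_m).

Lemma derive_sumC1 U x v (I : Type) (s : seq I) (P : pred I) (F : I -> 'rV[R]_m -> R) :
  open U -> U x -> (forall i, C1_on U (F i)) ->
  'D_v (fun y => \sum_(i <- s | P i) F i y) x = \sum_(i <- s | P i) 'D_v (F i) x.
Proof.
move=> oU Ux F1; elim: s => [|i s IH].
  rewrite big_nil (_ : (fun _ => _) = cst 0) ?derive_cst//.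
  by apply/funext => y; rewrite big_nil.
have E : (fun y => \sum_(j <- i :: s | P j) F j y) =
    (fun y => (if P i then F i y else 0) + \sum_(j <- s | P j) F j y).
  by apply/funext => y; rewrite big_cons; case: (P i); rewrite ?add0r.
rewrite E deriveD; first last.
- exact: C1_derivable (C1_sum _ _ oU F1) Ux.
- by case: (P i); [exact: C1_derivable Ux|exact: derivable_cst].
by rewrite IH big_cons; case: (P i) => //; rewrite derive_cst add0r.
Qed.

Lemma derive_MC1 U x v f g : C1_on U f -> C1_on U g -> U x ->
  'D_v (fun y => f y * g y) x = f x * 'D_v g x + g x * 'D_v f x.
Proof.
by move=> f1 g1 Ux; rewrite (@deriveM _ _ f g x v)//; exact: C1_derivable Ux.
Qed.

Lemma derive_prodC1 U x v (I : eqType) (s : seq I) (F : I -> 'rV[R]_m -> R) :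
  open U -> U x -> (forall i, i \in s -> C1_on U (F i)) -> uniq s ->
  'D_v (fun y => \prod_(i <- s) F i y) x =
  \sum_(l <- s) 'D_v (F l) x * \prod_(i <- s | i != l) F i x.
Proof.
move=> oU Ux; elim: s => [|i s IH] F1 /=.
  rewrite big_nil (_ : (fun _ => _) = cst 1) ?derive_cst//.
  by apply/funext => y; rewrite big_nil.
move=> /andP[is_ us].
have F1s j : j \in s -> C1_on U (F j) by move=> js; apply: F1; rewrite inE js orbT.
have -> : (fun y => \prod_(j <- i :: s) F j y) = (fun y => F i y * \prod_(j <- s) F j y).
  by apply/funext => y; rewrite big_cons.
have P1 : C1_on U (fun y => \prod_(j <- s) F j y).
  apply: (@C1_ext _ _ _ (fun y => \prod_(j <- s) (if j \in s then F j y else 1))) => //.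
    by move=> y _; apply: eq_big_seq => j ->.
  by apply: C1_prod => // j; have := F1s j; case: (j \in s) => [h|_]; [exact: h|exact: C1_cst].
rewrite (derive_MC1 _ _ P1 Ux); last by apply: F1; rewrite mem_head.
rewrite IH// !big_cons eqxx/= addrC mulrC; congr (_ * _ + _).
  rewrite [in RHS]big_seq_cond [LHS]big_seq; apply: eq_bigl => j.
  by case: (boolP (j \in s)) => //= js; apply/esym; apply: contraNneq is_ => <-.
rewrite mulr_sumr; apply: eq_big_seq => l ls.
rewrite big_cons ifT; last by apply: contraNneq is_ => ->.
by move: ('D_v (F l) x) => d; rewrite mulrCA.
Qed.

Context (U : set 'rV[R]_m) (oU : open U) (k0 : 'I_m) (B : 'rV[R]_m -> 'M[R]_m)
  (B1 : forall a k, k != k0 -> C1_on U (fun x => B x a k))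
  (Bcl : forall x a b k, U x -> k != k0 -> 'D_(delta_mx 0 a) (fun y => B y b k) x =
    'D_(delta_mx 0 b) (fun y => B y a k) x).

Definition subprod (s : 'S_m) x := \prod_(k | k != k0) B x (s k) k.

(** The cofactor of the entry (i, k0), as the part of the Leibniz formula with s k0 = i: this form
    lets the terms of the divergence be paired by a transposition. Column k0 does not occur in
    it. *)
Definition cof (i : 'I_m) x := \sum_(s : 'S_m | s k0 == i) (-1) ^+ s * subprod s x.

Lemma subprod_C1 s : C1_on U (subprod s).
Proof.
apply: (@C1_ext _ _ _ (fun x => \prod_(k <- enum 'I_m) (if k != k0 then B x (s k) k else 1))) => //.
  by move=> x _; rewrite /subprod big_enum/= [RHS]big_mkcond.
by apply: C1_prod => // k; have := @B1 (s k) k; case: (k != k0) => [h|_]; [exact: h|exact: C1_cst].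
Qed.

Lemma cof_C1 i : C1_on U (cof i).
Proof.
by apply: C1_sum => // s; apply: C1_Z => //; exact: subprod_C1.
Qed.

Lemma derive_subprod s x v : U x -> 'D_v (subprod s) x =
  \sum_(l | l != k0) 'D_v (fun y => B y (s l) l) x *
    \prod_(k | (k != k0) && (k != l)) B x (s k) k.
Proof.
move=> Ux; set r := [seq k <- enum 'I_m | k != k0].
have E : subprod s = (fun y => \prod_(k <- r) B y (s k) k).
  by apply/funext => y; rewrite /subprod /r big_filter big_enum_cond.
rewrite E (derive_prodC1 v oU Ux).
- rewrite /r big_filter big_enum_cond/=; apply: eq_bigr => l _; congr (_ * _).
  by rewrite big_filter_cond big_enum_cond.
- by move=> k; rewrite mem_filter => /andP[/B1].
- by rewrite filter_uniq ?enum_uniq.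
Qed.

(* Piola: the terms of s and of s composed with the transposition of k0 and l
   cancel since the l-th column is closed. *)
Lemma cof_divergence_free x : U x -> \sum_i 'D_(delta_mx 0 i) (cof i) x = 0.
Proof.
move=> Ux.
pose T (l : 'I_m) (s : 'S_m) := (-1) ^+ s * ('D_(delta_mx 0 (s k0)) (fun y => B y (s l) l) x *
    \prod_(k | (k != k0) && (k != l)) B x (s k) k).
have -> : \sum_i 'D_(delta_mx 0 i) (cof i) x = \sum_(l | l != k0) \sum_s T l s.
  rewrite exchange_big/= (partition_big (fun s : 'S_m => s k0) xpredT)//=.
  apply: eq_bigr => i _; rewrite (derive_sumC1 _ _ _ oU Ux); last first.
    by move=> s; apply: C1_Z => //; exact: subprod_C1.
  apply: eq_bigr => s /eqP si.
  rewrite (derive_MC1 _ (@C1_cst _ _ U _) (subprod_C1 s) Ux).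
  have -> : 'D_(delta_mx 0 i) (fun _ : 'rV[R]_m => (-1) ^+ s : R) x = 0 by exact: derive_cst.
  rewrite mulr0 addr0.
  by rewrite derive_subprod// mulr_sumr; apply: eq_bigr => l _; rewrite /T si.
apply: big1 => l lk0.
have h : \sum_s T l s = - \sum_s T l s.
  rewrite {1}(reindex_inj (mulgI (tperm k0 l)))/= -sumrN; apply: eq_bigr => s _.
  rewrite /T odd_permM odd_tperm eq_sym lk0 signr_addb mulN1r mulNr; congr (- (_ * (_ * _))).
    by rewrite !permM tpermL tpermR Bcl.
  apply: eq_bigr => k /andP[kk0 kl]; rewrite permM tpermD//; by rewrite eq_sym.
by apply/eqP; rewrite -[_ == _](mulrn_eq0 _ 2) mulr2n {2}h subrr.
Qed.

(** The cofactors being divergence free, the divergence of u times the cofactors is the gradient of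
    u paired with them, that is, the expansion of the determinant along column k0. *)
Lemma divergence_det u x : C1_on U u -> U x ->
  \sum_i 'D_(delta_mx 0 i) (fun y => u y * cof i y) x =
  \det (\matrix_(a, k) if k == k0 then 'D_(delta_mx 0 a) u x else B x a k).
Proof.
move=> u1 Ux.
transitivity (\sum_i (u x * 'D_(delta_mx 0 i) (cof i) x +
    cof i x * 'D_(delta_mx 0 i) u x)).
  by apply: eq_bigr => i _; rewrite (derive_MC1 _ u1 (cof_C1 i) Ux).
rewrite big_split/= -mulr_sumr cof_divergence_free// mulr0 add0r.
rewrite -det_tr /determinant (partition_big (fun s : 'S_m => s k0) xpredT)//=.
apply: eq_bigr => i _; rewrite mulr_suml; apply: eq_bigr => s /eqP si.
rewrite (bigD1 k0)//= !mxE eqxx si -mulrA [subprod s x * _]mulrC; congr (_ * (_ * _)).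
by apply: eq_bigr => k /negbTE kk0; rewrite !mxE kk0.
Qed.

End Divergence.

(** * Change of variables *)

Section CompactUniformity.
Context {R : realType}.

(** The local hypothesis covers all smaller constants d', so that the neighbourhoods given by
    compactness have a common one. The uniform estimates of the change of variables that involve a
    constant or a modulus are reduced to local ones in this way. *)
Lemma compact_uniform (T : topologicalType) (K : set T) (P : R -> T -> Prop) :
  compact K ->
  (forall x, K x -> exists2 d, 0 < d & \forall y \near x, forall d', 0 < d' <= d -> P d' y) ->
  exists2 d, 0 < d & forall x, K x -> P d x.
Proof.
move=> /compact_near_coveringP cK KP.
have : \forall d \near (0 : R)^'+, K `<=` P d.
  apply: cK => x Kx; have [d d0 dP] := KP x Kx.
  exists ([set y | forall d', 0 < d' <= d -> P d' y], [set e | 0 < e <= d]) => /=.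
    split=> //; near=> e; apply/andP; split; first by [].
    by near: e; exact: nbhs_right_le.
  by move=> [y e] /= [yP ed]; exact: yP.
move=> H; have H0 : \forall d \near (0 : R)^'+, 0 < d by exact: nbhs_right_gt.
by have [d [d0 dP]] := filter_ex (filterI H0 H); exists d.
Unshelve. all: by end_near. Qed.

(** The bound is written as the inverse of d, so that decreasing d weakens the claim. *)
Lemma compact_bounded_continuous (T : topologicalType) (V : normedModType R)
    (K : set T) (h : T -> V) : compact K ->
  (forall x, K x -> {for x, continuous h}) -> exists B, forall x, K x -> `|h x| <= B.
Proof.
move=> cK hc; have [|d d0 dP] := @compact_uniform _ _ (fun d y => `|h y| <= d^-1) cK.
  move=> x Kx; exists (`|h x| + 1)^-1; first by rewrite invr_gt0 ltr_wpDl.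
  have /cvgrPdist_le/(_ _ ltr01) := hc x Kx; apply: filterS => y hxy d' /andP[d'0 d'd].
  apply: (@le_trans _ _ (`|h x| + 1)).
    rewrite -[h y](subKr (h x)) (le_trans (ler_normB _ _))// lerD2l//.
  by rewrite -[leLHS]invrK lef_pV2// posrE invr_gt0 ltr_wpDl.
by exists d^-1.
Qed.

Lemma uniform_continuous_support (V W : normedModType R) (K : set V) (f : V -> W) :
  compact K -> continuous f -> (forall x, f x != 0 -> K x) ->
  forall e, 0 < e -> exists2 d, 0 < d & forall x y, `|x - y| <= d -> `|f x - f y| <= e.
Proof.
move=> cK fc fK e e0.
have [|d d0 dP] := @compact_uniform _ _
    (fun d x => forall y, `|x - y| <= d -> `|f x - f y| <= e) cK.
  move=> x Kx; have e20 : 0 < e / 2 by rewrite divr_gt0.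
  have /cvgrPdist_le/(_ _ e20)/nbhs_normP[r /= r0 rP] := fc x.
  have r20 : 0 < r / 2 by rewrite divr_gt0.
  exists (r / 2 / 2); first by rewrite divr_gt0.
  apply/nbhs_normP; exists (r / 2) => //= y xy d' /andP[_ d'r] z yz.
  have h1 : `|f x - f y| <= e / 2 by apply: rP; rewrite /= (lt_trans xy)// ltr_pdivrMr// mulr_natr mulr2n ltrDl.
  have h2 : `|f x - f z| <= e / 2.
    apply: rP => /=; rewrite -(subrKA y) (le_lt_trans (ler_normD _ _))//.
    by rewrite [r]splitr ltr_leD// (le_trans yz)// (le_trans d'r)// ler_pdivrMr// mulr_natr mulr2n lerDl ltW.
  rewrite -(subrKA (f x)) (le_trans (ler_normD _ _))// distrC.
  by rewrite [e]splitr lerD.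
exists d => // x y xy.
have [fx|/fK Kx] := eqVneq (f x) 0; last exact: dP.
have [fy|/fK Ky] := eqVneq (f y) 0; last by rewrite distrC dP// distrC.
by rewrite fx fy subr0 normr0 ltW.
Qed.

End CompactUniformity.

Section ContinuousMatrices.
Context {R : realType} {T : topologicalType}.

Lemma continuous_mx p q (h : T -> 'M[R]_(p, q)) (x : T) :
  (forall i j, {for x, continuous (fun y => h y i j)}) -> {for x, continuous h}.
Proof.
move=> hc; apply/cvgrPdist_le => e e0; near=> y.
apply: mx_norm_le => [|i j]; first exact: ltW.
rewrite !mxE; move: i j; near: y; apply: filter_forall => i; apply: filter_forall => j.
by have /cvgrPdist_le/(_ _ e0) := hc i j.
Unshelve. all: by end_near. Qed.

Lemma continuous_entry p q (h : T -> 'M[R]_(p, q)) (x : T) i j :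
  {for x, continuous h} -> {for x, continuous (fun y => h y i j)}.
Proof.
by move=> hc; apply: (@continuous_comp _ _ _ h (fun A : 'M[R]_(p, q) => A i j)) => //;
  exact: coord_continuous.
Qed.

Lemma continuous_det p (h : T -> 'M[R]_p) (x : T) :
  {for x, continuous h} -> {for x, continuous (fun y => \det (h y))}.
Proof.
move=> hc; apply: (@cvg_sumr _ _ (nbhs x)) => s.
apply: cvgMl_tmp; apply: cvg_big => [|i _]; first exact: mul_continuous.
exact: continuous_entry.
Qed.

End ContinuousMatrices.

Lemma derive_coord {R : realType} m (v y : 'rV[R]_m) (b : 'I_m) :
  'D_v (fun x : 'rV[R]_m => x 0 b) y = v 0 b.
Proof.
have := derive_mx (@derivable_id _ 'rV[R]_m y v); rewrite derive_id.
by move=> /(congr1 (fun w : 'rV[R]_m => w 0 b)); rewrite mxE.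
Qed.

Section EuclideanChangeOfVariables.
Context {R : realType} {n : nat}.
Let m := n.+1.

Lemma compact_image_continuous (S T : topologicalType) (K : set S) (h : S -> T) :
  compact K -> (forall x, K x -> {for x, continuous h}) -> compact (h @` K).
Proof.
move=> cK hc; apply: continuous_compact => //; apply: continuous_in_subspaceT => x.
by rewrite inE; exact: hc.
Qed.

(** Compactness of K and of its image turns pointwise regularity into the uniform hypotheses of
    [lsum_cov_approx]. *)
Lemma lsum_cov_diff (U W K : set 'rV[R]_m) (phi psi : 'rV[R]_m -> 'rV[R]_m)
    (J : 'rV[R]_m -> 'M[R]_m) (f g : 'rV[R]_m -> R) :
  open U -> compact K -> K `<=` U ->
  (forall b, C1_on U (fun x => phi x 0 b)) ->
  (forall x, U x -> W (phi x) /\ psi (phi x) = x) ->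
  (forall y, W y -> {for y, continuous psi}) ->
  (forall x i b, U x -> J x i b = 'D_(delta_mx 0 i) (fun y => phi y 0 b) x) ->
  (forall x, U x -> 0 < \det (J x)) ->
  (forall x, U x -> f x = \det (J x) * g (phi x)) ->
  continuous f -> continuous g ->
  (forall x, f x != 0 -> K x) -> (forall y, g y != 0 -> (phi @` K) y) ->
  forall e, 0 < e ->
    \forall M \near \oo, \forall N \near \oo, `|lsum N f - lsum M g| <= e.
Proof.
move=> oU cK KU phi1 phiK psic JE Jpos fJ fc gc fK gK.
have phic x : U x -> {for x, continuous phi}.
  move=> Ux; apply: continuous_mx => i b; rewrite ord1.
  exact: C1_continuous (phi1 b) Ux.
have ck' := compact_image_continuous cK (fun x Kx => phic x (KU x Kx)).
have Jc x : U x -> {for x, continuous J}.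
  move=> Ux; apply: continuous_mx => i b.
  apply: (@continuous_near _ _ _ (fun y => 'D_(delta_mx 0 i) (fun y => phi y 0 b) y)).
    by apply: open_near Ux _ => // y Uy; rewrite JE.
  exact: (phi1 b x Ux).2.
have Jnear x e : U x -> 0 < e -> \forall y \near x, `|J y - J x| <= e.
  move=> Ux e0; have /cvgrPdist_le/(_ _ e0) := Jc x Ux.
  by apply: filterS => y; rewrite distrC.
have Jinvx x : U x -> exists2 C, 0 < C & forall v : 'rV[R]_m, `|v| <= C * `|v *m J x|.
  move=> Ux; exists (m%:R * `|invmx (J x)| + 1); first by rewrite ltr_wpDl// mulr_ge0.
  have Ju : J x \in unitmx by rewrite unitmxE unitfE gt_eqF// Jpos.
  move=> v; rewrite -{1}[v](mulmxK Ju) (le_trans (norm_mulmx_le _ _))//.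
  by rewrite ler_wpM2r// lerDl.
apply: (@lsum_cov_approx R n K phi psi J f g).
- exact: fK.
- by move=> y /gK[x Kx <-]; have [_ ->] := phiK x (KU x Kx).
- by have [B BP] := compact_bounded_continuous cK (fun x Kx => @cvg_id _ (nbhs x)); exists B.
- by have [B BP] := compact_bounded_continuous cK (fun x Kx => phic x (KU x Kx)); exists B.
- by move=> x Kx; apply: fJ; exact: KU.
- by move=> x Kx; apply: Jpos; exact: KU.
- have [|B BP] := @compact_bounded_continuous _ _ _ _ (fun x => \det (J x)) cK.
    by move=> x Kx; apply: continuous_det; apply: Jc; exact: KU.
  by exists B => x Kx; rewrite (le_trans (ler_norm _))// BP.
(* A bound C for the inverse of J x becomes 2 C nearby: the perturbation of v J contributes at most
   |v|/2, which is absorbed on the left. The constant is again the inverse of d. *)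
- have [|d d0 dP] := @compact_uniform _ _ _ (fun d x => forall v : 'rV[R]_m,
      `|v| <= d^-1 * `|v *m J x|) cK; last first.
    by exists d^-1; [rewrite invr_gt0|move=> x v Kx; exact: dP].
  move=> x Kx; have [C C0 CP] := Jinvx x (KU x Kx).
  have e0 : 0 < (2 * C * m%:R)^-1 by rewrite invr_gt0 !mulr_gt0.
  exists (2 * C)^-1; first by rewrite invr_gt0 mulr_gt0.
  apply: filterS (Jnear x _ (KU x Kx) e0) => y Jy d /andP[d0 dC] v.
  have h1 : `|v *m (J y - J x)| <= (2 * C)^-1 * `|v|.
    apply: le_trans (norm_mulmx_le _ _) _; rewrite ler_wpM2r//.
    rewrite -ler_pdivlMl//; apply: le_trans Jy _.
    by rewrite le_eqVlt; apply/orP; left; apply/eqP; field; rewrite !gt_eqF.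
  have h2 : `|v| <= C * (`|v *m J y| + (2 * C)^-1 * `|v|).
    apply: le_trans (CP v) _; rewrite ler_wpM2l ?(ltW C0)//.
    have -> : v *m J x = v *m J y - v *m (J y - J x).
      by rewrite -mulmxBr subKr.
    by apply: le_trans (ler_normB _ _) _; rewrite lerD2l.
  apply: (@le_trans _ _ (2 * C * `|v *m J y|)); last first.
    rewrite ler_wpM2r// -[leLHS]invrK lef_pV2// posrE invr_gt0 mulr_gt0//.
  have E : C * ((2 * C)^-1 * `|v|) = `|v| / 2 by field; rewrite gt_eqF.
  by move: h2; rewrite mulrDr E; lra.
- have [B BP] := compact_bounded_continuous cK (fun x Kx => Jc x (KU x Kx)).
  exists (m%:R * (`|B| + 1)); first by rewrite mulr_gt0// ltr_wpDl.
  move=> x v Kx; apply: le_trans (norm_mulmx_le _ _) _; rewrite ler_wpM2r// ler_wpM2l//.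
  by rewrite (le_trans (BP x Kx))// (le_trans (ler_norm _))// lerDl.
- exact: uniform_continuous_support cK fc fK.
- exact: uniform_continuous_support ck' gc gK.
- have [B BP] := compact_bounded_continuous cK (fun x _ => fc x).
  exists `|B| => x; have [->|/fK Kx] := eqVneq (f x) 0; first by rewrite normr0.
  by rewrite (le_trans (BP x Kx))// ler_norm.
- move=> e e0.
  have [|d d0 dP] := @compact_uniform _ _ _ (fun d x => forall y, `|y - x| <= d ->
    `|phi y - phi x - (y - x) *m J x| <= e * `|y - x|) cK; last first.
    by exists d => // x y Kx; exact: dP.
  (* Strict differentiability at x controls the increment of phi between any two points near x, with
     the matrix J x; continuity of J then allows it to be replaced by the matrix at the base point.
     Each costs e/2. *)
  move=> x Kx.
  have e20 : 0 < e / 2 by rewrite divr_gt0.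
  have e2m : 0 < e / 2 / m%:R by rewrite divr_gt0.
  have [r [r0 rP]] : exists r, 0 < r /\ forall (b : 'I_m) y z, `|x - y| < r -> `|x - z| < r ->
      `|phi z 0 b - phi y 0 b - ((z - y) *m J x) 0 b| <= e / 2 * `|z - y|.
    have Hb (b : 'I_m) : \forall r \near (0 : R)^'+, forall y z,
        `|x - y| < r -> `|x - z| < r ->
        `|phi z 0 b - phi y 0 b - ((z - y) *m J x) 0 b| <= e / 2 * `|z - y|.
      have [||d d0 dP] := @strict_diff _ _ (fun y => phi y 0 b) U x oU (KU x Kx) _ _ _ e20.
      - by move=> i y Uy; exact: C1_derivable (phi1 b) Uy.
      - by move=> i; exact: (phi1 b x (KU x Kx)).2.
      have rd : \forall r \near (0 : R)^'+, r < d by exact: nbhs_right_lt.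
      apply: filterS rd => r rd y z xy xz.
      have := dP y z (lt_trans xy rd) (lt_trans xz rd).
      have -> // : ((z - y) *m J x) 0 b =
          \sum_i (z 0 i - y 0 i) * 'D_(delta_mx 0 i) (fun y => phi y 0 b) x.
      rewrite mxE; apply: eq_bigr => i _; rewrite !mxE JE//; exact: KU.
    have r0 : \forall r \near (0 : R)^'+, 0 < r by exact: nbhs_right_gt.
    by have [r [? H]] := filter_ex (filterI r0 (filter_forall _ Hb)); exists r.
  exists (r / 2); first by rewrite divr_gt0.
  have Jx := Jnear x _ (KU x Kx) e2m.
  have xr : \forall y \near x, `|x - y| < r / 2.
    by apply/nbhs_normP; exists (r / 2) => //=; rewrite divr_gt0.
  apply: filterS2 xr Jx => x' xx' Jx' d /andP[_ dr] y yx'.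
  have x'r : `|x - x'| < r by rewrite (lt_trans xx')// ltr_pdivrMr// mulr_natr mulr2n ltrDl.
  have yr : `|x - y| < r.
    rewrite -(subrKA x') (le_lt_trans (ler_normD _ _))// [r]splitr ltr_leD//.
    by rewrite distrC (le_trans yx').
  apply: mx_norm_le => [|i b]; first by rewrite mulr_ge0// ltW.
  rewrite ord1 {i}.
  have -> : (phi y - phi x' - (y - x') *m J x') 0 b =
      (phi y 0 b - phi x' 0 b - ((y - x') *m J x) 0 b) - ((y - x') *m (J x' - J x)) 0 b.
    by rewrite mulmxBr !mxE; ring.
  apply: le_trans (ler_normB _ _) _; rewrite [e]splitr mulrDl; apply: lerD.
    exact: rP.
  apply: le_trans (coord_le_norm _ _ _) _; apply: le_trans (norm_mulmx_le _ _) _.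
  rewrite ler_wpM2r//; apply: le_trans (ler_wpM2l (ler0n _ _) Jx') _.
  by rewrite mulrC divfK// gt_eqF.
- move=> e e0.
  have [|d d0 dP] := @compact_uniform _ _ _ (fun d (z : 'rV[R]_m) => forall y, W y -> `|z - y| <= d ->
      `|psi z - psi y| <= e) ck'; last first.
    exists d => // x y Kx Ky xy.
    have [_ Ex] := phiK x (KU x Kx); have [Wy Ey] := phiK y (KU y Ky).
    by rewrite -Ex -Ey; apply: dP => //; exists x.
  move=> _ [x Kx <-]; have [Wx Ex] := phiK x (KU x Kx).
  have e20 : 0 < e / 2 by rewrite divr_gt0.
  have /cvgrPdist_le/(_ _ e20)/nbhs_normP[r /= r0 rP] := psic _ Wx.
  exists (r / 2); first by rewrite divr_gt0.
  apply/nbhs_normP; exists (r / 2) => /=; first by rewrite divr_gt0.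
  move=> z xz d /andP[_ dr] y Wy zy.
  have h1 : `|psi (phi x) - psi z| <= e / 2.
    by apply: rP; rewrite /= (lt_trans xz)// ltr_pdivrMr// mulr_natr mulr2n ltrDl.
  have h2 : `|psi (phi x) - psi y| <= e / 2.
    apply: rP => /=; rewrite -(subrKA z) (le_lt_trans (ler_normD _ _))//.
    by rewrite [r]splitr ltr_leD// (le_trans zy).
  rewrite -(subrKA (psi (phi x))) (le_trans (ler_normD _ _))// distrC.
  by rewrite [e]splitr lerD.
Unshelve. all: by end_near. Qed.

(** [lsum_cov_diff] relates the sum of f at mesh N to that of g at mesh M. Applied also to g and the
    identity map, it relates the sums of g at the two meshes, and M is eliminated. *)
Lemma lsum_cov (U W K : set 'rV[R]_m) (phi psi : 'rV[R]_m -> 'rV[R]_m)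
    (J : 'rV[R]_m -> 'M[R]_m) (f g : 'rV[R]_m -> R) :
  open U -> compact K -> K `<=` U ->
  (forall b, C1_on U (fun x => phi x 0 b)) ->
  (forall x, U x -> W (phi x) /\ psi (phi x) = x) ->
  (forall y, W y -> {for y, continuous psi}) ->
  (forall x i b, U x -> J x i b = 'D_(delta_mx 0 i) (fun y => phi y 0 b) x) ->
  (forall x, U x -> 0 < \det (J x)) ->
  (forall x, U x -> f x = \det (J x) * g (phi x)) ->
  continuous f -> continuous g ->
  (forall x, f x != 0 -> K x) -> (forall y, g y != 0 -> (phi @` K) y) ->
  lsum N f - lsum N g @[N --> \oo] --> 0.
Proof.
move=> oU cK KU phi1 phiK psic JE Jpos fJ fc gc fK gK.
apply/cvgrPdist_le => e e0; have e20 : 0 < e / 2 by rewrite divr_gt0.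
have cK' : compact (phi @` K).
  apply: compact_image_continuous => // x Kx; apply: continuous_mx => i b; rewrite ord1.
  exact: C1_continuous (phi1 b) (KU x Kx).
have A1 := lsum_cov_diff oU cK KU phi1 phiK psic JE Jpos fJ fc gc fK gK e20.
have A2 : \forall M \near \oo, \forall N \near \oo, `|lsum N g - lsum M g| <= e / 2.
  apply: (@lsum_cov_diff setT setT (phi @` K) id id (fun=> 1%:M) g g) => //.
  - exact: openT.
  - move=> b x _; split=> [|v]; first exact: differentiable_coord.
    have -> : (fun y : 'rV[R]_m => 'D_v (fun x : 'rV[R]_m => x 0 b) y) = cst (v 0 b).
      by apply/funext => y; exact: derive_coord.
    exact: cst_continuous.
  - by move=> y _; exact: cvg_id.
  - move=> x i b _.
    by rewrite -[RHS]/('D_(delta_mx 0 i) (fun y : 'rV[R]_m => y 0 b) x) derive_coord !mxE eqxx eq_sym.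
  - by move=> x _; rewrite det1.
  - by move=> x _; rewrite det1 mul1r.
  - by move=> y /gK ?; exists y.
have [M [M1 M2]] := filter_ex (filterI A1 A2).
apply: filterS2 M1 M2 => N h1 h2.
rewrite sub0r normrN -(subrKA (lsum M g)) (le_trans (ler_normD _ _))//.
by rewrite [e]splitr lerD// distrC.
Qed.

End EuclideanChangeOfVariables.

(** * Positivity of sums and extension by zero *)

Section ZeroExtension.
Context {R : realType} {n : nat}.
Let m := n.+1.
Implicit Types (f h : 'rV[R]_m -> R) (U K : set 'rV[R]_m).

Lemma lsum_pos r f x0 : supp_in r f -> (forall x, 0 <= f x) ->
  {for x0, continuous f} -> 0 < f x0 ->
  exists2 d, 0 < d & \forall N \near \oo, d <= lsum N f.
Proof.
move=> fr f0 fc fx0; have c0 : 0 < f x0 / 2 by rewrite divr_gt0.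
have [d d0 dP] : exists2 d, 0 < d & forall x, `|x - x0| < d -> f x0 / 2 <= f x.
  have /cvgrPdist_le/(_ _ c0)/nbhs_normP[d /= d0 dP] := fc; exists d => // x xd.
  have := dP x; rewrite /= distrC => /(_ xd); rewrite ler_norml => /andP[_].
  lra.
(* This scaling confines the hat function to the cube of half-side d/2 around x0. *)
pose A : 'M[R]_m := (2 / d)%:M.
have d20 : 0 < 2 / d by rewrite divr_gt0.
have Au : A \in unitmx by rewrite unitmxE det_scalar unitfE expf_neq0// gt_eqF.
pose b := - (x0 *m A).
pose g x := f x0 / 2 * kap (x *m A + b).
have kl := lsum_kap b Au.
set l := `|\det A|^-1 in kl; have l0 : 0 < l.
  by rewrite invr_gt0 normr_gt0 -unitfE -unitmxE.
exists (f x0 / 2 * (l / 2)); first by rewrite mulr_gt0// divr_gt0.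
have kr : supp_in 1 (@kap R m) by move=> x /kap_supp x1 i; rewrite ltW.
have [rg gr] : exists r, supp_in r g.
  have [rg rgP] := supp_in_affine b Au kr.
  by exists rg; apply: supp_inMr rgP.
have gf x : g x <= f x.
  rewrite /g; have [->|kx] := eqVneq (kap (x *m A + b)) 0; first by rewrite mulr0.
  apply: (@le_trans _ _ (f x0 / 2)); first by rewrite ler_piMr ?(ltW c0)// kap_le1.
  apply: dP; have := kap_supp kx; rewrite /b -mulmxBl mul_mx_scalar => h.
  apply: (@le_lt_trans _ _ (d / 2)); last by rewrite ltr_pdivrMr// mulr_natr mulr2n ltrDl.
  apply: mx_norm_le => [|i j]; first by rewrite divr_ge0// ltW.
  rewrite ord1; have := h j; rewrite mxE normrM gtr0_norm// => hj.
  by rewrite -[d / 2]invf_div -[leRHS]mulr1 mulrC ler_pdivlMr// mulrC ltW.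
have [rm [fm gm]] : exists r, supp_in r f /\ supp_in r g.
  exists (maxn r rg); split; [apply: supp_in_le fr|apply: supp_in_le gr];
  by rewrite ?leq_maxl ?leq_maxr.
have l20 : 0 < l / 2 by rewrite divr_gt0.
have /cvgrPdist_le/(_ _ l20) := kl; apply: filterS => N kN.
apply: le_trans (lsum_le N gm fm gf); rewrite lsumZ ler_wpM2l ?(ltW c0)//.
by move: kN; rewrite ler_norml => /andP[_]; lra.
Qed.

(** Chart expressions are meaningful only on the image of the chart, while lattice sums need
    functions on all of R^m. For h vanishing off a compact subset of U, the extension keeps its
    regularity. *)
Definition zext U h x := if `[< U x >] then h x else 0.

Lemma zextE U h x : U x -> zext U h x = h x.
Proof. by move=> Ux; rewrite /zext asboolT. Qed.

Lemma zext0 U h x : ~ U x -> zext U h x = 0.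
Proof. by move=> Ux; rewrite /zext asboolF. Qed.

Lemma zext_supp U K h : (forall x, U x -> ~ K x -> h x = 0) ->
  forall x, zext U h x != 0 -> K x.
Proof.
move=> h0 x; have [Ux|nUx] := pselect (U x); last by rewrite zext0// eqxx.
by rewrite zextE// => hx; apply: contrapT => Kx; move/eqP: hx; apply; exact: h0.
Qed.

Lemma zext_near U K h x : open U -> closed K -> K `<=` U ->
  (forall x, U x -> ~ K x -> h x = 0) ->
  (U x /\ \forall y \near x, h y = zext U h y) \/
  (~ K x /\ \forall y \near x, 0 = zext U h y).
Proof.
move=> oU clK KU h0; have [Ux|nUx] := pselect (U x).
  by left; split=> //; apply: open_near Ux _ => // y Uy; rewrite zextE.
right; have nKx : ~ K x by move/KU.
split=> //; have oK : open (~` K) by exact: closed_openC.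
apply: (open_near oK) => // y nKy; apply/esym/eqP/negPn/negP => /(zext_supp h0).
exact: nKy.
Qed.

Lemma zext_continuous U K h : open U -> closed K -> K `<=` U ->
  (forall x, U x -> ~ K x -> h x = 0) ->
  (forall x, U x -> {for x, continuous h}) -> continuous (zext U h).
Proof.
move=> oU clK KU h0 hc x.
have [[Ux hx]|[_ hx]] := zext_near x oU clK KU h0.
  exact: continuous_near hx (hc x Ux).
by apply: continuous_near hx _; exact: cst_continuous.
Qed.

Lemma zext_C1 U K h : open U -> closed K -> K `<=` U ->
  (forall x, U x -> ~ K x -> h x = 0) -> C1_on U h -> C1_on setT (zext U h).
Proof.
move=> oU clK KU h0 h1.
have oK : open (~` K) by exact: closed_openC.
have H1 : C1_on U (zext U h) by apply: C1_ext h1 => // x Ux; rewrite zextE.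
have H2 : C1_on (~` K) (zext U h).
  apply: C1_ext (@C1_cst _ _ _ 0) => // x nKx.
  by apply/esym/eqP/negPn/negP => /(zext_supp h0).
move=> x _; have [Ux|nUx] := pselect (U x); first exact: H1.
by apply: H2 => /KU.
Qed.

Lemma derive_zext U K h v : open U -> closed K -> K `<=` U ->
  (forall x, U x -> ~ K x -> h x = 0) ->
  (fun x => 'D_v (zext U h) x) = zext U (fun x => 'D_v h x).
Proof.
move=> oU clK KU h0; apply/funext => x.
have [[Ux hx]|[nKx hx]] := zext_near x oU clK KU h0.
  by rewrite zextE// -(near_eq_derive _ hx).
rewrite -(near_eq_derive _ hx) derive_cst.
have [Ux|nUx] := pselect (U x); last by rewrite zext0.
rewrite zextE//; have hx' : \forall y \near x, 0 = h y.
  have oUK : open (U `&` ~` K) by apply: openI => //; exact: closed_openC.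
  by apply: (open_near oUK) => // y [Uy nKy]; rewrite h0.
by rewrite -(near_eq_derive _ hx') derive_cst.
Qed.

Lemma compact_supp_in K f : compact K -> (forall x, f x != 0 -> K x) ->
  exists r, supp_in r f.
Proof.
move=> cK fK; have [B BP] := compact_bounded_continuous cK (fun x Kx => @cvg_id _ (nbhs x)).
by apply: (@norm_supp_in _ _ B) => x /fK /BP.
Qed.

Lemma derive_zext_supp U K h v : open U -> closed K -> K `<=` U ->
  (forall x, U x -> ~ K x -> h x = 0) ->
  forall x, zext U (fun x => 'D_v h x) x != 0 -> K x.
Proof.
move=> oU clK KU h0; apply: zext_supp => y Uy nKy.
rewrite -(zextE (fun x => 'D_v h x) Uy) -(derive_zext v oU clK KU h0).
have hy : \forall z \near y, 0 = zext U h z.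
  have oK : open (~` K) by exact: closed_openC.
  apply: (open_near oK) => // z nKz; apply/esym/eqP/negPn/negP => /(zext_supp h0).
  exact: nKz.
by rewrite -(near_eq_derive _ hy) derive_cst.
Qed.

Lemma lsum_divergence U K h (i : 'I_m) : open U -> compact K -> K `<=` U ->
  (forall x, U x -> ~ K x -> h x = 0) -> C1_on U h ->
  lsum N (zext U (fun x => 'D_(delta_mx 0 i) h x)) @[N --> \oo] --> 0.
Proof.
move=> oU cK KU h0 h1.
have clK : closed K by apply: compact_closed => //; exact: norm_hausdorff.
have DE := derive_zext (delta_mx 0 i) oU clK KU h0.
have hT := zext_C1 oU clK KU h0 h1.
have K0 := derive_zext_supp (v := delta_mx 0 i) oU clK KU h0.
have [r1 r1P] := compact_supp_in cK K0.
have [r2 r2P] := compact_supp_in cK (zext_supp h0).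
rewrite -DE in r1P K0 *.
apply: (@lsum_derive _ _ (maxn r1 r2)).
- by apply: supp_in_le r2P; exact: leq_maxr.
- by apply: supp_in_le r1P; exact: leq_maxl.
- by move=> x; exact: C1_derivable hT I.
- move=> e e0.
  have Dc : continuous (fun x => 'D_(delta_mx 0 i) (zext U h) x).
    by move=> x; exact: (hT x I).2.
  have [d d0 dP] := uniform_continuous_support cK Dc K0 e0.
  exists d => // x t /andP[t0 td]; apply: dP.
  rewrite addrC addKr normrZ ger0_norm// (le_trans _ td)// ler_piMr//.
  apply: mx_norm_le => // a b; rewrite mxE; case: (_ && _); by rewrite ?normr1 ?normr0.
Qed.

End ZeroExtension.

(** * Differential forms in charts *)

Section WedgeOfDeterminants.
Context {R : realType}.

Definition same_block k l (t : 'S_(k + l)) :=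
  [forall i : 'I_(k + l), (i < k)%N == (t i < k)%N].

(** The left side is the determinant of X with its off-diagonal blocks erased: in the Leibniz
    formula exactly the permutations preserving the two blocks survive. *)
Lemma det_diag_blocks k l (X : 'M[R]_(k + l)) :
  \det (ulsubmx X) * \det (drsubmx X) =
  \sum_(t | same_block t) (-1) ^+ t * \prod_i X i (t i).
Proof.
rewrite -(det_ublock _ 0) /determinant [RHS]big_mkcond/=; apply: eq_bigr => t _.
pose Y := \matrix_(i, j) (X i j * ((i < k)%N == (j < k)%N :> bool)%:R).
have -> : block_mx (ulsubmx X) 0 0 (drsubmx X) = Y.
  rewrite -[Y]submxK; congr block_mx; apply/matrixP => i j; rewrite !mxE /=.
  - by rewrite !ltn_ord eqxx mulr1.
  - by rewrite ltn_ord ltnNge leq_addr mulr0.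
  - by rewrite ltn_ord ltnNge leq_addr mulr0.
  - by rewrite !ltnNge !leq_addr mulr1.
rewrite (eq_bigr (fun i => X i (t i) * ((i < k)%N == (t i < k)%N)%:R)); last first.
  by move=> i _; rewrite mxE.
rewrite big_split/=; case: ifPn => [/forallP tb|/forallPn[i /negbTE ti]].
  by rewrite [X in _ * (_ * X) = _]big1 ?mulr1// => i _; rewrite tb.
by rewrite [X in _ * (_ * X) = _](bigD1 i)//= ti mul0r !mulr0.
Qed.

(** For each block-preserving t, summing over s gives the Leibniz formula in the permutation s^-1 t,
    hence the determinant of C. *)
Lemma wedge_det k l (C : 'M[R]_(k + l)) :
  \sum_(s : 'S_(k + l)) (-1) ^+ s *
    (\det (ulsubmx (row_perm s C)) * \det (drsubmx (row_perm s C))) =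
  #|@same_block k l|%:R * \det C.
Proof.
under eq_bigr do rewrite det_diag_blocks mulr_sumr.
rewrite exchange_big/= (eq_bigr (fun=> \det C)); last first.
  move=> t _; rewrite [RHS](reindex_inj (h := fun s => s^-1%g * t)%g)/=; last first.
    by move=> s u /mulIg /invg_inj.
  apply: eq_bigr => s _; rewrite mulrA -signr_addb -[s (+) t]/(s (+) t).
  rewrite odd_permM odd_permV; congr (_ * _).
  rewrite [RHS](reindex_inj (@perm_inj _ s))/=; apply: eq_bigr => i _.
  by rewrite mxE permM permK.
by rewrite sumr_const mulr_natl.
Qed.

Section Pointwise.
Context {m : nat}.

Definition wedgef k l (f : 'M[R]_(k, m) -> R) (g : 'M[R]_(l, m) -> R)
    (A : 'M[R]_(k + l, m)) : R :=
  (k`! * l`!)%:R^-1 * \sum_(s : 'S_(k + l))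
    (-1) ^+ s * (f (usubmx (row_perm s A)) * g (dsubmx (row_perm s A))).

(* The columns of a matrix B stand for covectors: A |-> \det (A *m B) is their
   exterior product. *)
Definition detsum k (s : seq 'M[R]_(m, k)) (A : 'M[R]_(k, m)) : R :=
  \sum_(B <- s) \det (A *m B).

(** Equal to 1, since the block-preserving permutations form S_k x S_l; it is carried along
    unevaluated as a common factor. *)
Definition wedge_cst k l : R := #|@same_block k l|%:R / (k`! * l`!)%:R.

Lemma wedgef_detsum k l (s1 : seq 'M[R]_(m, k)) (s2 : seq 'M[R]_(m, l)) A :
  wedgef (detsum s1) (detsum s2) A =
  wedge_cst k l * detsum [seq row_mx B1 B2 | B1 <- s1, B2 <- s2] A.
Proof.
rewrite /wedgef /wedge_cst [_ / _ in RHS]mulrC -mulrA; congr (_ * _).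
rewrite /detsum big_allpairs_dep/= mulr_sumr.
under eq_bigr => s _ do rewrite mulr_suml mulr_sumr.
rewrite exchange_big/=; apply: eq_bigr => B1 _; rewrite mulr_sumr.
under eq_bigr => s _ do rewrite !mulr_sumr.
rewrite exchange_big/=; apply: eq_bigr => B2 _; rewrite -wedge_det.
apply: eq_bigr => s _; congr (_ * (_ * _)); congr (\det _).
  by apply/matrixP => i j; rewrite !mxE; apply: eq_bigr => c _; rewrite row_mxEl !mxE.
by apply/matrixP => i j; rewrite !mxE; apply: eq_bigr => c _; rewrite row_mxEr !mxE.
Qed.

Lemma wedgefZ k l c d (f : 'M[R]_(k, m) -> R) (g : 'M[R]_(l, m) -> R) A :
  wedgef (fun B => c * f B) (fun B => d * g B) A = c * d * wedgef f g A.
Proof.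
rewrite /wedgef mulrCA; congr (_ * _); rewrite mulr_sumr; apply: eq_bigr => s _.
by rewrite [RHS]mulrCA; congr (_ * _); rewrite mulrACA.
Qed.

Lemma eq_wedgef k l (f f' : 'M[R]_(k, m) -> R) (g g' : 'M[R]_(l, m) -> R) A :
  f =1 f' -> g =1 g' -> wedgef f g A = wedgef f' g' A.
Proof. by move=> /funext -> /funext ->. Qed.

Lemma wedgef_mulmx k l (f : 'M[R]_(k, m) -> R) (g : 'M[R]_(l, m) -> R) A (T : 'M[R]_m) :
  wedgef f g (A *m T) = wedgef (fun B => f (B *m T)) (fun B => g (B *m T)) A.
Proof.
rewrite /wedgef; congr (_ * _); apply: eq_bigr => s _.
have -> : row_perm s (A *m T) = row_perm s A *m T.
  by apply/matrixP => i j; rewrite !mxE; apply: eq_bigr => c _; rewrite !mxE.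
by rewrite -mul_usub_mx -mul_dsub_mx.
Qed.

(** The vector v may be any of the arguments, not just the first: in this form the property passes
    to exterior products without the sign rule of a contraction. *)
Definition kills k (v : 'rV[R]_m) (f : 'M[R]_(k, m) -> R) :=
  forall A i, row i A = v -> f A = 0.

Lemma wedgef_kills k l v (f : 'M[R]_(k, m) -> R) (g : 'M[R]_(l, m) -> R) :
  kills v f -> kills v g -> kills v (wedgef f g).
Proof.
move=> fv gv A i Ai; rewrite /wedgef big1 ?mulr0// => s _.
case: (split_ordP (s^-1%g i)) => j ij.
  rewrite (fv _ j) ?mul0r ?mulr0// -Ai -[i in RHS](permKV s) ij.
  by apply/rowP => c; rewrite !mxE.
rewrite (gv _ j) ?mulr0// -Ai -[i in RHS](permKV s) ij.
by apply/rowP => c; rewrite !mxE.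
Qed.

End Pointwise.
End WedgeOfDeterminants.

Section TopForms.
Context {R : realType} {m : nat}.

Lemma top_form_kills (f : 'M[R]_m -> R) (v : 'rV[R]_m) :
  (forall A, f A = \det A * f 1%:M) -> v != 0 -> kills v f -> forall A, f A = 0.
Proof.
move=> fdet v0 vf A; have [j vj] : exists j, v 0 j != 0.
  apply: contrapT => /forallNP h; case/negP: v0; apply/eqP/rowP => j.
  by rewrite mxE; apply/eqP/negPn/negP => /h.
(* The identity with row j replaced by v has determinant v_j, which is non-zero; as f vanishes on
   it, f vanishes on the identity. *)
pose A' : 'M[R]_m := \matrix_(i, l) if i == j then v 0 l else (i == l)%:R.
have rA : row j A' = v by apply/rowP => l; rewrite !mxE eqxx.
have adj1 : \adj (1%:M : 'M[R]_m) = 1%:M.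
  by have := mul_mx_adj (1%:M : 'M[R]_m); rewrite mul1mx det1.
have dA : \det A' != 0.
  have cofE l : cofactor A' j l = (j == l)%:R.
    transitivity (\adj (1%:M : 'M[R]_m) l j); last by rewrite adj1 mxE eq_sym.
    rewrite mxE /cofactor; congr (_ * \det _); apply/matrixP => a b.
    by rewrite !mxE eq_sym (negbTE (neq_lift _ _)).
  rewrite (expand_det_row _ j) (bigD1 j)//= big1 ?addr0 => [|l lj].
    by rewrite cofE eqxx mulr1 mxE eqxx.
  by rewrite cofE eq_sym (negbTE lj) mulr0.
have := vf A' j rA; rewrite fdet => /eqP; rewrite mulf_eq0 (negbTE dA)/= => /eqP f1.
by rewrite fdet f1 mulr0.
Qed.

End TopForms.

Section VectorValued.
Context {R : realType} {m p : nat}.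

Lemma Cr_coord r (U : set 'rV[R]_m) (F : 'rV[R]_m -> 'rV[R]_p) b : open U ->
  Cr_on r U F -> Cr_on r U (fun x => F x 0 b).
Proof.
move=> oU; elim: r F => [|r IH] F [Fc Fr].
  by split=> // x xU; apply: continuous_entry; exact: Fc.
split=> [x xU|i]; first by apply: continuous_entry; exact: Fc.
have [Fd Fi] := Fr i; split=> [x Ux|].
  by have /derivable_mxP := Fd x Ux; apply.
apply: Cr_ext (IH _ Fi) => // x Ux.
by rewrite derive_mx ?mxE//; exact: Fd.
Qed.

Lemma smooth_coord (U : set 'rV[R]_m) (F : 'rV[R]_m -> 'rV[R]_p) b : open U ->
  smooth_on U F -> smooth_on U (fun x => F x 0 b).
Proof. by move=> oU FU r; exact: Cr_coord. Qed.

Lemma differentiable_row (F : 'rV[R]_m -> 'rV[R]_p) x :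
  (forall b, differentiable (fun y => F y 0 b) x) -> differentiable F x.
Proof.
move=> Fd; have -> : F = \sum_b (fun y => F y 0 b *: delta_mx 0 b).
  by apply/funext => y; rewrite fct_sumE -row_sum_delta.
by apply: differentiable_sum => b; exact: differentiableZl.
Qed.

End VectorValued.

(** * Coordinate changes *)

Section Transitions.
Context {R : realType} {m : nat} {M : oriented_manifold R m}.
Implicit Types (i j k c : chart_index M) (x : 'rV[R]_m) (p : M).

Definition overlap i j := [set x | chart_cod i x /\ chart_dom j (chart_inv i x)].

Definition trans i j x : 'rV[R]_m := chart j (chart_inv i x).

Lemma open_preimage_in (S T : topologicalType) (U : set S) (V : set T) (f : S -> T) :
  open U -> open V -> {in U, continuous f} -> open [set x | U x /\ V (f x)].
Proof.
move=> oU oV fc; rewrite openE => x [Ux Vfx]; rewrite /interior.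
have h1 : \forall y \near x, U y by apply: open_nbhs_nbhs.
have h2 : \forall y \near x, V (f y).
  by apply: (fc x); [rewrite inE|apply: open_nbhs_nbhs].
by apply: filterS2 h1 h2.
Qed.

Lemma overlap_open i j : open (overlap i j).
Proof.
by apply: open_preimage_in;
  [exact: chart_cod_open|exact: chart_dom_open|exact: chart_inv_cont].
Qed.

Lemma trans_smooth i j b : smooth_on (overlap i j) (fun x => trans i j x 0 b).
Proof.
by apply: (@smooth_coord _ _ _ _ (chart j \o chart_inv i)); [exact: overlap_open|exact: transition_smooth].
Qed.

Lemma trans_C1 i j b : C1_on (overlap i j) (fun x => trans i j x 0 b).
Proof. by apply: smooth_C1; [exact: overlap_open|exact: trans_smooth]. Qed.

Lemma trans_differentiable i j x : overlap i j x -> differentiable (trans i j) x.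
Proof. by move=> ij; apply: differentiable_row => b; exact: (trans_C1 b ij).1. Qed.

Lemma chart_inv_trans i j x : overlap i j x -> chart_inv j (trans i j x) = chart_inv i x.
Proof. by move=> [_ jx]; rewrite /trans chartK. Qed.

Lemma trans_overlap i j x : overlap i j x -> overlap j i (trans i j x).
Proof.
move=> ij; have [ix jx] := ij; split; first exact: chart_mem.
by rewrite chart_inv_trans//; exact: chart_inv_mem.
Qed.

Lemma transK i j x : overlap i j x -> trans j i (trans i j x) = x.
Proof.
by move=> ij; rewrite {1}/trans chart_inv_trans//; have [ix _] := ij; rewrite chart_invK.
Qed.

Lemma overlap_refl i x : chart_cod i x -> overlap i i x.
Proof. by move=> ix; split=> //; exact: chart_inv_mem. Qed.

Lemma mul_transition i j x (v : 'rV[R]_m) : overlap i j x ->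
  v *m transition_mx i j x = 'D_v (trans i j) x.
Proof. by move=> ij; rewrite deriveEjacobian//; exact: trans_differentiable. Qed.

#[local] Opaque transition_mx.

Lemma mul_transition_coord i j x (v : 'rV[R]_m) b : overlap i j x ->
  (v *m transition_mx i j x) 0 b = 'D_v (fun y => trans i j y 0 b) x.
Proof.
move=> ij; rewrite mul_transition// derive_mx ?mxE//.
exact: diff_derivable (trans_differentiable ij).
Qed.

Lemma transition_mxE i j x a b : overlap i j x ->
  transition_mx i j x a b = 'D_(delta_mx 0 a) (fun y => trans i j y 0 b) x.
Proof. by move=> ij; rewrite -mul_transition_coord// -rowE [RHS]mxE. Qed.

(** The chain rule; acting on row vectors, the matrices multiply in the order in which the charts
    are visited. *)
Lemma transition_mx_comp i j k x : overlap i j x -> overlap i k x ->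
  transition_mx i k x = transition_mx i j x *m transition_mx j k (trans i j x).
Proof.
move=> ij ik; apply/row_matrixP => a; rewrite !rowE mulmxA.
have jk : overlap j k (trans i j x).
  by split; [exact: chart_mem ij.2|rewrite chart_inv_trans//; exact: ik.2].
have dij := trans_differentiable ij; have djk := trans_differentiable jk.
apply: (etrans (mul_transition _ ik)); apply: esym.
apply: (etrans (congr1 (mulmx^~ _) (mul_transition _ ij))).
apply: (etrans (mul_transition _ jk)).
have E : \forall y \near x, (trans j k \o trans i j) y = trans i k y.
  by apply: (open_near (@overlap_open i j)) => // y ijy; rewrite /= /trans chartK//; exact: ijy.2.
apply: etrans (near_eq_derive _ E).
apply: (etrans (deriveE _ djk)); apply: esym.
apply: (etrans (deriveE _ (differentiable_comp dij djk))).
apply: (etrans (congr1 (@^~ (delta_mx 0 a)) (diff_comp dij djk))).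
exact: (congr1 ('d (trans j k) (trans i j x)) (esym (deriveE _ dij))).
Qed.

Lemma transition_mx_id i x : chart_cod i x -> transition_mx i i x = 1%:M.
Proof.
move=> ix; have ii := overlap_refl ix; apply/row_matrixP => a.
rewrite rowE mul_transition// row1.
have E : \forall y \near x, id y = trans i i y.
  by apply: (open_near (@overlap_open i i)) => // y [iy _]; rewrite /trans chart_invK.
by rewrite -(near_eq_derive _ E) derive_id.
Qed.

Lemma local_form_trans (l : nat) (a : diff_form M l) i j x A : overlap i j x ->
  local_form i a x A = local_form j a (trans i j x) (A *m transition_mx i j x).
Proof.
move=> ij; have ic : overlap i (chart_at (chart_inv i x)) x.
  by split; [exact: ij.1|exact: chart_at_mem].
rewrite /local_form /= (chart_inv_trans ij) -mulmxA.
exact: (congr1 (fun B => a _ (A *m B)) (transition_mx_comp ij ic)).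
Qed.

Lemma local_form_chart_at (l : nat) (a : diff_form M l) p :
  local_form (chart_at p) a (chart (chart_at p) p) = a p.
Proof.
apply/funext => A; have cp := chart_at_mem p.
by rewrite /local_form chartK// transition_mx_id ?mulmx1//; exact: chart_mem.
Qed.

Lemma transition_det_gt0 i j x : overlap i j x -> 0 < \det (transition_mx i j x).
Proof. by move=> [ix jx]; exact: transition_oriented. Qed.

End Transitions.

Section Composition.
Context {R : realType} {m p : nat}.

Lemma derive_comp_row (F : 'rV[R]_m -> 'rV[R]_p) (f : 'rV[R]_p -> R) x (v : 'rV[R]_m) :
  differentiable F x -> differentiable f (F x) ->
  'D_v (fun y => f (F y)) x = 'D_('D_v F x) f (F x).
Proof.
move=> dF df; apply: (etrans (deriveE _ (differentiable_comp dF df))).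
apply: (etrans (congr1 (@^~ v) (diff_comp dF df))).
apply: esym; apply: (etrans (deriveE _ df)).
exact: (congr1 ('d f (F x)) (deriveE _ dF)).
Qed.

Lemma C1_comp (U : set 'rV[R]_m) (V : set 'rV[R]_p) (F : 'rV[R]_m -> 'rV[R]_p)
    (f : 'rV[R]_p -> R) : open U -> open V -> (forall x, U x -> V (F x)) ->
  (forall b, C1_on U (fun x => F x 0 b)) -> C1_on V f -> C1_on U (fun x => f (F x)).
Proof.
move=> oU oV UV F1 f1.
have dF x : U x -> differentiable F x.
  by move=> Ux; apply: differentiable_row => b; exact: (F1 b x Ux).1.
have df x : U x -> differentiable f (F x) by move=> /UV /f1[].
have Fc x : U x -> {for x, continuous F}.
  by move=> Ux; exact: differentiable_continuous (dF x Ux).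
move=> x Ux; split=> [|v]; first exact: differentiable_comp (dF x Ux) (df x Ux).
apply: (@continuous_near _ _ _ (fun y => \sum_b 'D_v (fun z => F z 0 b) y *
    'D_(delta_mx 0 b) f (F y))).
  apply: (open_near oU) => // y Uy; apply: esym.
  apply: (etrans (derive_comp_row _ (dF y Uy) (df y Uy))).
  apply: (etrans (derive_partials _ (df y Uy))); apply: eq_bigr => b _.
  congr (_ * _); rewrite derive_mx ?mxE//; exact: diff_derivable (dF y Uy).
apply: (@cvg_sumr _ _ (nbhs x)) => b; apply: cvgM; first exact: (F1 b x Ux).2.
exact: (@continuous_comp _ _ _ F (fun y => 'D_(delta_mx 0 b) f y) x (Fc x Ux)
  ((f1 _ (UV x Ux)).2 _)).
Qed.

End Composition.

(** * Exterior derivative of 1-forms *)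

Section OneForms.
Context {R : realType} {m : nat} {M : oriented_manifold R m}.
Implicit Types (i j : chart_index M) (x : 'rV[R]_m) (p : M) (a : diff_form M 1).

Lemma multilinear1P (f : 'M[R]_(1, m) -> R) : multilinear f ->
  forall s u v, f (s *: u + v) = s * f u + f v.
Proof.
move=> fl s u v; rewrite -[X in _ = _ + X]mul1r; apply: (fl _ _ _ 0).
- by apply/rowP => l; rewrite !mxE mul1r.
- by apply/matrixP => -[].
- by apply/matrixP => -[].
Qed.

Lemma multilinear1_sum (f : 'M[R]_(1, m) -> R) : multilinear f ->
  forall v, f v = \sum_b v 0 b * f (delta_mx 0 b).
Proof.
move=> /multilinear1P fl v; rewrite {1}[v]row_sum_delta.
have f0 : f 0 = 0.
  by have := fl (-1) 0 0; rewrite scaler0 addr0 => h; lra.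
elim/big_rec2: _ => // b y1 y2 _ <-; exact: fl.
Qed.

Definition C1_form a := (forall p, multilinear (a p)) /\
  forall i A, C1_on (chart_cod i) (fun x => local_form i a x A).

Lemma smooth_C1_form a : smooth_form a -> C1_form a.
Proof.
move=> [al sa]; split=> [p|i A]; first exact: (al p).1.
by apply: smooth_C1; [exact: chart_cod_open|exact: sa].
Qed.

Definition coef i a (b : 'I_m) x := local_form i a x (delta_mx 0 b).

Lemma coef_C1 a i b : C1_form a -> C1_on (chart_cod i) (coef i a b).
Proof. by move=> [_]; apply. Qed.

Lemma local_form_coef a i x w : (forall p, multilinear (a p)) ->
  local_form i a x w = \sum_b w 0 b * coef i a b x.
Proof.
move=> al; rewrite /coef; apply: multilinear1_sum.
rewrite /local_form => A B C l s t E _ _.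
apply: (al _ _ _ _ l); [|by apply/matrixP => -[]; rewrite ord1; case|by apply/matrixP => -[]; rewrite ord1; case].
by move: E; rewrite !row_mul => ->; rewrite mulmxDl -!scalemxAl.
Qed.

(** The expression of d a in a fixed chart, whereas [ext_d] uses the preferred chart of each point,
    which may jump from one point to the next. *)
Definition dloc i a x (v w : 'rV[R]_m) : R :=
  'D_v (fun y => local_form i a y w) x - 'D_w (fun y => local_form i a y v) x.

Lemma derive_local_form a i x v w : C1_form a -> chart_cod i x ->
  'D_v (fun y => local_form i a y w) x = \sum_b w 0 b * 'D_v (coef i a b) x.
Proof.
move=> aC ix; have oi := @chart_cod_open _ _ M i.
have -> : (fun y => local_form i a y w) = (fun y => \sum_b w 0 b * coef i a b y).
  by apply/funext => y; exact: (local_form_coef _ _ _ aC.1).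
rewrite (derive_sumC1 _ _ _ oi ix) => [|b]; last by apply: C1_Z => //; exact: coef_C1.
apply: eq_bigr => b _; rewrite (derive_MC1 _ (@C1_cst _ _ _ _) (@coef_C1 a i b aC) ix).
have -> : 'D_v (fun _ : 'rV[R]_m => w 0 b) x = 0 by exact: derive_cst.
by rewrite mulr0 addr0.
Qed.

Lemma dlocE a i x v w : C1_form a -> chart_cod i x ->
  dloc i a x v w = \sum_b (w 0 b * 'D_v (coef i a b) x - v 0 b * 'D_w (coef i a b) x).
Proof. by move=> aC ix; rewrite /dloc !derive_local_form// -sumrB. Qed.

Lemma row'0_2 (A : 'M[R]_(2, m)) : row' ord0 A = row ord_max A.
Proof. by apply/matrixP => r l; rewrite !mxE ord1; congr (A _ _); apply: val_inj. Qed.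

Lemma row'1_2 (A : 'M[R]_(2, m)) : row' ord_max A = row ord0 A.
Proof. by apply/matrixP => r l; rewrite !mxE ord1; congr (A _ _); apply: val_inj. Qed.

Lemma ext_d1E a p (A : 'M[R]_(2, m)) : ext_d a p A =
  dloc (chart_at p) a (chart (chart_at p) p) (row ord0 A) (row ord_max A).
Proof.
rewrite /ext_d big_ord_recl big_ord1 expr0 mul1r expr1 mulN1r.
have -> : lift ord0 ord0 = ord_max :> 'I_2 by apply: val_inj.
by rewrite row'0_2 row'1_2.
Qed.

(** Naturality of d: the second derivatives of the coordinate change produced by the product rule
    are symmetric by Schwarz and drop out of the antisymmetrisation. *)
Lemma dloc_trans a i j x v w : C1_form a -> overlap i j x ->
  dloc i a x v w =
  dloc j a (trans i j x) (v *m transition_mx i j x) (w *m transition_mx i j x).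
Proof.
move=> aC ij; have oij := @overlap_open _ _ _ i j.
have jx : chart_cod j (trans i j x) := chart_mem ij.2.
pose phi (c : 'I_m) y := trans i j y 0 c.
have phiD c u : C1_on (overlap i j) (fun y => 'D_u (phi c) y).
  by apply: smooth_dir_C1 => //; exact: trans_smooth.
have coC c : C1_on (overlap i j) (fun y => coef j a c (trans i j y)).
  apply: (C1_comp oij (@chart_cod_open _ _ M j)) => [y yij|b|].
  - exact: chart_mem yij.2.
  - exact: trans_C1.
  - exact: coef_C1.
have D u z : 'D_u (fun y => local_form i a y z) x =
    \sum_c ('D_z (phi c) x * 'D_u (fun y => coef j a c (trans i j y)) x +
      coef j a c (trans i j x) * 'D_u (fun y => 'D_z (phi c) y) x).
  have E : \forall y \near x, local_form i a y z =
      \sum_c 'D_z (phi c) y * coef j a c (trans i j y).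
    apply: (open_near oij) => // y yij.
    apply: (etrans (local_form_trans _ _ yij)).
    apply: (etrans (local_form_coef _ _ _ aC.1)); apply: eq_bigr => c _.
    by congr (_ * _); exact: mul_transition_coord.
  apply: (etrans (near_eq_derive _ E)).
  apply: (etrans (derive_sumC1 _ _ _ oij ij _)) => [c|]; first exact: C1_M.
  by apply: eq_bigr => c _; exact: derive_MC1.
have Dco u c : 'D_u (fun y => coef j a c (trans i j y)) x =
    'D_(u *m transition_mx i j x) (coef j a c) (trans i j x).
  apply: (etrans (derive_comp_row _ (trans_differentiable ij) _)).
    exact: (@coef_C1 a j c aC _ jx).1.
  by congr ('D__ _ _); apply: esym; exact: mul_transition.
have S c : 'D_v (fun y => 'D_w (phi c) y) x = 'D_w (fun y => 'D_v (phi c) y) x.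
  by apply: smooth_derive_comm oij _ ij; exact: trans_smooth.
have key (p q r s t u u' : R) : u = u' ->
    p * q - r * s = p * q + t * u - (r * s + t * u').
  by move=> ->; ring.
apply: (etrans (congr2 (fun s t : R => s - t) (D v w) (D w v))); apply: esym.
apply: (etrans (dlocE _ _ aC jx)); rewrite -sumrB; apply: eq_bigr => c _.
apply: (etrans (congr2 (fun s t : R => s - t)
  (congr2 *%R (mul_transition_coord w c ij) (esym (Dco v c)))
  (congr2 *%R (mul_transition_coord v c ij) (esym (Dco w c))))).
exact: key.
Qed.

(** Naturality allows one chart to be used for all points of its domain; this is what makes it
    possible to differentiate d a again and to expand it over a whole chart. *)
Lemma local_ext_d a i x (A : 'M[R]_(2, m)) : C1_form a -> chart_cod i x ->
  local_form i (ext_d a) x A = dloc i a x (row ord0 A) (row ord_max A).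
Proof.
move=> aC ix; have ic : overlap i (chart_at (chart_inv i x)) x.
  by split=> //; exact: chart_at_mem.
rewrite /local_form ext_d1E !row_mul; apply: esym; exact: dloc_trans.
Qed.

End OneForms.

Section ExteriorDerivative.
Context {R : realType} {m : nat} {M : oriented_manifold R m}.
Implicit Types (i j : chart_index M) (x : 'rV[R]_m) (p : M) (a b : diff_form M 1).

Lemma dloc_antisym i a x (v w : 'rV[R]_m) : dloc i a x v w = - dloc i a x w v.
Proof. by rewrite /dloc opprB. Qed.

Lemma dloc_self i a x (v : 'rV[R]_m) : dloc i a x v v = 0.
Proof. by rewrite /dloc subrr. Qed.

Lemma dloc_linear i a x (s t : R) (u v w : 'rV[R]_m) : C1_form a -> chart_cod i x ->
  dloc i a x (s *: u + t *: v) w = s * dloc i a x u w + t * dloc i a x v w.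
Proof.
move=> aC ix; rewrite !dlocE// !mulr_sumr -big_split/=; apply: eq_bigr => b _.
have D : 'D_(s *: u + t *: v) (coef i a b) x =
    s * 'D_u (coef i a b) x + t * 'D_v (coef i a b) x.
  have df := (@coef_C1 _ _ _ a i b aC x ix).1.
  apply: (etrans (deriveE _ df)); rewrite linearD !linearZ.
  by congr (s * _ + t * _); apply: esym; exact: deriveE.
apply: (etrans (congr1 (fun d => w 0 b * d - _) D)).
rewrite !mxE; move: ('D_u _ _) ('D_v _ _) ('D_w _ _) => d1 d2 d3; ring.
Qed.

Lemma ext_d_multilinear a p : C1_form a -> multilinear (ext_d a p).
Proof.
move=> aC A B C l s t E EB EC; rewrite !ext_d1E.
have cx : chart_cod (chart_at p) (chart (chart_at p) p) by apply/chart_mem/chart_at_mem.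
have : (l == ord0) || (l == ord_max) by case: l {E EB EC} => -[|[|]].
move=> /orP[/eqP l0|/eqP l1].
  rewrite l0 in E EB EC; rewrite E -!row'0_2 EB EC !row'0_2; exact: dloc_linear.
rewrite l1 in E EB EC; rewrite E -!row'1_2 EB EC !row'1_2.
rewrite dloc_antisym dloc_linear// opprD -!mulrN.
by congr (_ * _ + _ * _); rewrite [RHS]dloc_antisym.
Qed.

Lemma ext_d_alternating a p : Defs.alternating (ext_d a p).
Proof.
move=> A k l kl E; rewrite !ext_d1E.
suff -> : row ord0 A = row ord_max A by exact: dloc_self.
case: k l kl E => -[|[|//]] hk [[|[|//]] hl] //= _ E.
- have -> : ord0 = Ordinal hk by apply: val_inj.
  by have -> : ord_max = Ordinal hl by apply: val_inj.
- have -> : ord0 = Ordinal hl by apply: val_inj.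
  by have -> : ord_max = Ordinal hk by apply: val_inj.
Qed.

Lemma smooth_dir (U : set 'rV[R]_m) f (v : 'rV[R]_m) : open U -> smooth_on U f ->
  smooth_on U (fun x => 'D_v f x : R).
Proof.
move=> oU fU.
apply: (@smooth_ext _ _ _ (fun y => \sum_i v 0 i * 'D_(delta_mx 0 i) f y)) => // [x Ux|].
  by apply: esym; apply: derive_partials; exact: (smooth_C1 oU fU Ux).1.
by apply: smooth_sum => // i; exact: smooth_partial.
Qed.

Lemma smooth_dloc a i (v w : 'rV[R]_m) : smooth_form a ->
  smooth_on (chart_cod i) (fun x => dloc i a x v w).
Proof.
move=> [_ sa]; have oi := @chart_cod_open _ _ M i.
apply: (@smooth_ext _ _ _ (fun x => -1 * 'D_w (fun y => local_form i a y v) x +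
  'D_v (fun y => local_form i a y w) x)) => // [x _|].
  by rewrite mulN1r addrC.
by apply: smooth_lin => //; apply: smooth_dir => //; exact: sa.
Qed.

Lemma smooth_ext_d a : smooth_form a -> smooth_form (ext_d a).
Proof.
move=> sa; have aC := smooth_C1_form sa; split=> [p|i A].
  by split; [exact: ext_d_multilinear|exact: ext_d_alternating].
have oi := @chart_cod_open _ _ M i.
apply: (@smooth_ext _ _ _ (fun x => dloc i a x (row ord0 A) (row ord_max A))) => //.
  by move=> x ix; apply: esym; exact: local_ext_d.
exact: smooth_dloc.
Qed.

Lemma sum_ord3 (F : 'I_3 -> R) : \sum_i F i = F ord0 + F (inord 1) + F ord_max.
Proof.
rewrite !big_ord_recl big_ord0 addr0 addrA; congr (_ + F _ + F _); apply: val_inj => //=.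
by rewrite inordK.
Qed.

(** The six iterated derivatives ['D_u ('D_v (l w))] cancel in pairs by Schwarz. *)
Lemma ext_d_ext_d a : smooth_form a -> ext_d (ext_d a) = 0.
Proof.
move=> sa; have aC := smooth_C1_form sa; apply/funext => p; apply/funext => A.
set c := chart_at p; have cx : chart_cod c (chart c p) by apply/chart_mem/chart_at_mem.
have oc := @chart_cod_open _ _ M c; set x := chart c p in cx *.
pose l (v : 'rV[R]_m) y := local_form c a y v.
have ls v : smooth_on (chart_cod c) (l v) by exact: sa.2.
have D u (B : 'M[R]_(2, m)) : 'D_u (fun y => local_form c (ext_d a) y B) x =
    'D_u (fun y => 'D_(row ord0 B) (l (row ord_max B)) y) x -
    'D_u (fun y => 'D_(row ord_max B) (l (row ord0 B)) y) x.
  have E : \forall y \near x, local_form c (ext_d a) y B =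
      'D_(row ord0 B) (l (row ord_max B)) y - 'D_(row ord_max B) (l (row ord0 B)) y.
    by apply: (open_near oc) => // y cy; exact: local_ext_d.
  apply: (etrans (near_eq_derive _ E)); apply: deriveB.
    by apply: C1_derivable cx; exact: smooth_dir_C1.
  by apply: C1_derivable cx; exact: smooth_dir_C1.
pose v0 := row ord0 A; pose v1 := row (inord 1) A; pose v2 := row ord_max A.
have S u v w : 'D_u (fun y => 'D_v (l w) y) x = 'D_v (fun y => 'D_u (l w) y) x.
  by apply: smooth_derive_comm cx => //; exact: ls.
have Dr u (B : 'M[R]_(2, m)) v w : row ord0 B = v -> row ord_max B = w ->
    'D_u (fun y => local_form c (ext_d a) y B) x =
    'D_u (fun y => 'D_v (l w) y) x - 'D_u (fun y => 'D_w (l v) y) x.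
  by move=> <- <-; exact: D.
have r (k : 'I_3) (q : 'I_2) (k' : 'I_3) : lift k q = k' -> row q (row' k A) = row k' A.
  by move=> <-; apply/rowP => z; rewrite !mxE.
have t0 := Dr v0 (row' ord0 A) v1 v2.
have t1 := Dr v1 (row' (inord 1) A) v0 v2.
have t2 := Dr v2 (row' ord_max A) v0 v1.
have key (A1 A2 A3 A4 A5 A6 B0 B1 B2 : R) : B0 = A1 - A2 -> B1 = A3 - A4 -> B2 = A5 - A6 ->
   A1 = A3 -> A2 = A5 -> A4 = A6 ->
   (-1) ^+ (ord0 : 'I_3) * B0 + (-1) ^+ (inord 1 : 'I_3) * B1 +
   (-1) ^+ (ord_max : 'I_3) * B2 = 0.
  by move=> -> -> -> -> -> ->; rewrite inordK//= expr0 expr1 sqrrN expr1n; ring.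
apply: (etrans (sum_ord3 _)).
apply: (key _ _ _ _ _ _ _ _ _ (t0 _ _) (t1 _ _) (t2 _ _)).
- by apply: r; apply: val_inj; rewrite /= inordK.
- by apply: r; apply: val_inj.
- by apply: r; apply: val_inj; rewrite /= inordK.
- by apply: r; apply: val_inj; rewrite /= inordK.
- by apply: r; apply: val_inj.
- by apply: r; apply: val_inj; rewrite /= inordK.
- exact: S.
- exact: S.
- exact: S.
Qed.

Lemma C1_form_B a b : C1_form a -> C1_form b -> C1_form (a - b).
Proof.
move=> [al ac] [bl bc]; split=> [p|i A].
  move=> B C D l s t E1 E2 E3; rewrite !fctE (al p _ _ _ _ _ _ E1)// (bl p _ _ _ _ _ _ E1)//.
  ring.
have oi := @chart_cod_open _ _ M i.
exact: (C1_D oi (ac i A) (C1_N oi (bc i A))).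
Qed.

Lemma dloc_B a b i x (v w : 'rV[R]_m) : C1_form a -> C1_form b -> chart_cod i x ->
  dloc i (a - b) x v w = dloc i a x v w - dloc i b x v w.
Proof.
move=> aC bC ix.
have D u z : 'D_u (fun y => local_form i (a - b) y z) x =
    'D_u (fun y => local_form i a y z) x - 'D_u (fun y => local_form i b y z) x.
  apply: deriveB; first exact: C1_derivable (aC.2 i z) ix.
  exact: C1_derivable (bC.2 i z) ix.
apply: (etrans (congr2 (fun s t : R => s - t) (D v w) (D w v))).
by rewrite /dloc; move: ('D_v _ _) ('D_v _ _) ('D_w _ _) ('D_w _ _) => ? ? ? ?; ring.
Qed.

Lemma ext_d_0 : ext_d (0 : diff_form M 1) = 0.
Proof.
apply/funext => p; apply/funext => A; rewrite ext_d1E /dloc.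
have E (u v : 'rV[R]_m) : 'D_u (fun y => local_form (chart_at p) (0 : diff_form M 1) y v)
    (chart (chart_at p) p) = 0.
  exact: derive_cst.
by rewrite !E subrr.
Qed.

Lemma smooth_form_0 k : smooth_form (0 : diff_form M k).
Proof.
split=> [p|i A]; last exact: smooth_cst.
split=> [A B C l s t _ _ _|A k1 k2 _ _]; last by [].
by change (0 = s * 0 + t * 0 :> R); rewrite !mulr0 addr0.
Qed.

End ExteriorDerivative.

(** * Exterior powers of d a in coordinates *)

Section LocalFormulas.
Context {R : realType} {n : nat}.
Let m := n.+1.
Context {M : oriented_manifold R m}.
Implicit Types (i j : chart_index M) (x : 'rV[R]_m) (p : M) (a : diff_form M 1).

Lemma local_form_wedge k l (a : diff_form M k) (b : diff_form M l) i x A :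
  local_form i (wedge_prod a b) x A = wedgef (local_form i a x) (local_form i b x) A.
Proof. exact: wedgef_mulmx. Qed.

Definition coef_col i a x : 'M[R]_(m, 1) := \matrix_(r, k) coef i a r x.

Lemma local_form_detsum a i x A : (forall p, multilinear (a p)) ->
  local_form i a x A = detsum [:: coef_col i a x] A.
Proof.
move=> al; rewrite (local_form_coef _ _ _ al) /detsum big_seq1 det_mx11 mxE.
by apply: eq_bigr => b _; rewrite mxE.
Qed.

(** The covectors d(a_b) and dx_b as columns; their exterior products add up to d a over b. *)
Definition grad_col i a (b : 'I_m) x : 'M[R]_(m, 2) :=
  \matrix_(r, k) if k == ord0 then 'D_(delta_mx 0 r) (coef i a b) x else (r == b)%:R.

Lemma det2 (B : 'M[R]_2) : \det B =
  B ord0 ord0 * B ord_max ord_max - B ord0 ord_max * B ord_max ord0.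
Proof.
have e : lift ord0 ord0 = ord_max :> 'I_2 by apply: val_inj.
have e' : lift ord_max ord0 = ord0 :> 'I_2 by apply: val_inj.
rewrite (expand_det_row _ ord0) big_ord_recl big_ord1 /cofactor !det_mx11 !mxE /= e e'.
by rewrite expr0 mul1r expr1 mulN1r mulrN.
Qed.

Lemma local_ext_d_detsum a i x A : C1_form a -> chart_cod i x ->
  local_form i (ext_d a) x A = detsum [seq grad_col i a b x | b <- enum 'I_m] A.
Proof.
move=> aC ix; apply: (etrans (local_ext_d _ aC ix)); apply: (etrans (dlocE _ _ aC ix)).
rewrite /detsum big_map big_enum/=; apply: eq_bigr => b _; rewrite det2.
have D r : (A *m grad_col i a b x) r ord0 = 'D_(row r A) (coef i a b) x.
  apply: esym; apply: (etrans (derive_partials _ (@coef_C1 _ _ _ a i b aC x ix).1)).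
  by rewrite mxE; apply: eq_bigr => c _; rewrite !mxE.
have E r : (A *m grad_col i a b x) r ord_max = row r A 0 b.
  rewrite mxE (bigD1 b)//= !mxE eqxx mulr1 big1 ?addr0// => c cb.
  by rewrite mxE/= (negbTE cb) mulr0.
rewrite !D !E; move: ('D_ _ _ _) ('D_ _ _ _) => s t; ring.
Qed.

(** The columns of one term of the k-th power of d a, with t listing the index b chosen in each
    factor. The default of [head] is not reached for t in [exp_idx k], whose members have length
    k. *)
Fixpoint exp_col i a (k : nat) (t : seq 'I_m) x : 'M[R]_(m, k * 2) :=
  if k is k'.+1 then row_mx (grad_col i a (head ord0 t) x) (exp_col i a k' (behead t) x)
  else 0.

Fixpoint exp_idx (k : nat) : seq (seq 'I_m) :=
  if k is k'.+1 then [seq b :: t | b <- enum 'I_m, t <- exp_idx k'] else [:: [::]].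

Fixpoint exp_cst (k : nat) : R :=
  if k is k'.+1 then wedge_cst 2 (k' * 2) * exp_cst k' else 1.

Lemma wedgef_cst_detsum k l (f : 'M[R]_(k, m) -> R) (g : 'M[R]_(l, m) -> R) c d s1 s2 A :
  (forall B, f B = c * detsum s1 B) -> (forall B, g B = d * detsum s2 B) ->
  wedgef f g A = wedge_cst k l * (c * d) * detsum [seq row_mx B1 B2 | B1 <- s1, B2 <- s2] A.
Proof.
move=> fE gE; rewrite (eq_wedgef _ fE gE) wedgefZ wedgef_detsum; ring.
Qed.

Lemma local_wedge_exp a i x k A : C1_form a -> chart_cod i x ->
  local_form i (wedge_exp (ext_d a) k) x A =
  exp_cst k * detsum [seq exp_col i a k t x | t <- exp_idx k] A.
Proof.
move=> aC ix; elim: k A => [|k IH] A.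
  by rewrite /= mul1r /detsum big_seq1 /local_form /= det_mx00.
apply: (etrans (local_form_wedge _ _ _ _ _)).
rewrite (@wedgef_cst_detsum _ _ _ _ 1 (exp_cst k)
  [seq grad_col i a b x | b <- enum 'I_m] [seq exp_col i a k t x | t <- exp_idx k]); last first.
- exact: IH.
- by move=> B; rewrite mul1r; exact: local_ext_d_detsum.
rewrite mul1r /=; congr (_ * detsum _ _).
by rewrite map_allpairs allpairs_mapl allpairs_mapr.
Qed.

End LocalFormulas.

(** * Stokes *)

Section ClosedColumns.
Context {R : realType} {m : nat}.

Definition closed_cols (U : set 'rV[R]_m) k (B : 'rV[R]_m -> 'M[R]_(m, k)) :=
  forall c, (forall a, C1_on U (fun x => B x a c)) /\
  forall x a b, U x -> 'D_(delta_mx 0 a) (fun y => B y b c) x =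
    'D_(delta_mx 0 b) (fun y => B y a c) x.

Lemma closed_cols_row_mx (U : set 'rV[R]_m) k l (B : 'rV[R]_m -> 'M[R]_(m, k))
    (C : 'rV[R]_m -> 'M[R]_(m, l)) :
  closed_cols U B -> closed_cols U C -> closed_cols U (fun x => row_mx (B x) (C x)).
Proof.
move=> Bc Cc c; case: (split_ordP c) => j ->.
  have E a : (fun x => row_mx (B x) (C x) a (lshift l j)) = (fun x => B x a j).
    by apply/funext => x; rewrite row_mxEl.
  by have [h1 h2] := Bc j; split=> [a|x a b Ux]; rewrite !E//; exact: h2.
have E a : (fun x => row_mx (B x) (C x) a (rshift k j)) = (fun x => C x a j).
  by apply/funext => x; rewrite row_mxEr.
by have [h1 h2] := Cc j; split=> [a|x a b Ux]; rewrite !E//; exact: h2.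
Qed.

End ClosedColumns.

Section ClosedColumnsOfForms.
Context {R : realType} {n : nat}.
Let m := n.+1.
Context {M : oriented_manifold R m}.
Implicit Types (i j : chart_index M) (x : 'rV[R]_m) (p : M) (a : diff_form M 1).

Lemma closed_coef_col i a : C1_form a -> ext_d a = 0 ->
  closed_cols (chart_cod i) (coef_col i a).
Proof.
move=> aC da c.
have E r : (fun x => coef_col i a x r c) = coef i a r.
  by apply/funext => x; rewrite mxE.
split=> [r|x r s ix]; rewrite !E; first exact: coef_C1.
apply/eqP; rewrite -subr_eq0; apply/eqP.
pose A : 'M[R]_(2, m) := \matrix_(q, z) (if q == ord0 then r == z else s == z)%:R.
have r0 : row ord0 A = delta_mx 0 r.
  by apply/rowP => z; rewrite !mxE ?eqxx /= eq_sym.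
have r1 : row ord_max A = delta_mx 0 s.
  by apply/rowP => z; rewrite !mxE ?eqxx /= eq_sym.
have := local_ext_d A aC ix; rewrite da r0 r1 => h.
by apply: etrans (esym h) _.
Qed.

(** The first column is a gradient, closed by Schwarz; the second is constant. *)
Lemma closed_grad_col i a b : smooth_form a -> closed_cols (chart_cod i) (grad_col i a b).
Proof.
move=> sa c; have oi := @chart_cod_open _ _ M i.
have cs : smooth_on (chart_cod i) (coef i a b) by exact: sa.2.
have [->|c0] := eqVneq c ord0.
  have E r : (fun x => grad_col i a b x r ord0) = (fun x => 'D_(delta_mx 0 r) (coef i a b) x).
    by apply/funext => x; rewrite mxE.
  split=> [r|x r s ix]; rewrite !E; first exact: smooth_dir_C1.
  exact: smooth_derive_comm oi cs ix.
have E r : (fun x => grad_col i a b x r c) = (fun=> (r == b)%:R).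
  by apply/funext => x; rewrite mxE (negbTE c0).
split=> [r|x r s ix]; rewrite !E; first exact: C1_cst.
have D (u : 'rV[R]_m) (d : R) : 'D_u (fun=> d) x = 0 by exact: derive_cst.
by apply: (etrans (D _ _)); apply: esym; exact: D.
Qed.

Lemma closed_exp_col i a k t : smooth_form a -> closed_cols (chart_cod i) (exp_col i a k t).
Proof.
move=> sa; elim: k t => [|k IH] t; first by case.
by apply: closed_cols_row_mx; [exact: closed_grad_col|exact: IH].
Qed.

End ClosedColumnsOfForms.

(** * Stokes in one chart *)

Section LocalStokes.
Context {R : realType} {k : nat}.
Let m := (1 + (2 + k * 2))%N.
Context {M : oriented_manifold R m}.
Implicit Types (i j : chart_index M) (x : 'rV[R]_m) (p : M).
Context (mu lam a : diff_form M 1) (muC : C1_form mu) (dmu : ext_d mu = 0)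
  (slam : smooth_form lam) (aC : C1_form a).

(** With n = k + 1 this is mu /\ d a /\ (d lam)^(n-1). One factor is kept apart so that a can be lam
    itself or a localised, merely C^1, form rho_l lam. *)
Definition theta : diff_form M m :=
  wedge_prod mu (wedge_prod (ext_d a) (wedge_exp (ext_d lam) k)).

(* The columns are mu, d a and the factors of (d lam)^k: expanding d a and d lam
   as sums of d (coef b) /\ dx_b, theta is a sum over b and t. *)
Definition theta_col i (b : 'I_m) (t : seq 'I_m) x : 'M[R]_m :=
  row_mx (coef_col i mu x) (row_mx (grad_col i a b x) (exp_col i lam k t x)).

Definition theta_cst : R := wedge_cst 1 (2 + k * 2) * (wedge_cst 2 (k * 2) * exp_cst k).

Lemma local_theta i x A : chart_cod i x ->
  local_form i theta x A = theta_cst *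
    \sum_(b : 'I_m) \sum_(t <- exp_idx k) \det (A *m theta_col i b t x).
Proof.
move=> ix; apply: (etrans (local_form_wedge _ _ _ _ _)).
have lamC := smooth_C1_form slam.
have W B : local_form i (wedge_prod (ext_d a) (wedge_exp (ext_d lam) k)) x B =
    wedge_cst 2 (k * 2) * exp_cst k * detsum [seq row_mx B1 B2 |
      B1 <- [seq grad_col i a b x | b <- enum 'I_m],
      B2 <- [seq exp_col i lam k t x | t <- exp_idx k]] B.
  apply: (etrans (local_form_wedge _ _ _ _ _)).
  rewrite (@wedgef_cst_detsum _ _ _ _ _ _ 1 (exp_cst k)
    [seq grad_col i a b x | b <- enum 'I_m] [seq exp_col i lam k t x | t <- exp_idx k]).
  - by rewrite mul1r.
  - by move=> C; rewrite mul1r; exact: local_ext_d_detsum.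
  - by move=> C; exact: local_wedge_exp.
rewrite (@wedgef_cst_detsum _ _ _ _ _ _ 1 _ [:: coef_col i mu x] _ _ _ W); last first.
  by move=> C; rewrite mul1r; apply: local_form_detsum; exact: muC.1.
rewrite mul1r /theta_cst; congr (_ * _).
rewrite allpairs_mapl allpairs_mapr /detsum /= cats0 big_map big_allpairs_dep big_enum /=.
by [].
Qed.

(** The column of the gradient of a coefficient of a, the one column that is known only to be
    continuous. *)
Let k0 : 'I_m := rshift 1 (lshift (k * 2) ord0).

Lemma theta_col_closed i b t c : c != k0 ->
  (forall r, C1_on (chart_cod i) (fun x => theta_col i b t x r c)) /\
  forall x r s, chart_cod i x -> 'D_(delta_mx 0 r) (fun y => theta_col i b t y s c) x =
    'D_(delta_mx 0 s) (fun y => theta_col i b t y r c) x.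
Proof.
move=> ck0.
(* Outside k0 the columns do not depend on a, so a may be replaced by lam, which is smooth; then all
   columns are closed. *)
pose B' x : 'M[R]_m := row_mx (coef_col i mu x)
  (row_mx (grad_col i lam b x) (exp_col i lam k t x)).
have B'c : closed_cols (chart_cod i) B'.
  apply: closed_cols_row_mx; first exact: closed_coef_col.
  by apply: closed_cols_row_mx; [exact: closed_grad_col|exact: closed_exp_col].
have E r : (fun x => theta_col i b t x r c) = (fun x => B' x r c).
  apply/funext => x; rewrite /theta_col /B'; move: ck0.
  case: (split_ordP c) => c1 ->; first by rewrite !row_mxEl.
  rewrite !row_mxEr /k0 (inj_eq (@rshift_inj _ _)).
  case: (split_ordP c1) => c2 ->; last by rewrite !row_mxEr.
  by rewrite !row_mxEl (inj_eq (@lshift_inj _ _)) !mxE => /negbTE ->.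
have [h1 h2] := B'c c; split=> [r|x r s ix].
  exact: (eq_rect_r (fun f => C1_on (chart_cod i) f) (h1 r) (E r)).
apply: (etrans (congr1 (fun f => 'D_(delta_mx 0 r) f x) (E s))).
apply: (etrans (h2 x r s ix)).
exact: (congr1 (fun f => 'D_(delta_mx 0 s) f x) (esym (E r))).
Qed.

Lemma theta_col_divergence i b t x : chart_cod i x ->
  \det (theta_col i b t x) =
  \sum_r 'D_(delta_mx 0 r) (fun y => coef i a b y * cof k0 (theta_col i b t) r y) x.
Proof.
move=> ix; have oi := @chart_cod_open _ _ M i.
apply: esym; apply: (etrans (divergence_det oi _ _ (@coef_C1 _ _ _ a i b aC) ix)).
- by move=> r c ck; exact: (theta_col_closed i b t ck).1.
- by move=> y r s c iy ck; exact: (theta_col_closed i b t ck).2.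
congr (\det _); apply/matrixP => r c; rewrite mxE; case: eqP => // ->.
by rewrite /theta_col /k0 row_mxEr row_mxEl mxE.
Qed.

Lemma lsum_theta i (K : set 'rV[R]_m) : compact K -> K `<=` chart_cod i ->
  (forall x w, chart_cod i x -> ~ K x -> local_form i a x w = 0) ->
  lsum N (zext (chart_cod i) (fun x => local_form i theta x 1%:M)) @[N --> \oo] --> 0.
Proof.
move=> cK Ki a0; have oi := @chart_cod_open _ _ M i.
pose h b t r y := coef i a b y * cof k0 (theta_col i b t) r y.
have hC b t r : C1_on (chart_cod i) (h b t r).
  apply: C1_M => //; first exact: coef_C1.
  by apply: cof_C1 => // q c ck; exact: (theta_col_closed i b t ck).1.
have h0 b t r x : chart_cod i x -> ~ K x -> h b t r x = 0.
  by move=> ix nKx; rewrite /h /coef a0// mul0r.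
have clK : closed K by apply: compact_closed => //; exact: norm_hausdorff.
have lim0 b t r := lsum_divergence r oi cK Ki (h0 b t r) (hC b t r).
pose z b t r := zext (chart_cod i) (fun x => 'D_(delta_mx 0 r) (h b t r) x).
have zs b t r : exists q, supp_in q (z b t r).
  apply: (compact_supp_in cK); exact: (derive_zext_supp oi clK Ki (h0 b t r)).
have E x : zext (chart_cod i) (fun x => local_form i theta x 1%:M) x =
    theta_cst * \sum_(b : 'I_m) \sum_(t <- exp_idx k) \sum_(r : 'I_m) z b t r x.
  have [ix|nix] := pselect (chart_cod i x).
    rewrite zextE// local_theta//; congr (_ * _); apply: eq_bigr => b _.
    apply: eq_bigr => t _; rewrite mul1mx.
    apply: (etrans (theta_col_divergence b t ix)); apply: eq_bigr => r _.
    by apply: esym; exact: zextE.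
  rewrite zext0// big1 ?mulr0// => b _; apply: big1 => t _; apply: big1 => r _.
  by rewrite /z zext0.
have L N : lsum N (zext (chart_cod i) (fun x => local_form i theta x 1%:M)) =
    theta_cst * \sum_(b : 'I_m) \sum_(t <- exp_idx k) \sum_(r : 'I_m) lsum N (z b t r).
  rewrite (eq_lsum N E) lsumZ; congr (_ * _).
  rewrite lsum_sum => [|b]; last by do 2 apply: supp_in_sum => ?; exact: zs.
  apply: eq_bigr => b _; rewrite lsum_sum => [|t]; last by apply: supp_in_sum => ?; exact: zs.
  by apply: eq_bigr => t _; rewrite lsum_sum.
have H : \sum_(b : 'I_m) \sum_(t <- exp_idx k) \sum_(r : 'I_m) lsum N (z b t r)
    @[N --> \oo] --> \sum_(b : 'I_m) \sum_(t <- exp_idx (n := 2 + k * 2) k) \sum_(r : 'I_m) (0 : R).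
  have FF : Filter (\oo : set_system nat) by typeclasses eauto.
  have H1 b t := @cvg_sumr R nat \oo FF 'I_m (index_enum _) _ _ (fun r => lim0 b t r).
  have H2 b := @cvg_sumr R nat \oo FF (seq 'I_m) (exp_idx k) _ _ (H1 b).
  have H3 := @cvg_sumr R nat \oo FF 'I_m (index_enum _) _ _ H2.
  exact: H3.
rewrite big1 in H; last by move=> b _; rewrite big1// => t _; rewrite big1.
have C := cvgM (@cvg_cst _ theta_cst nat \oo _) H; rewrite mulr0 in C.
by rewrite (eq_cvg _ _ L); exact: C.
Qed.

End LocalStokes.

(** * Partition of unity of class C^1 *)

Section SquaredPositivePart.
Context {R : realType}.

Lemma pospart_sqr_taylor (t s : R) :
  `|pospart (t + s) ^+ 2 - pospart t ^+ 2 - 2 * s * pospart t| <= s ^+ 2.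
Proof.
rewrite /pospart ler_norml; case: (leP 0 t) => t0; case: (leP 0 (t + s)) => ts;
  apply/andP; split; nra.
Qed.

Lemma pospart_continuous : continuous (@pospart R).
Proof.
by move=> t; apply: continuous_max; [exact: cst_continuous|exact: cvg_id].
Qed.

Lemma derive_pospart_sqr (t : R) :
  is_derive t 1 (fun s => pospart s ^+ 2 : R) (2 * pospart t).
Proof.
have H : (fun h : R => h^-1 *: (((fun s => pospart s ^+ 2 : R) \o shift t) (h *: 1) -
    pospart t ^+ 2)) @ 0^' --> 2 * pospart t.
  apply/cvgrPdist_le => e e0; near=> h.
  have h0 : h != 0 by near: h; exact: nbhs_dnbhs_neq.
  have he : `|h| <= e by near: h; exact: dnbhs0_le.
  rewrite /= /shift /= /GRing.scale /= mulr1 [h + t]addrC.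
  have -> : 2 * pospart t - h^-1 * (pospart (t + h) ^+ 2 - pospart t ^+ 2) =
    - (h^-1 * (pospart (t + h) ^+ 2 - pospart t ^+ 2 - 2 * h * pospart t)) by field.
  rewrite normrN normrM normfV ler_pdivrMl ?normr_gt0//.
  apply: le_trans (pospart_sqr_taylor t h) _.
  by rewrite -real_normK ?num_real// expr2 ler_wpM2l.
apply: DeriveDef; first by apply/cvg_ex; exists (2 * pospart t).
exact: cvg_lim H.
Unshelve. all: by end_near. Qed.

Lemma C1_pospart_sqr m (U : set 'rV[R]_m) h : open U -> C1_on U h ->
  C1_on U (fun x => pospart (h x) ^+ 2).
Proof.
move=> oU h1; pose sq (s : R) := pospart s ^+ 2 : R.
have dsq t : differentiable sq t.
  by apply/derivable1_diffP; have [] := derive_pospart_sqr t.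
have dsqE t s : 'd sq t s = s * (2 * pospart t).
  have -> : 'd sq t s = s *: 'D_1 sq t.
    by rewrite (deriveE _ (dsq t)) -linearZ /GRing.scale /= mulr1.
  by have [_ ->] := derive_pospart_sqr t.
move=> x Ux; split=> [|v]; first exact: differentiable_comp (h1 x Ux).1 (dsq _).
apply: (@continuous_near _ _ _ (fun y => 'D_v h y * (2 * pospart (h y)))).
  apply: (open_near oU) => // y Uy; have dh := (h1 y Uy).1; apply: esym.
  apply: (etrans (deriveE _ (differentiable_comp dh (dsq _)))).
  apply: (etrans (congr1 (@^~ v) (diff_comp dh (dsq _)))).
  by apply: (etrans (dsqE _ _)); congr (_ * _); apply: esym; exact: deriveE.
apply: continuousM; first exact: (h1 x Ux).2.
apply: continuousM; first exact: cst_continuous.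
apply: (@continuous_comp _ _ _ h (@pospart R)); first exact: C1_continuous Ux.
exact: pospart_continuous.
Qed.

End SquaredPositivePart.

Section Bump.
Context {R : realType} {m : nat}.

(** The squared Euclidean distance is polynomial and the squared positive part is C^1, so the bump
    is C^1. Its support lies in the sup-norm ball as well, which contains the Euclidean one. *)
Definition bump (x0 : 'rV[R]_m) (r : R) (x : 'rV[R]_m) : R :=
  pospart (r ^+ 2 - \sum_i (x 0 i - x0 0 i) ^+ 2) ^+ 2.

Lemma bump_ge0 x0 r x : 0 <= bump x0 r x.
Proof. exact: sqr_ge0. Qed.

Lemma C1_coord (b : 'I_m) : C1_on setT (fun x : 'rV[R]_m => x 0 b).
Proof.
move=> x _; split=> [|v]; first exact: differentiable_coord.
have -> : (fun y : 'rV[R]_m => 'D_v (fun x : 'rV[R]_m => x 0 b) y) = cst (v 0 b).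
  by apply/funext => y; exact: derive_coord.
exact: cst_continuous.
Qed.

Lemma C1_bump x0 r : C1_on setT (bump x0 r).
Proof.
apply: C1_pospart_sqr; first exact: openT.
apply: C1_D; [exact: openT|exact: C1_cst|apply: C1_N; first exact: openT].
apply: C1_sum => [|i]; first exact: openT.
have h : C1_on setT (fun x : 'rV[R]_m => x 0 i - x0 0 i).
  apply: C1_D; [exact: openT|exact: C1_coord|exact: C1_cst].
exact: (C1_M openT h h).
Qed.

Lemma bump_center x0 r : 0 < r -> 0 < bump x0 r x0.
Proof.
move=> r0; rewrite /bump big1 => [|i _]; last by rewrite subrr expr0n.
rewrite subr0 /pospart exprn_even_gt0//= gt_eqF// lt_max exprn_gt0// orbT//.
Qed.

Lemma bump_supp x0 r x : 0 < r -> bump x0 r x != 0 -> `|x0 - x| <= r.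
Proof.
move=> r0 bx; have : 0 < r ^+ 2 - \sum_i (x 0 i - x0 0 i) ^+ 2.
  rewrite ltNge; apply: contra bx => h; rewrite /bump /pospart.
  by have /max_idPl -> := h; rewrite expr0n.
rewrite subr_gt0 => h; apply: mx_norm_le => [|i j]; first exact: ltW.
rewrite ord1 !mxE distrC -(@ler_pXn2r _ 2)// ?nnegrE ?(ltW r0)//.
rewrite real_normK ?num_real//; apply: le_trans (ltW h).
by rewrite (bigD1 j)//= lerDl sumr_ge0// => c _; exact: sqr_ge0.
Qed.

End Bump.

(** Near-covering compactness for the filter on lists generated by the sets of lists containing a
    given list: a point q is covered as soon as the list contains q, and likewise near q, so some
    list serves all points. *)
Lemma finite_subcover (T : topologicalType) (V : T -> set T) : compact [set: T] ->
  (forall p, open (V p) /\ V p p) ->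
  exists s : seq T, forall q, exists2 p, p \in s & V p q.
Proof.
move=> /compact_near_coveringP cT HV.
pose F : set_system (seq T) :=
  [set P | exists s0 : seq T, forall s : seq T, {subset s0 <= s} -> P s].
have FF : Filter F.
  split=> [|P Q [s1 h1] [s2 h2]|P Q PQ [s1 h1]].
  - by exists [::].
  - exists (s1 ++ s2) => s hs; split; [apply: h1|apply: h2] => x xs;
      apply: hs; by rewrite mem_cat xs ?orbT.
  - by exists s1 => s /h1 /PQ.
have [q _|s0 h] := cT _ F (fun s q => exists2 p, p \in s & V p q) FF.
  have [oV Vq] := HV q.
  exists (V q, [set s : seq T | q \in s]) => /=; last by move=> [x s] /= [Vx qs]; exists q.
  split; first by apply: open_nbhs_nbhs.
  by exists [:: q] => s; apply; rewrite mem_head.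
by exists s0 => q; exact: (h s0 (fun _ => id) q I).
Qed.

Section PartitionOfUnity.
Context {R : realType} {n : nat}.
Let m := n.+1.
Context {M : oriented_manifold R m}.
Implicit Types (i j : chart_index M) (x : 'rV[R]_m) (p q : M).

Definition C1_fun (f : M -> R) :=
  forall i, C1_on (chart_cod i) (fun x => f (chart_inv i x)).

Lemma compact_closed_manifold (K : set M) : compact K -> closed K.
Proof. by apply: compact_closed; exact: manifold_hausdorff. Qed.

(** K is closed because M is Hausdorff, so every chart image is covered by two open sets: one where
    f is h in the coordinates of j, one where f vanishes. *)
Lemma C1_fun_chart j (K : set M) (h : 'rV[R]_m -> R) (f : M -> R) :
  compact K -> K `<=` chart_dom j -> C1_on setT h ->
  (forall q, chart_dom j q -> f q = h (chart j q)) -> (forall q, f q != 0 -> K q) ->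
  C1_fun f.
Proof.
move=> cK Kj h1 fh fK i.
have oi := @chart_cod_open _ _ M i.
have oij := @overlap_open _ _ M i j.
have H1 : C1_on (overlap i j) (fun x => f (chart_inv i x)).
  apply: (@C1_ext _ _ _ (fun x => h (trans i j x)) _ oij).
    by move=> x ij; rewrite fh//; exact: ij.2.
  by apply: (C1_comp oij openT) => // b; exact: trans_C1.
pose V := [set x | chart_cod i x /\ (~` K) (chart_inv i x)].
have oV : open V.
  apply: open_preimage_in => //; last exact: chart_inv_cont.
  by apply: closed_openC; exact: compact_closed_manifold.
have H2 : C1_on V (fun x => f (chart_inv i x)).
  apply: (@C1_ext _ _ _ (fun=> 0) _ oV); last exact: C1_cst.
  by move=> x [_ nK]; apply/esym/eqP/negPn/negP => /fK.
move=> x ix; have [Kx|nKx] := pselect (K (chart_inv i x)).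
  by apply: H1; split=> //; exact: Kj.
exact: H2.
Qed.

Lemma bump_fun_exists p : exists (K : set M) (b : M -> R), [/\ compact K,
  K `<=` chart_dom (chart_at p), (forall q, 0 <= b q), (forall q, b q != 0 -> K q) &
  C1_fun b /\ exists2 O : set M, open O & O p /\ forall q, O q -> 0 < b q].
Proof.
set c := chart_at p; have cp : chart_dom c p by exact: chart_at_mem.
have cx : chart_cod c (chart c p) by exact: chart_mem.
have : \forall x \near chart c p, chart_cod c x.
  by apply: open_nbhs_nbhs; split=> //; exact: chart_cod_open.
move=> /nbhs_normP[d /= d0 dP].
pose r := d / 2; have r0 : 0 < r by rewrite divr_gt0.
have rd : r < d by rewrite ltr_pdivrMr// mulr_natr mulr2n ltrDl.
pose B : set 'rV[R]_m := [set x | `|chart c p - x| <= r].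
have Bc : B `<=` chart_cod c by move=> x Bx; apply: dP; exact: le_lt_trans Bx rd.
have cB : compact B.
  apply: bounded_closed_compact.
    exists (r + `|chart c p|); split; first exact: num_real.
    move=> s rs x Bx; rewrite -[x](subKr (chart c p)) addrC.
    apply: le_trans (ler_normD _ _) _; rewrite normrN (le_trans _ (ltW rs))//.
    by rewrite lerD2r.
  have -> : B = closed_ball (chart c p) r by rewrite closed_ballE.
  exact: closed_ball_closed.
pose K := chart_inv c @` B.
have Kc : K `<=` chart_dom c by move=> _ [x Bx <-]; apply: chart_inv_mem; exact: Bc.
have cK : compact K.
  apply: compact_image_continuous => // x Bx; apply: chart_inv_cont.
  by rewrite inE; exact: Bc.
pose b q := if `[< chart_dom c q >] then bump (chart c p) r (chart c q) else 0.
have bE q : chart_dom c q -> b q = bump (chart c p) r (chart c q).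
  by move=> cq; rewrite /b asboolT.
have b0 q : ~ chart_dom c q -> b q = 0 by move=> cq; rewrite /b asboolF.
have bK q : b q != 0 -> K q.
  have [cq|ncq] := pselect (chart_dom c q); last by rewrite b0// eqxx.
  rewrite bE// => /(bump_supp r0) h; exists (chart c q) => //; exact: chartK.
exists K, b; split=> //.
  move=> q; have [cq|ncq] := pselect (chart_dom c q); last by rewrite b0.
  by rewrite bE//; exact: bump_ge0.
split; first exact: (C1_fun_chart cK Kc (@C1_bump _ _ (chart c p) r) bE bK).
exists [set q | chart_dom c q /\ [set x | 0 < bump (chart c p) r x] (chart c q)].
  apply: open_preimage_in; [exact: chart_dom_open| |exact: chart_cont].
  have bc : continuous (bump (chart c p) r).
    by move=> x; exact: (C1_continuous (@C1_bump _ _ (chart c p) r) (I : setT x)).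
  have := @open_comp _ _ (bump (chart c p) r) [set s | 0 < s] (fun x _ => bc x) (@open_gt R 0).
  by [].
split; first by split=> //; exact: bump_center.
by move=> q [cq h]; rewrite bE.
Qed.

Lemma C1_fun_sum (s : seq M) (f : M -> M -> R) : (forall p, C1_fun (f p)) ->
  C1_fun (fun q => \sum_(p <- s) f p q).
Proof. by move=> f1 i; apply: C1_sum => [|p]; [exact: chart_cod_open|exact: f1]. Qed.

Lemma partition_of_unity : compact [set: M] ->
  exists (s : seq M) (rho : M -> M -> R) (K : M -> set M),
  [/\ forall p, compact (K p) /\ K p `<=` chart_dom (chart_at p),
      forall p q, 0 <= rho p q,
      forall p q, rho p q != 0 -> K p q,
      forall p, C1_fun (rho p) &
      forall q, \sum_(p <- s) rho p q = 1].
Proof.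
move=> cM; have [K H] := choice (@bump_fun_exists).
have {H}[b H] := choice H.
have HO p : exists W : set M, [/\ open W, W p & forall q, W q -> 0 < b p q].
  by have [_ _ _ _ [_ [W oW [Wp Wb]]]] := H p; exists W.
have [V VP] := choice HO.
have [p|s scov] := @finite_subcover M V cM; first by have [] := VP p.
pose sigma q := \sum_(p <- s) b p q.
have b_ge0 p q : 0 <= b p q by have [_ _ + _ _] := H p; apply.
have sigma_gt0 q : 0 < sigma q.
  have [p ps Vpq] := scov q; have [_ _ Vb] := VP p.
  rewrite /sigma (big_rem p)//= ltr_pwDl ?Vb// sumr_ge0// => ? _; exact: b_ge0.
have b1 p : C1_fun (b p) by have [_ _ _ _ []] := H p.
exists s, (fun p q => b p q / sigma q), K; split.
- by move=> p; have [] := H p.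
- by move=> p q; rewrite divr_ge0// ltW.
- move=> p q; rewrite mulf_eq0 negb_or => /andP[bq _].
  by have [_ _ _ + _] := H p; apply.
- move=> p i; have oi := @chart_cod_open _ _ M i; apply: C1_M => //; first exact: b1.
  apply: C1_V => // [x _|]; first by rewrite gt_eqF.
  exact: (C1_fun_sum s b1).
- by move=> q; rewrite -mulr_suml -/(sigma q) divff ?gt_eqF.
Qed.

End PartitionOfUnity.

(** * Independence of the chart *)

Section ChartIntegrals.
Context {R : realType} {n : nat}.
Let m := n.+1.
Context {M : oriented_manifold R m}.
Implicit Types (i j : chart_index M) (x : 'rV[R]_m) (p q : M).

Definition density (w : M -> R) (T : diff_form M m) i : 'rV[R]_m -> R :=
  zext (chart_cod i) (fun x => w (chart_inv i x) * local_form i T x 1%:M).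

Context (T : diff_form M m) (w : M -> R) (K : set M)
  (Ttop : forall i x A, chart_cod i x ->
    local_form i T x A = \det A * local_form i T x 1%:M)
  (Tc : forall i x, chart_cod i x -> {for x, continuous (fun y => local_form i T y 1%:M)})
  (wc : forall i x, chart_cod i x -> {for x, continuous (fun y => w (chart_inv i y))})
  (cK : compact K)
  (wT0 : forall p, ~ K p -> w p = 0 \/ T p = 0).

Lemma chart_compact i : K `<=` chart_dom i ->
  compact (chart i @` K) /\ chart i @` K `<=` chart_cod i.
Proof.
move=> Ki; split; last by move=> _ [p Kp <-]; apply: chart_mem; exact: Ki.
by apply: compact_image_continuous => // p Kp; apply: chart_cont; rewrite inE; exact: Ki.
Qed.

Lemma density_off i x : chart_cod i x -> ~ (chart i @` K) x ->
  w (chart_inv i x) * local_form i T x 1%:M = 0.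
Proof.
move=> ix nK; have /wT0[->|T0] : ~ K (chart_inv i x).
- by move=> Kx; apply: nK; exists (chart_inv i x) => //; rewrite chart_invK.
- by rewrite mul0r.
- by rewrite /local_form T0 mulr0.
Qed.

Lemma density_supp i x : density w T i x != 0 -> chart_cod i x /\ (chart i @` K) x.
Proof.
move=> dx; have [ix|nix] := pselect (chart_cod i x).
  split=> //; exact: (zext_supp (@density_off i) dx).
by move: dx; rewrite /density zext0// eqxx.
Qed.

Lemma density_continuous i : K `<=` chart_dom i -> continuous (density w T i).
Proof.
move=> Ki; have [cKi Kci] := chart_compact Ki.
apply: zext_continuous Kci (@density_off i) _.
- exact: chart_cod_open.
- by apply: compact_closed => //; exact: norm_hausdorff.
- by move=> x ix; apply: continuousM; [exact: wc|exact: Tc].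
Qed.

Lemma density_supp_in i : K `<=` chart_dom i -> exists r, supp_in r (density w T i).
Proof.
move=> Ki; have [cKi Kci] := chart_compact Ki.
by apply: compact_supp_in cKi _ => x /density_supp[].
Qed.

(** A coordinate change multiplies the coefficient of a top form by its Jacobian determinant; the
    orientation makes that determinant positive, as [lsum_cov] requires. K need only contain the
    points where neither w nor T vanishes, so it can be an intersection of two supports. *)
Lemma lsum_chart_change i j : K `<=` chart_dom i -> K `<=` chart_dom j ->
  lsum N (density w T i) - lsum N (density w T j) @[N --> \oo] --> 0.
Proof.
move=> Ki Kj; have [cKi Kci] := chart_compact Ki.
apply: (@lsum_cov _ _ (overlap i j) (overlap j i) (chart i @` K) (trans i j) (trans j i)
  (transition_mx i j)) => //.
- exact: overlap_open.
- move=> _ [p Kp <-]; split; first by apply: chart_mem; exact: Ki.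
  by rewrite chartK; [exact: Kj|exact: Ki].
- by move=> b; exact: trans_C1.
- by move=> x ij; split; [exact: trans_overlap|exact: transK].
- by move=> y ji; apply: differentiable_continuous; exact: trans_differentiable.
- by move=> x r b; exact: transition_mxE.
- by move=> x; exact: transition_det_gt0.
- move=> x ij; have ji := trans_overlap ij.
  rewrite /density zextE; last exact: ij.1.
  rewrite zextE; last exact: ji.1.
  rewrite chart_inv_trans// mulrCA; congr (_ * _).
  apply: (etrans (local_form_trans _ _ ij)); rewrite mul1mx.
  by apply: Ttop; exact: ji.1.
- exact: density_continuous.
- exact: density_continuous.
- by move=> x /density_supp[].
- move=> y /density_supp[jy [q Kq yE]]; exists (chart i q); first by exists q.
  by rewrite /trans chartK//; exact: Ki.
Qed.

End ChartIntegrals.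

(** * Stokes on the closed manifold *)

Section GlobalStokes.
Context {R : realType} {k : nat}.
Let m := (1 + (2 + k * 2))%N.
Context {M : oriented_manifold R m}.
Implicit Types (i j : chart_index M) (x : 'rV[R]_m) (p q : M) (a : diff_form M 1).
Context (mu lam : diff_form M 1) (muC : C1_form mu) (dmu : ext_d mu = 0)
  (slam : smooth_form lam).

Lemma theta_top a i x A : C1_form a -> chart_cod i x ->
  local_form i (theta mu lam a) x A = \det A * local_form i (theta mu lam a) x 1%:M.
Proof.
move=> aC ix; rewrite !local_theta// mulrCA; congr (_ * _).
rewrite mulr_sumr; apply: eq_bigr => b _; rewrite mulr_sumr; apply: eq_bigr => t _.
by rewrite !det_mulmx det1 mul1r.
Qed.

Lemma theta_continuous a i x : C1_form a -> chart_cod i x ->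
  {for x, continuous (fun y => local_form i (theta mu lam a) y 1%:M)}.
Proof.
move=> aC ix; have oi := @chart_cod_open _ _ M i.
apply: (@continuous_near _ _ _ (fun y => theta_cst * \sum_(b : 'I_m)
    \sum_(t <- exp_idx (n := 2 + k * 2) k) \det (theta_col mu lam a i b t y))).
  apply: (open_near oi) => // y iy; apply: esym.
  apply: (etrans (local_theta muC slam aC _ iy)); congr (_ * _).
  by apply: eq_bigr => b _; apply: eq_bigr => t _; rewrite mul1mx.
apply: continuousM; first exact: cst_continuous.
have FF : Filter (nbhs x) by typeclasses eauto.
apply: (@cvg_sumr _ _ (nbhs x) FF) => b; apply: (@cvg_sumr _ _ (nbhs x) FF) => t.
apply: continuous_det; apply: continuous_mx => r c.
(* In the exceptional column the entries are first derivatives of C^1 coefficients, hence continuous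
   and no better; the other columns are C^1. *)
have [ck0|ck0] := eqVneq c (rshift 1 (lshift (k * 2) ord0)); last first.
  exact: (C1_continuous ((@theta_col_closed _ _ _ mu lam a muC dmu slam i b t c ck0).1 r) ix).
have E : (fun y => theta_col mu lam a i b t y r c) =
    (fun y => 'D_(delta_mx 0 r) (coef i a b) y).
  by apply/funext => y; rewrite ck0 /theta_col row_mxEr row_mxEl mxE.
apply: (eq_rect_r (fun f => {for x, continuous f}) _ E).
exact: (@coef_C1 _ _ _ a i b aC x ix).2.
Qed.

Lemma theta_sum (s : seq M) (a : M -> diff_form M 1) b p A :
  (forall B, ext_d b p B = \sum_(l <- s) ext_d (a l) p B) ->
  theta mu lam b p A = \sum_(l <- s) theta mu lam (a l) p A.
Proof.
move=> bE; rewrite /theta /wedge_prod -mulr_sumr; congr (_ * _).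
rewrite exchange_big/=; apply: eq_bigr => u _.
rewrite -mulr_sumr; congr (_ * _); rewrite -mulr_sumr; congr (_ * _).
rewrite -mulr_sumr; congr (_ * _); rewrite exchange_big/=; apply: eq_bigr => v _.
by rewrite -mulr_sumr -mulr_suml bE.
Qed.

Lemma theta0 a p : ext_d a p = 0 -> theta mu lam a p = 0.
Proof.
move=> a0; apply/funext => A; rewrite /theta /wedge_prod big1 ?mulr0// => u _.
rewrite [X in _ * (_ * (_ * X))]big1 ?mulr0// => v _.
by rewrite a0 mul0r mulr0.
Qed.

Definition scale_form (f : M -> R) a : diff_form M 1 := fun p A => f p * a p A.

Lemma C1_scale_form f a : C1_fun f -> C1_form a -> C1_form (scale_form f a).
Proof.
move=> f1 [al ac]; split=> [p B C D r s t E1 E2 E3|i A].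
  by rewrite /scale_form (al p _ _ _ _ _ _ E1 E2 E3); ring.
exact: (C1_M (@chart_cod_open _ _ M i) (f1 i) (ac i A)).
Qed.

Lemma ext_d_sum (s : seq M) (rho : M -> M -> R) p A : (forall l, C1_fun (rho l)) ->
  (forall q, \sum_(l <- s) rho l q = 1) ->
  ext_d lam p A = \sum_(l <- s) ext_d (scale_form (rho l) lam) p A.
Proof.
move=> rho1 rhoE; have lamC := smooth_C1_form slam.
rewrite ext_d1E; under eq_bigr do rewrite ext_d1E.
set c := chart_at p; have cx : chart_cod c (chart c p) by apply/chart_mem/chart_at_mem.
have D u v : 'D_u (fun y => local_form c lam y v) (chart c p) =
    \sum_(l <- s) 'D_u (fun y => local_form c (scale_form (rho l) lam) y v) (chart c p).
  have -> : (fun y => local_form c lam y v) =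
      (fun y => \sum_(l <- s) local_form c (scale_form (rho l) lam) y v).
    by apply/funext => y; rewrite /local_form /scale_form -mulr_suml rhoE mul1r.
  apply: (derive_sumC1 _ _ _ (@chart_cod_open _ _ M c) cx) => l.
  exact: (C1_scale_form (rho1 l) lamC).2.
by rewrite /dloc sumrB; congr (_ - _); exact: D.
Qed.

Lemma ext_d_scale_off (f : M -> R) (K : set M) p : closed K -> ~ K p ->
  (forall q, f q != 0 -> K q) -> ext_d (scale_form f lam) p = 0.
Proof.
move=> clK nKp fK; apply/funext => A; rewrite ext_d1E.
set c := chart_at p; have cp : chart_dom c p by exact: chart_at_mem.
pose V := [set x | chart_cod c x /\ (~` K) (chart_inv c x)].
have oV : open V.
  by apply: open_preimage_in; [exact: chart_cod_open|exact: closed_openC|exact: chart_inv_cont].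
have Vx : V (chart c p) by split; [exact: chart_mem|rewrite chartK].
have D (u v : 'rV[R]_m) :
    'D_u (fun y => local_form c (scale_form f lam) y v) (chart c p) = 0.
  have E : \forall y \near chart c p, 0 = local_form c (scale_form f lam) y v.
    apply: (open_near oV) => // y [cy nKy]; rewrite /local_form /scale_form.
    have -> : f (chart_inv c y) = 0 by apply/eqP/negPn/negP => /fK.
    by rewrite mul0r.
  by rewrite -(near_eq_derive _ E) derive_cst.
by rewrite /dloc !D subrr.
Qed.

(** The partition is used twice. As a weight, rho_h makes the total sum of rho_h eta in chart h
    meaningful for the positive form eta; inside d, it splits eta into forms T_l supported in one
    chart, where Stokes applies. The products rho_h T_l live in both charts and carry one
    decomposition over to the other. *)
Lemma theta_not_positive : compact [set: M] -> [set: M] !=set0 ->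
  ~ positive_volume (theta mu lam lam).
Proof.
move=> cM [p0 _] etapos; have lamC := smooth_C1_form slam.
have [s [rho [K [cK rho0 rhoK rho1 rhoE]]]] := partition_of_unity cM.
pose a l := scale_form (rho l) lam; pose T l := theta mu lam (a l).
have aC l : C1_form (a l) by apply: C1_scale_form.
pose eta := theta mu lam lam.
have etaE p A : eta p A = \sum_(l <- s) T l p A.
  by apply: theta_sum => B; exact: ext_d_sum.
have clK l : closed (K l) by apply: compact_closed_manifold; exact: (cK l).1.
have T0 l p : ~ K l p -> T l p = 0.
  by move=> nK; apply: theta0; apply: (ext_d_scale_off (clK l)) => // q; exact: rhoK.
have eta_pos i x : chart_cod i x -> 0 < local_form i eta x 1%:M.
  move=> ix; set p := chart_inv i x; set c := chart_at p.
  have ic : overlap i c x by split=> //; exact: chart_at_mem.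
  rewrite (local_form_trans _ _ ic) mul1mx.
  rewrite (theta_top _ lamC (trans_overlap ic).1) mulr_gt0 ?transition_det_gt0//.
  have -> : trans i c x = chart c p by [].
  by rewrite local_form_chart_at; exact: etapos.
have wc l i x : chart_cod i x -> {for x, continuous (fun y => rho l (chart_inv i y))}.
  by move=> ix; exact: C1_continuous (rho1 l i) ix.
have cKK h l : compact (K h `&` K l).
  by apply: compact_closedI; [exact: (cK h).1|exact: clK].
have wT h l p : ~ (K h `&` K l) p -> rho h p = 0 \/ T l p = 0.
  move=> nK; have [Kh|nKh] := pselect (K h p).
    by right; apply: T0 => Kl; apply: nK.
  by left; apply/eqP/negPn/negP => /rhoK.
have Kh h l : K h `&` K l `<=` chart_dom (chart_at h) by move=> p [/(cK h).2].
have Kl h l : K h `&` K l `<=` chart_dom (chart_at l) by move=> p [_ /(cK l).2].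
have change h l := lsum_chart_change (fun i x A => @theta_top _ i x A (aC l))
  (fun i x => @theta_continuous _ i x (aC l)) (wc h) (cKK h l) (wT h l) (Kh h l) (Kl h l).
have supp h l i : K h `&` K l `<=` chart_dom i -> exists r, supp_in r (density (rho h) (T l) i).
  exact: (density_supp_in (cKK h l) (wT h l)).
have FF : Filter (\oo : set_system nat) by typeclasses eauto.
have I1 := @cvg_sumr R nat \oo FF M s _ _
  (fun h => @cvg_sumr R nat \oo FF M s _ _ (change h)).
pose Z l := zext (chart_cod (chart_at l)) (fun x => local_form (chart_at l) (T l) x 1%:M).
have ZL l : lsum N (Z l) @[N --> \oo] --> 0.
  have [cKl Klc] := chart_compact (cK l).1 (cK l).2.
  apply: (lsum_theta muC dmu slam (aC l) cKl Klc) => x v lx nKx.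
  have -> : local_form (chart_at l) (a l) x v =
      rho l (chart_inv (chart_at l) x) * local_form (chart_at l) lam x v by [].
  have -> : rho l (chart_inv (chart_at l) x) = 0.
    apply/eqP/negPn/negP => /rhoK Kx; apply: nKx.
    by exists (chart_inv (chart_at l) x) => //; rewrite chart_invK.
  by rewrite mul0r.
have I2 := @cvg_sumr R nat \oo FF M s _ _ ZL.
(* Each rho_h T_l is moved from chart h to chart l; there the weights rho_h add up to 1 and leave
   T_l alone. *)
have E N : \sum_(h <- s) lsum N (density (rho h) eta (chart_at h)) =
    \sum_(h <- s) \sum_(l <- s) (lsum N (density (rho h) (T l) (chart_at h)) -
      lsum N (density (rho h) (T l) (chart_at l))) + \sum_(l <- s) lsum N (Z l).
  have E1 h : lsum N (density (rho h) eta (chart_at h)) =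
      \sum_(l <- s) lsum N (density (rho h) (T l) (chart_at h)).
    rewrite -lsum_sum => [|l]; last by apply: supp; exact: Kh.
    apply: eq_lsum => x; have [ix|nix] := pselect (chart_cod (chart_at h) x).
      rewrite /density zextE//; under eq_bigr do rewrite zextE//.
      rewrite -mulr_sumr; congr (_ * _); exact: etaE.
    by rewrite /density zext0// big1// => l _; rewrite zext0.
  have E2 l : lsum N (Z l) = \sum_(h <- s) lsum N (density (rho h) (T l) (chart_at l)).
    rewrite -lsum_sum => [|h]; last by apply: supp; exact: Kl.
    apply: eq_lsum => x; have [ix|nix] := pselect (chart_cod (chart_at l) x).
      rewrite /Z /density zextE//; under eq_bigr do rewrite zextE//.
      by rewrite -mulr_suml rhoE mul1r.
    by rewrite /Z /density zext0// big1// => h _; rewrite zext0.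
  under [X in _ = X + _]eq_bigr do rewrite sumrB.
  rewrite sumrB (eq_bigr _ (fun l _ => E2 l)) [X in _ - X + _]exchange_big/= subrK.
  by apply: eq_bigr => h _; exact: E1.
have L0 : \sum_(h <- s) lsum N (density (rho h) eta (chart_at h)) @[N --> \oo] --> (0 : R).
  have Z0 : \sum_(h <- s) \sum_(l <- s) (0 : R) + \sum_(l <- s) (0 : R) = 0.
    have S0 : \sum_(l <- s) (0 : R) = 0 by exact: big1.
    by rewrite S0 addr0; apply: big1 => h _.
  by rewrite (eq_cvg _ _ E); have L := cvgD I1 I2; rewrite Z0 in L; exact: L.
have dens_ge0 h x : 0 <= density (rho h) eta (chart_at h) x.
  have [ix|nix] := pselect (chart_cod (chart_at h) x); last by rewrite /density zext0.
  by rewrite /density zextE// mulr_ge0// ltW// eta_pos.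
have [h hs rhoh] : exists2 h, h \in s & 0 < rho h p0.
  apply: contrapT => H; have := rhoE p0; rewrite big_seq big1 => [/esym/eqP|h hs].
    by rewrite oner_eq0.
  apply/eqP; rewrite eq_le rho0 andbT leNgt; apply/negP => rh.
  by apply: H; exists h.
have Kp0 : K h p0 by apply: rhoK; rewrite gt_eqF.
have hp0 : chart_dom (chart_at h) p0 by exact: (cK h).2.
have wK p : ~ K h p -> rho h p = 0 \/ eta p = 0.
  by move=> nK; left; apply/eqP/negPn/negP => /rhoK.
have [r densr] := density_supp_in (cK h).1 wK (cK h).2.
have densc := density_continuous
  (fun i x => @theta_continuous _ i x lamC) (wc h) (cK h).1 wK (cK h).2.
have [|d d0 dP] := lsum_pos densr (dens_ge0 h) (densc (chart (chart_at h) p0)).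
  rewrite /density zextE; last exact: chart_mem.
  by rewrite chartK// mulr_gt0// eta_pos//; exact: chart_mem.
have d20 : 0 < d / 2 by rewrite divr_gt0.
have /cvgrPdist_le/(_ _ d20) := L0 => L1.
have [N [N1 N2]] := filter_ex (filterI dP L1).
move: N2; rewrite sub0r normrN => N2; have := le_trans (ler_norm _) N2.
apply/negP; rewrite -ltNge; apply: (@lt_le_trans _ _ d).
  by rewrite ltr_pdivrMr// mulr_natr mulr2n ltrDl.
(* The densities are non-negative, so the total is at least the term of h, which is at least d,
   while it has just been bounded by d/2. *)
apply: le_trans N1 _; rewrite (big_rem h)//= lerDl sumr_ge0// => l _.
exact: lsum_ge0.
Qed.

End GlobalStokes.

(** * Contraction with the Reeb field *)

Lemma row0_col_mx (R : realType) (m : nat) (v w : 'rV[R]_m) :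
  row ord0 (col_mx v w : 'M[R]_(2, m)) = v.
Proof. by apply/rowP => r; rewrite !mxE; case: splitP => // j _; rewrite ord1. Qed.

Lemma row1_col_mx (R : realType) (m : nat) (v w : 'rV[R]_m) :
  row ord_max (col_mx v w : 'M[R]_(2, m)) = w.
Proof.
apply/rowP => r; rewrite !mxE; case: splitP => j jE; last by rewrite ord1.
by have := ltn_ord j; rewrite -jE.
Qed.

Section ReebKills.
Context {R : realType} {k : nat}.
Let m := (1 + (2 + k * 2))%N.
Context {M : oriented_manifold R m}.
Implicit Types (p : M) (v w : 'rV[R]_m) (a : diff_form M 1).

Lemma kills_form1 v (f : 'M[R]_(1, m) -> R) : interior_prod v f = 0 -> kills v f.
Proof.
move=> vf A i Ai; have := congr1 (fun g => g (0 : 'M[R]_(0, m))) vf.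
rewrite /interior_prod /=; congr (f _ = _).
apply/matrixP => r c; rewrite mxE; case: splitP => [j _|[]//].
by rewrite -Ai mxE; congr (A _ c); apply/val_inj; move: (ltn_ord r) (ltn_ord i) => /=; lia.
Qed.

(** The contraction inserts v in the first place only; the second place follows by antisymmetry. *)
Lemma kills_ext_d v a p : interior_prod v (ext_d a p) = 0 -> kills v (ext_d a p).
Proof.
move=> va A i Ai.
have H w : dloc (chart_at p) a (chart (chart_at p) p) v w = 0.
  have := congr1 (fun g => g (w : 'M[R]_(1, m))) va.
  rewrite /interior_prod /= ext_d1E.
  have -> : row ord0 (col_mx v w) = v.
    exact: row0_col_mx.
  by rewrite row1_col_mx.
rewrite ext_d1E; have : (i == ord0) || (i == ord_max) by case: i {Ai} => -[|[|]].
move=> /orP[/eqP i0|/eqP i1]; first by rewrite -i0 Ai.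
by rewrite -i1 Ai dloc_antisym H oppr0.
Qed.

Lemma kills_wedge_exp v a p j : kills v (ext_d a p) -> kills v (wedge_exp (ext_d a) j p).
Proof.
move=> va; elim: j => [|j IH] /=; first by move=> A [].
exact: wedgef_kills va IH.
Qed.

Lemma theta_killed (b lam : diff_form M 1) v p : C1_form b -> smooth_form lam -> v != 0 ->
  kills v (b p) -> kills v (ext_d lam p) -> theta b lam lam p 1%:M = 0.
Proof.
move=> bC slam v0 vb vl; have lamC := smooth_C1_form slam.
have cx : chart_cod (chart_at p) (chart (chart_at p) p) by apply/chart_mem/chart_at_mem.
have E A : theta b lam lam p A = \det A * theta b lam lam p 1%:M.
  have := theta_top bC slam A lamC cx; by rewrite !local_form_chart_at.
apply: (top_form_kills E v0).
exact: (wedgef_kills vb (@kills_wedge_exp v lam p k.+1 vl)).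
Qed.

Lemma theta_B (a b lam : diff_form M 1) p A :
  theta (a - b) lam lam p A = theta a lam lam p A - theta b lam lam p A.
Proof.
rewrite /theta /wedge_prod -mulrBr; congr (_ * _); rewrite -sumrB; apply: eq_bigr => u _.
by rewrite -mulrBr -mulrBl.
Qed.

Lemma no_basic_primitive (lam b : diff_form M 1) (X : vector_field M) :
  compact [set: M] -> [set: M] !=set0 -> smooth_form lam ->
  positive_volume (theta lam lam lam) -> reeb_field lam X -> C1_form b ->
  (forall p, interior_prod (X p) (b p) = 0) -> ext_d b <> ext_d lam.
Proof.
move=> cM M0 slam pos [_ reeb] bC bX db; have lamC := smooth_C1_form slam.
have muC := C1_form_B lamC bC.
have dmu : ext_d (lam - b) = 0.
  apply/funext => p; apply/funext => A; rewrite ext_d1E.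
  have cx : chart_cod (chart_at p) (chart (chart_at p) p) by apply/chart_mem/chart_at_mem.
  by rewrite (dloc_B _ _ lamC bC cx) -!ext_d1E db subrr.
apply: (theta_not_positive muC dmu slam cM M0) => p; rewrite theta_B.
have [lX dX] := reeb p.
rewrite (@theta_killed b lam (X p) p)// ?subr0; first exact: pos.
(* The Reeb field has no zero: lam is linear and takes the value 1 on it. *)
- apply/eqP => X0; move: lX; rewrite X0 => l0.
  have := multilinear1P (slam.1 p).1 (-1) 0 0; rewrite scaler0 addr0 l0; lra.
- exact: kills_form1.
- exact: kills_ext_d.
Qed.

End ReebKills.

(** * The class of d lam in basic cohomology *)

Theorem theorem2p1 (R : realType) (n : nat) (n_gt0 : (0 < n)%N)
    (M : oriented_manifold R (n * 2).+1)
    (M_nonempty : [set: M] !=set0) (M_closed : compact [set: M])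
    (lam : diff_form M 1) (lam_contact : contact_form lam)
    (X : vector_field M) (X_reeb : reeb_field lam X) :
  basic_cocycle (foliation_of X) (ext_d lam) /\
  basic_class (foliation_of X) (ext_d lam)
    <> basic_class (foliation_of X) (0 : diff_form M 2).
Proof.
have [slam pos] := lam_contact; have lamC := smooth_C1_form slam.
have cocycle : basic_cocycle (foliation_of X) (ext_d lam).
  split; last exact: ext_d_ext_d.
  split; first exact: smooth_ext_d.
  move=> p _ [t _ <-]; split; last by rewrite ext_d_ext_d.
  have [_ /(_ p)[_ dX]] := X_reeb.
  apply/funext => A; rewrite /interior_prod ext_d1E.
  have cx : chart_cod (chart_at p) (chart (chart_at p) p) by apply/chart_mem/chart_at_mem.
  have := congr1 (fun g => g A) dX.
  rewrite /interior_prod ext_d1E !row0_col_mx !row1_col_mx => dXA.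
  have := dloc_linear t 0 (X p) 0 A lamC cx.
  by rewrite scaler0 addr0 dXA mulr0 mul0r addr0.
split=> // E.
(* Classes are cosets of cocycles: d lam belongs to its own, the difference being d of the zero
   form, hence to that of 0, which consists of coboundaries. *)
have : basic_class (foliation_of X) (ext_d lam) (ext_d lam).
  split=> //; exists 0; last by rewrite ext_d_0 subrr.
  split; first exact: smooth_form_0.
  move=> p Y _; split; first by apply/funext.
  by rewrite ext_d_0; apply/funext.
rewrite E => -[_ [b [sb bF] db]]; rewrite subr0 in db.
have bC := smooth_C1_form sb.
have bX p : interior_prod (X p) (b p) = 0.
  by have [] := bF p (X p); first by exists 1; rewrite ?scale1r.
(* In dimension 1 every 2-form vanishes and so does the class. For n = k + 1 the dimension is
   convertible to 1 + (2 + k * 2), and the contact volume form to [theta lam lam lam]. *)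
case: n n_gt0 M M_nonempty M_closed lam lam_contact X X_reeb slam pos lamC cocycle E
  b sb bF db bC bX => // k _ M M0 cM lam _ X reeb slam pos _ _ _ b _ _ db bC bX.
exact: (@no_basic_primitive R k M lam b X cM M0 slam pos reeb bC bX db).
Qed.
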